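(* Let $k$ be a field and $(R,\mathfrak{m})$ an artinian standard graded local $k$-algebra of embedding dimension $e \ge 3$ and socle degree $2$. If $R$ is not Gorenstein and admits a non-zero minimal acyclic complex $F$ of finitely generated free modules, then the graded local $k$-algebra $$T = R \ltimes \mathsf{\Sigma}\operatorname{Hom}_k(R,k) \quad\text{with maximal ideal}\quad \mathfrak{t} = \mathfrak{m} \ltimes \mathsf{\Sigma}\operatorname{Hom}_k(R,k)$$ is Gorenstein and compressed with Hilbert series $1 + (2e-1)z + (2e-1)z^2 + z^3$. Furthermore, the following hold: (a) $T$ is not complete intersection. (b) If $R$ does not have an exact zero divisor, then neither does $T$. (c) If $H_n(\operatorname{Hom}_R(F,R))=0$ holds for some $n$, then $T/\mathfrak{t}^3$ is not Golod.
   Context: An artinian standard graded local $k$-algebra is a finite-dimensional commutative graded $k$-algebra $R=\bigoplus_{i\ge 0}R_i$ with $R_0=k$, generated as a $k$-algebra by $R_1$; its maximal ideal is $\mathfrak{m}=\bigoplus_{i\ge 1}R_i$. The embedding dimension is the minimal number of generators of the maximal ideal, and the socle degree is the integer $s$ with $\mathfrak{m}^{s+1}=0\ne\mathfrak{m}^s$. A complex $F$ of finitely generated free $R$-modules (indexed by $\mathbb{Z}$) is minimal if $\partial(F)\subseteq\mathfrak{m}F$, and acyclic if $H(F)=0$. $T=R\ltimes \mathsf{\Sigma}\operatorname{Hom}_k(R,k)$ is the trivial extension: as a $k$-vector space it is $R\oplus\operatorname{Hom}_k(R,k)$, with multiplication $(x,\alpha)(y,\beta)=(xy,\,x\beta+y\alpha)$.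 The symbol $\mathsf{\Sigma}$ only indicates a shift in grading: $T$ is graded so that $R_j$ sits in degree $j$ and $\operatorname{Hom}_k(R_j,k)$ sits in degree $3-j$. Hilbert series: $H_T(z)=\sum_i h_T(i)z^i$ with $h_T(i)=\dim_k(\mathfrak{t}^i/\mathfrak{t}^{i+1})$. Compressed: an artinian Gorenstein local ring $T$ of embedding dimension $\epsilon$ and socle degree $s$ is compressed if $h_T(i)=\min\left\{\binom{\epsilon-1+i}{\epsilon-1},\binom{\epsilon-1+s-i}{\epsilon-1}\right\}$ for all $0\le i\le s$ (the inequality $\le$ always holds). Exact zero divisor: an element $a \ne 0$ of a commutative ring that is a zero divisor (so in a local ring $a$ is not a unit) and whose annihilator $(0:a)$ is a principal ideal. Golod ring: for a local ring $(S,\mathfrak{m}_S,k)$ with residue field $k$ the Poincar\'e series is $P^S_k(z)=\sum_{j\ge 0}\dim_k(\operatorname{Tor}^S_j(k,k))\,z^j$. Let $e_S$ be the embedding dimension and $d$ the depth of $S$, and let $K^S$ be the Koszul complex on a minimal set of generators of $\mathfrak{m}_S$. The ring $S$ is called Golod if $$P^S_k(z) = \frac{(1+z)^{e_S}}{1-\sum_{j=1}^{e_S-d}\dim_k(H_j(K^S))\,z^{j+1}}.$$ *)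

(* Defs.v *)
From HB Require Import structures.
From mathcomp Require Import all_boot all_order all_algebra.
From mathcomp Require Import falgebra.

Set Implicit Arguments.
Unset Strict Implicit.
Unset Printing Implicit Defensive.

Import GRing.Theory.
Local Open Scope ring_scope.

#[short(type="comFalgType")]
HB.structure Definition ComFalgebra (K : fieldType) :=
  { A of Vector K A & GRing.ComUnitAlgebra K A }.

Definition in_idl (A : comNzRingType) (s : seq A) (x : A) : Prop :=
  exists c : nat -> A, x = \sum_(i < size s) c i * s`_i.

Definition regular_seq (A : comNzRingType) (s : seq A) : Prop :=
  (forall i, (i < size s)%N ->
     forall a, in_idl (take i s) (a * s`_i) -> in_idl (take i s) a)
  /\ ~ in_idl s 1.

Definition is_ideal (A : comNzRingType) (I : A -> Prop) : Prop :=
  [/\ I 0, forall x y, I x -> I y -> I (x + y) & forall a x, I x -> I (a * x)].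

Definition noetherian (A : comNzRingType) : Prop :=
  forall I : A -> Prop, is_ideal I ->
    exists s : seq A, forall x, I x <-> in_idl s x.

(* The last clause says that the non-units form the ideal (y), so that A is
   local with maximal ideal (y). A noetherian local ring is regular exactly
   when its maximal ideal is generated by a regular sequence. *)
Definition regular_local (A : comNzRingType) : Prop :=
  noetherian A /\
  exists y : seq A, regular_seq y /\
    forall x, (exists u, u * x = 1) <-> ~ in_idl y x.

(* The completion of A is a regular local ring modulo a regular sequence.
   This is only used for artinian local rings, which are complete. *)
Definition complete_intersection (A : comNzRingType) : Prop :=
  exists (Q : comNzRingType) (f : seq Q) (phi : {rmorphism Q -> A}),
    [/\ regular_local Q, regular_seq f, forall a, exists q, phi q = a
      & forall q, phi q = 0 <-> in_idl f q].

Definition exact_zero_divisor (A : comNzRingType) (a : A) : Prop :=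
  [/\ a != 0, exists2 b, b != 0 & a * b = 0
    & exists c, forall x, x * a = 0 <-> exists y, x = y * c].

Definition injective_module (A : comNzRingType) (E : lmodType A) : Prop :=
  forall (M N : lmodType A) (i : {linear M -> N}) (f : {linear M -> E}),
    injective i -> exists g : {linear N -> E}, forall x, g (i x) = f x.

Fixpoint injdim_le (A : comNzRingType) (n : nat) (M : lmodType A) : Prop :=
  if n is n'.+1 then
    exists (E C : lmodType A) (f : {linear M -> E}) (g : {linear E -> C}),
      [/\ injective_module E, injective f, forall y, exists x, g x = y,
          forall x, g x = 0 <-> exists w, f w = x & injdim_le n' C]
  else injective_module M.

(* Finite self-injective dimension; meant for noetherian local rings. *)
Definition gorenstein (A : comNzRingType) : Prop :=
  exists n, injdim_le n A^o.

(* A is meant to be an artinian local algebra k (+) m with residue field k;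
   its maximal ideal m is passed explicitly. *)

Section Local.
Variables (k : fieldType) (A : comFalgType k) (m : {vspace A}).

(* U ^+ 0 is the line spanned by 1, hence the factor fullv, which turns it
   into the unit ideal and changes nothing for n > 0. *)
Definition ideal_pow (n : nat) : {vspace A} := (fullv * m ^+ n)%VS.

Definition hilb (i : nat) : nat := (\dim (ideal_pow i) - \dim (ideal_pow i.+1))%N.

Definition socle_degree (s : nat) : Prop :=
  ideal_pow s.+1 = 0%VS /\ ideal_pow s != 0%VS.

Definition generates (s : seq A) : Prop := forall a, a \in m <-> in_idl s a.

Definition minimal_generators (s : seq A) : Prop :=
  generates s /\ forall s' : seq A, generates s' -> (size s <= size s')%N.

Definition embdim (e : nat) : Prop :=
  exists2 s : seq A, minimal_generators s & size s = e.

Definition depth (d : nat) : Prop :=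
  (exists s : seq A, [/\ all [in m] s, regular_seq s & size s = d]) /\
  (forall s : seq A, all [in m] s -> regular_seq s -> (size s <= d)%N).

Definition compressed : Prop :=
  exists e s, [/\ gorenstein A, embdim e, socle_degree s
    & forall i, (i <= s)%N ->
        hilb i = minn 'C(e.-1 + i, e.-1) 'C(e.-1 + (s - i), e.-1)].

(* A is graded with degree 0 part k and maximal ideal m, the sum of the parts
   of positive degree. Directness forces G i = 0 for all i >= n. *)
Definition graded_local (G : nat -> {vspace A}) : Prop :=
  [/\ G 0%N = 1%VS,
      forall i j x y, x \in G i -> y \in G j -> x * y \in G (i + j)%N,
      forall n, directv (\sum_(i < n) G i)
    & exists n, fullv = (\sum_(0 <= i < n) G i)%VS /\
                m = (\sum_(1 <= i < n) G i)%VS].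

Definition standard_graded_local (G : nat -> {vspace A}) : Prop :=
  graded_local G /\ agenv (G 1%N) = fullv.

(* The projection A -> A / m = k: the coordinate along 1 in A = k1 (+) m. *)
Definition residue (x : A) : k :=
  coord [tuple (1 : A)] ord0 (daddv_pi 1%VS m x).

(* A resolution ... -> P_1 -> P_0 -> k -> 0 by finitely generated free
   A-modules P_j = A^(res_rank j). Here and below matrices act on row vectors
   from the right. *)
Record resolution := Resolution {
  res_rank : nat -> nat;
  res_diff : forall j, 'M[A]_(res_rank j.+1, res_rank j);
  res_aug : 'cV[k]_(res_rank 0);
  res_aug_surj : forall c : 'M[k]_1,
    exists v : 'rV[A]_(res_rank 0), map_mx residue v *m res_aug = c;
  res_exact0 : forall v : 'rV[A]_(res_rank 0),
    map_mx residue v *m res_aug = 0 <-> exists w, v = w *m res_diff 0;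
  res_exactS : forall j (v : 'rV[A]_(res_rank j.+1)),
    v *m res_diff j = 0 <-> exists w, v = w *m res_diff j.+1 }.

(* dim_k Tor_j(k, k) = dim_k H_j(P (x) k); independent of P. *)
Definition tor_dim (P : resolution) (j : nat) : nat :=
  (res_rank P j
   - (if j is i.+1 then \rank (map_mx residue (res_diff P i)) else 0)
   - \rank (map_mx residue (res_diff P j)))%N.

(* The Koszul complex on x_0, ..., x_{e-1} has basis e_B, B a subset of 'I_e,
   and f represents the sum of the f(B) e_B. Removing x_i from i |: B carries
   the sign (-1)^(number of elements of B below i). *)
Definition koszul_diff (e : nat) (x : e.-tuple A) (f : {ffun {set 'I_e} -> A}) :
    {ffun {set 'I_e} -> A} :=
  [ffun B : {set 'I_e} => \sum_(i | i \notin B)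
     (-1) ^+ #|[set j in B | (j < i)%N]| * tnth x i * f (i |: B)].

Definition koszul_part (e j : nat) : {vspace {ffun {set 'I_e} -> A}} :=
  limg (linfun (fun f : {ffun {set 'I_e} -> A} =>
                  [ffun B : {set 'I_e} => if #|B| == j then f B else 0])).

Definition koszul_dim (e : nat) (x : e.-tuple A) (j : nat) : nat :=
  let d := linfun (koszul_diff x) in
  (\dim (lker d :&: koszul_part e j) - \dim (d @: koszul_part e j.+1))%N.

(* P(z) * (1 - sum_j h_j z^(j+1)) = (1 + z)^e, coefficient by coefficient. The
   choices of x and P do not matter. *)
Definition golod : Prop :=
  forall (e d : nat) (x : e.-tuple A) (P : resolution),
    minimal_generators x -> depth d ->
    let den : {poly int} :=
      1 - \sum_(1 <= j < (e - d).+1) (koszul_dim x j)%:Z *: 'X^(j.+1) in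
    forall n, \sum_(i < n.+1) (tor_dim P (n - i))%:Z * den`_i
              = ((1 + 'X) ^+ e : {poly int})`_n.

(* Complexes of finitely generated free modules F_n = A^(crank n), with
   cdiff n : F_n -> F_(n - 1). *)
Record complex := Complex {
  crank : int -> nat;
  cdiff : forall n : int, 'M[A]_(crank n, crank (n - 1));
  cdiff2 : forall n, cdiff n *m cdiff (n - 1) = 0 }.

Definition nonzero_complex (F : complex) : Prop := exists n, crank F n != 0%N.

Definition minimal_complex (F : complex) : Prop :=
  forall n (v : 'rV[A]_(crank F n)) j, (v *m cdiff F n) 0 j \in m.

(* Exactness at F_(n - 1), for all n. *)
Definition acyclic (F : complex) : Prop :=
  forall n (v : 'rV[A]_(crank F (n - 1))),
    v *m cdiff F (n - 1) = 0 -> exists w, v = w *m cdiff F n.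

(* Exactness of Hom_A(F, A) at Hom_A(F_(n - 1), A), that is,
   H_(1 - n)(Hom_A(F, A)) = 0. A column phi stands for the map v |-> v *m phi. *)
Definition dual_exact_at (F : complex) (n : int) : Prop :=
  forall phi : 'cV[A]_(crank F (n - 1)),
    cdiff F n *m phi = 0 -> exists psi, phi = cdiff F (n - 1) *m psi.

End Local.

Definition trivext (k : fieldType) (R : comFalgType k) : Type :=
  (R * 'Hom(R, k^o))%type.

Section TrivExt.
Variables (k : fieldType) (R : comFalgType k).
Local Notation T := (trivext R).

HB.instance Definition _ := Vector.copy T (R * 'Hom(R, k^o))%type.

Definition dual_act (x : R) (beta : 'Hom(R, k^o)) : 'Hom(R, k^o) :=
  (beta \o amull x)%VF.

Definition trivext_one : T := (1, 0).
Definition trivext_mul (u v : T) : T :=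
  (u.1 * v.1, dual_act u.1 v.2 + dual_act v.1 u.2).

Lemma dual_actE x beta r : dual_act x beta r = beta (x * r).
Proof. by rewrite comp_lfunE lfunE. Qed.

Fact trivext_mulA : associative trivext_mul.
Proof.
move=> u v w; congr pair; rewrite /= ?mulrA //; apply/lfunP => r.
rewrite !(add_lfunE, dual_actE) -!addrA.
congr (_ + (_ + _)); last by rewrite mulrA.
  by rewrite mulrCA mulrA.
by rewrite mulrCA.
Qed.

Fact trivext_mulC : commutative trivext_mul.
Proof. by move=> u v; congr pair; rewrite /= 1?mulrC // addrC. Qed.

Fact trivext_mul1 : left_id trivext_one trivext_mul.
Proof.
move=> [x b]; congr pair; rewrite /= ?mul1r //; apply/lfunP => r.
by rewrite add_lfunE !dual_actE mul1r zero_lfunE addr0.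
Qed.

Fact trivext_mulDl : left_distributive trivext_mul +%R.
Proof.
move=> u v w; congr pair; rewrite /= ?mulrDl //; apply/lfunP => r.
by rewrite !(add_lfunE, dual_actE) mulrDl linearD /= addrACA.
Qed.

Fact trivext_one_neq0 : trivext_one != 0.
Proof. by apply/eqP => -[/eqP]; rewrite oner_eq0. Qed.

HB.instance Definition _ := GRing.Zmodule_isComNzRing.Build T
  trivext_mulA trivext_mulC trivext_mul1 trivext_mulDl trivext_one_neq0.

Fact trivext_scaleAl (a : k) (u v : T) : a *: (u * v) = (a *: u) * v.
Proof.
congr pair; rewrite /= ?scalerAl //; apply/lfunP => r.
by rewrite !(scale_lfunE, add_lfunE, dual_actE) -scalerAl linearZ scalerDr.
Qed.

HB.instance Definition _ := GRing.Lmodule_isLalgebra.Build k T trivext_scaleAl.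
HB.instance Definition _ := GRing.Lalgebra_isComAlgebra.Build k T.
HB.instance Definition _ := Algebra_isFalgebra.Build k T.
HB.instance Definition _ := ComFalgebra.on T.

Definition trivext_max (m : {vspace R}) : {vspace T} :=
  (linfun (fun u : T => u.1) @^-1: m)%VS.

(* R_i sits in degree i and Hom_k(R_j, k) in degree 3 - j, where Hom_k(R_j, k)
   consists of the functionals on R that vanish on the other components. *)
Definition trivext_grading (G : nat -> {vspace R}) (GT : nat -> {vspace T}) :
    Prop :=
  forall i (u : T), u \in GT i <->
    u.1 \in G i /\
    (forall j y, (j + i != 3)%N -> y \in G j -> u.2 y = 0).

End TrivExt.

Section Quotient.
Variables (k : fieldType) (A : comFalgType k) (I : {vspace A}).

(* The quotient is taken by I when I is a proper ideal; 0 is a junk value. *)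
Definition proper_ideal_part : {vspace A} :=
  if (fullv * I <= I)%VS && (1 \notin I) then I else 0%VS.
Local Notation J := proper_ideal_part.

(* A / J, realized on a vector space complement of J. *)
Definition quot_alg : Type := subvs_of J^C%VS.
HB.instance Definition _ := Vector.copy quot_alg (subvs_of J^C%VS).

Definition quot_proj (x : A) : quot_alg := vsproj J^C%VS (daddv_pi J^C%VS J x).

Definition quot_one : quot_alg := quot_proj 1.
Definition quot_mul (u v : quot_alg) : quot_alg :=
  quot_proj (vsval u * vsval v).

Fact capv_complC : (J^C :&: J = 0)%VS.
Proof. by rewrite capvC capv_compl. Qed.

Fact quot_proj_is_linear : linear quot_proj.
Proof. by move=> a x y; rewrite /quot_proj !linearP. Qed.

HB.instance Definition _ := GRing.isLinear.Build k A quot_alg _ quot_proj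
  quot_proj_is_linear.

Fact quot_projK (u : quot_alg) : quot_proj (vsval u) = u.
Proof.
by rewrite /quot_proj daddv_pi_id ?capv_complC ?subvsP // vsvalK.
Qed.

Fact quot_valK (x : A) : x - vsval (quot_proj x) \in J.
Proof.
rewrite vsprojK ?memv_pi //.
have := daddv_pi_add capv_complC (w := x).
rewrite addvC addv_complf memvf => /(_ isT) {1}<-.
by rewrite addrC addKr memv_pi.
Qed.

Fact quot_proj_eq0 (x : A) : (quot_proj x == 0) = (x \in J).
Proof.
apply/eqP/idP => [x0|xJ]; first by have := quot_valK x; rewrite x0 subr0.
apply: val_inj; rewrite /= vsprojK ?memv_pi //; apply/eqP.
have: daddv_pi J^C%VS J x \in (J^C :&: J)%VS.
  rewrite memv_cap memv_pi /=.
  have := quot_valK x; rewrite vsprojK ?memv_pi // => h.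
  by rewrite -[X in X \in _](subKr x) rpredB.
by rewrite capv_complC memv0.
Qed.

Fact proper_ideal_partM (x y : A) : y \in J -> x * y \in J.
Proof.
rewrite /J; case: ifP => [/andP[/subvP sI _] yI|_].
  by apply/sI/memv_mul; rewrite ?memvf.
by rewrite !memv0 => /eqP ->; rewrite mulr0.
Qed.

Fact one_proper_ideal_part : 1 \notin J.
Proof. by rewrite /J; case: ifP => [/andP[] //|_]; rewrite memv0 oner_eq0. Qed.

Fact quot_projM (x y : A) :
  quot_proj (x * y) = quot_mul (quot_proj x) (quot_proj y).
Proof.
apply/eqP; rewrite -subr_eq0 /quot_mul -raddfB /= quot_proj_eq0.
set x' := vsval _; set y' := vsval _.
have -> : x * y - x' * y' = x * (y - y') + y' * (x - x').
  by rewrite !mulrBr addrA (mulrC y' x) subrK (mulrC y').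
by rewrite rpredD // proper_ideal_partM ?quot_valK.
Qed.

Fact quot_mulA : associative quot_mul.
Proof.
move=> u v w; rewrite -[u]quot_projK -[v]quot_projK -[w]quot_projK.
by rewrite -!quot_projM mulrA.
Qed.

Fact quot_mulC : commutative quot_mul.
Proof. by move=> u v; rewrite /quot_mul mulrC. Qed.

Fact quot_mul1 : left_id quot_one quot_mul.
Proof. by move=> u; rewrite -[u]quot_projK -quot_projM mul1r. Qed.

Fact quot_mulDl : left_distributive quot_mul +%R.
Proof. by move=> u v w; rewrite /quot_mul raddfD /= mulrDl raddfD. Qed.

Fact quot_one_neq0 : quot_one != 0.
Proof. by rewrite quot_proj_eq0 one_proper_ideal_part. Qed.

HB.instance Definition _ := GRing.Zmodule_isComNzRing.Build quot_alg
  quot_mulA quot_mulC quot_mul1 quot_mulDl quot_one_neq0.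

Fact quot_scaleAl (a : k) (u v : quot_alg) : a *: (u * v) = (a *: u) * v.
Proof.
by rewrite /GRing.mul /= /quot_mul linearZ /= -scalerAl linearZ.
Qed.

HB.instance Definition _ := GRing.Lmodule_isLalgebra.Build k quot_alg quot_scaleAl.
HB.instance Definition _ := GRing.Lalgebra_isComAlgebra.Build k quot_alg.
HB.instance Definition _ := Algebra_isFalgebra.Build k quot_alg.
HB.instance Definition _ := ComFalgebra.on quot_alg.

Definition quot_image (m : {vspace A}) : {vspace quot_alg} :=
  (linfun quot_proj @: m)%VS.

End Quotient.

(* Main.v *)
Require Import Defs.
From HB Require Import structures.
From mathcomp Require Import all_boot all_order all_algebra.
From mathcomp Require Import falgebra.
From mathcomp Require Import zify ring.
From mathcomp Require boolp classical_sets.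

Set Implicit Arguments.
Unset Strict Implicit.
Unset Printing Implicit Defensive.

Import Order.TTheory GRing.Theory.
Local Open Scope ring_scope.

(* Write R = k + R1 + R2 with e = dim R1, f = dim R2, and let b_j be the ranks of
   F, numbered along the differential. A socle element in R1, or f >= e, would
   make the b_j nonincreasing, hence eventually constant, which is impossible.
   So f < e, and the linear strand of the resolution of k over R grows
   exponentially; it embeds in F as soon as the linear part of the j-th
   differential kills a vector over k, so this does not happen for large j. Then
   b_j - e b_(j+1) + f b_(j+2) = 0 for large j, and an infinite sequence of
   positive integers with this property forces e = f + 1.

   T is k + T1 + T2 + T3 with a perfect pairing of T1 and T2 into the line T3.
   This gives the Hilbert series; the functional (x, alpha) |-> alpha(1) makes T
   injective over itself by Zorn's lemma. Put n = dim T1 = 2e - 1.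

   (a) Suppose T = Q / (f) with Q regular and maximal ideal (y). Comparing Koszul
   cohomology on y over the successive quotients of Q shows size f <= size y. As
   y is quasi-regular, the quadric relations between n generators of T inject
   into a space of dimension at most n, impossible for n >= 5.

   (b) If (0 : a) = (c) in T, counting dimensions of aT and cT shows that the
   linear parts of a and c span each other's annihilators in T1; their R-parts
   then are a pair of exact zero divisors of R.

   (c) Acyclicity of F, and exactness of Hom(F, R) at one spot, make the linear
   strands of k and of Hom_k(R, k) over R exact. This bounds the linear strand of
   k over T from above by the coefficients of 1 / (1 - n z + n z^2 - z^3), and a
   homotopy for multiplication by an element of the dual part bounds it from
   below by the same series. Hence a minimal resolution of k over T / t^3 can be
   written down; its ranks have generating series 1 / q with
   q = 1 - n z + (n - 1) z^2 - z^3. If T / t^3 were Golod, q (1 + z)^d would have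
   degree at most d + 1. *)

(** * Matrices over an algebra and linear strands *)

(** Everything is done with chosen subspaces of one ambient algebra [A], so that the same lemmas
    apply to R and to the copy of R inside T. In T, strands over R and strands over T are matrices
    over one ring and can be compared row by row.

    F is not assumed to be graded or linear, so its differential splits as a linear part plus a
    quadratic part and exactness has to be read off degree by degree. The constant rows killed by
    the linear part, counted by [kap], are what spoils the count of ranks.

    For (c), put f = dim R2. The strand of k over R has series U = 1 / ((1 - z)(1 - f z)), that of
    Hom_k(R, k) has series Y = (f - z) / (1 - f z). Gluing along 0 -> Hom_k(R, k) -> T -> R -> 0
    bounds the strand of k over T by U / (1 - z Y), which is 1 / (1 - n z + n z^2 - z^3) for n = 2 f
    + 1. Passing to T / t^3 subtracts z^2 from the inverse series: each generator causes one extra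
    quadratic syzygy two steps later. *)

Section EntrywiseMatrices.
Variables (k : fieldType) (A : comFalgType k).
Implicit Types (U V W : {vspace A}).

Definition kmx m n (c : 'M[k]_(m, n)) : 'M[A]_(m, n) := map_mx (in_alg A) c.

Definition entries_in U m n (M : 'M[A]_(m, n)) := forall i j, M i j \in U.

Lemma kmxM m n p (c : 'M[k]_(m, n)) (d : 'M[k]_(n, p)) :
  kmx (c *m d) = kmx c *m kmx d.
Proof. exact: map_mxM. Qed.

Lemma kmxD m n (c d : 'M[k]_(m, n)) : kmx (c + d) = kmx c + kmx d.
Proof. exact: map_mxD. Qed.

Lemma kmx0 m n : kmx (0 : 'M[k]_(m, n)) = 0.
Proof. exact: map_mx0. Qed.

Lemma kmx1 n : kmx (1%:M : 'M[k]_n) = 1%:M.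
Proof. exact: map_mx1. Qed.

Lemma kmxT m n (c : 'M[k]_(m, n)) : (kmx c)^T = kmx c^T.
Proof. by rewrite /kmx map_trmx. Qed.

Lemma entries_in0 U m n : entries_in U (0 : 'M_(m, n)).
Proof. by move=> i j; rewrite mxE mem0v. Qed.

Lemma entries_inD U m n (M N : 'M[A]_(m, n)) :
  entries_in U M -> entries_in U N -> entries_in U (M + N).
Proof. by move=> HM HN i j; rewrite mxE rpredD. Qed.

Lemma entries_inN U m n (M : 'M[A]_(m, n)) :
  entries_in U M -> entries_in U (- M).
Proof. by move=> HM i j; rewrite mxE rpredN. Qed.

Lemma entries_inB U m n (M N : 'M[A]_(m, n)) :
  entries_in U M -> entries_in U N -> entries_in U (M - N).
Proof. by move=> HM HN; apply: entries_inD => //; apply: entries_inN. Qed.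

Lemma entries_inT U m n (M : 'M[A]_(m, n)) :
  entries_in U M -> entries_in U M^T.
Proof. by move=> HM i j; rewrite mxE. Qed.

Lemma entries_inM U V W m n p (M : 'M[A]_(m, n)) (N : 'M[A]_(n, p)) :
  (forall x y, x \in U -> y \in V -> x * y \in W) ->
  entries_in U M -> entries_in V N -> entries_in W (M *m N).
Proof. by move=> UVW HM HN i j; rewrite mxE rpred_sum // => l _; apply: UVW. Qed.

Lemma entries_in_kmxl U m n p (c : 'M[k]_(m, n)) (N : 'M[A]_(n, p)) :
  entries_in U N -> entries_in U (kmx c *m N).
Proof.
by move=> HN i j; rewrite mxE rpred_sum // => l _; rewrite mxE -scalerAl mul1r rpredZ.
Qed.

Lemma entries_in_kmxr U m n p (M : 'M[A]_(m, n)) (c : 'M[k]_(n, p)) :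
  entries_in U M -> entries_in U (M *m kmx c).
Proof.
by move=> HM i j; rewrite mxE rpred_sum // => l _; rewrite mxE -scalerAr mulr1 rpredZ.
Qed.

Lemma entries_in_sub U V m n (M : 'M[A]_(m, n)) :
  (U <= V)%VS -> entries_in U M -> entries_in V M.
Proof. by move=> /subvP UV HM i j; apply: UV. Qed.

Lemma entries_inM0 U V m n p (M : 'M[A]_(m, n)) (N : 'M[A]_(n, p)) :
  (forall x y, x \in U -> y \in V -> x * y = 0) ->
  entries_in U M -> entries_in V N -> M *m N = 0.
Proof.
move=> UV HM HN; apply/matrixP => i j; rewrite !mxE big1 // => l _.
exact: UV.
Qed.

Lemma entries_in_row U m n (M : 'M[A]_(m, n)) :
  (forall i, entries_in U (row i M)) -> entries_in U M.
Proof. by move=> H i j; have := H i 0 j; rewrite mxE. Qed.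

Lemma row_entries_in U m n (M : 'M[A]_(m, n)) i :
  entries_in U M -> entries_in U (row i M).
Proof. by move=> H a j; rewrite mxE. Qed.

Lemma entries_in_kmx m n (c : 'M[k]_(m, n)) : entries_in 1%VS (kmx c).
Proof. by move=> i j; rewrite mxE rpredZ ?memv_line. Qed.

Lemma entries_in1P m n (M : 'M[A]_(m, n)) :
  entries_in 1%VS M -> exists c, M = kmx c.
Proof.
move=> H; have /fin_all_exists[c Hc] : forall ij : 'I_m * 'I_n,
    exists a : k, M ij.1 ij.2 = a%:A.
  by move=> [i j]; have /vlineP[a ->] := H i j; exists a.
exists (\matrix_(i, j) c (i, j)); apply/matrixP => i j.
by rewrite !mxE (Hc (i, j)).
Qed.

Lemma rows_choice (S : Type) m n (P : 'I_m -> 'rV[S]_n -> Prop) :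
  (forall i, exists w, P i w) -> exists M : 'M[S]_(m, n), forall i, P i (row i M).
Proof.
move=> /fin_all_exists[f Hf]; exists (\matrix_i f i) => i.
by rewrite rowK.
Qed.

Lemma row_factor m n p (M : 'M[A]_(m, n)) (N : 'M[A]_(p, n)) :
  (forall i, exists c, row i M = kmx c *m N) -> exists C, M = kmx C *m N.
Proof.
move=> /rows_choice[C HC]; exists C; apply/row_matrixP => i.
by rewrite HC row_mul /kmx map_row.
Qed.

Lemma kmx_free_inj m n p (M : 'M[A]_(m, n)) (B : 'M[k]_(n, p)) :
  row_free B -> M *m kmx B = 0 -> M = 0.
Proof.
move=> /row_freeP[B' BB'] MB; rewrite -[M]mulmx1 -kmx1 -BB' kmxM mulmxA MB.
by rewrite mul0mx.
Qed.

(** Over k, [1 - C *m pinvmx C] projects onto the left kernel of [C], hence factors through [B]; it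
    fixes [M] because [C] kills [M]. Thus left kernels over k also control matrices over [A]. *)
Lemma kmx_ker_factor m r p q (C : 'M[k]_(r, p)) (B : 'M[k]_(q, r))
    (M : 'M[A]_(m, r)) :
  (forall x : 'rV[k]_r, x *m C = 0 -> (x <= B)%MS) -> M *m kmx C = 0 ->
  exists D : 'M[k]_(r, q), M = M *m kmx D *m kmx B.
Proof.
move=> CB MC.
have /submxP[D HD] : (1%:M - C *m pinvmx C <= B)%MS.
  apply/row_subP => i; apply: CB.
  by rewrite -row_mul mulmxBl mul1mx mulmxKpV ?subrr ?linear0.
exists D; rewrite -mulmxA -kmxM -HD kmxD kmx1 mulmxDr mulmx1.
have -> : kmx (- (C *m pinvmx C)) = - (kmx C *m kmx (pinvmx C)).
  by rewrite -kmxM /kmx map_mxN.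
by rewrite mulmxN mulmxA MC mul0mx oppr0 addr0.
Qed.

End EntrywiseMatrices.

Section LinearKernel.
Variables (k : fieldType) (A : comFalgType k).
Implicit Types (U V W : {vspace A}).

(** Dimensions over k are taken in spaces of finite functions, on which k acts; the scalars of a row
    over [A] are those of [A]. *)
Definition row_of_ffun n (f : {ffun 'I_n -> A}) : 'rV[A]_n := \row_i f i.
Definition ffun_of_row n (v : 'rV[A]_n) : {ffun 'I_n -> A} := [ffun i => v 0 i].

Lemma row_of_ffunK n : cancel (@row_of_ffun n) (@ffun_of_row n).
Proof. by move=> f; apply/ffunP => i; rewrite ffunE mxE. Qed.

Lemma ffun_of_rowK n : cancel (@ffun_of_row n) (@row_of_ffun n).
Proof. by move=> v; apply/rowP => i; rewrite mxE ffunE. Qed.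

Definition ffun_incl U n (f : {ffun 'I_n -> subvs_of U}) : {ffun 'I_n -> A} :=
  [ffun i => vsval (f i)].

Fact ffun_incl_linear U n : linear (@ffun_incl U n).
Proof. by move=> a f g; apply/ffunP => i; rewrite !ffunE linearP. Qed.
HB.instance Definition _ U n := GRing.isLinear.Build k _ _ _ (@ffun_incl U n)
  (@ffun_incl_linear U n).

Definition pointwise U n : {vspace {ffun 'I_n -> A}} :=
  limg (linfun (@ffun_incl U n)).

Lemma pointwiseP U n (f : {ffun 'I_n -> A}) :
  reflect (forall i, f i \in U) (f \in pointwise U n).
Proof.
apply: (iffP memv_imgP) => [[g _ ->] i|H]; first by rewrite lfunE ffunE subvsP.
exists [ffun i => vsproj U (f i)]; rewrite ?memvf //.
by apply/ffunP => i; rewrite lfunE !ffunE vsprojK.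
Qed.

Lemma dim_pointwise U n : \dim (pointwise U n) = (n * \dim U)%N.
Proof.
rewrite limg_dim_eq; first by rewrite dimvf /dim /= card_ord mulnC.
apply/eqP; rewrite -subv0; apply/subvP => f; rewrite memv_cap memv_ker memv0.
move=> /andP[_ /eqP f0]; apply/eqP/ffunP => i; apply: val_inj.
by move/ffunP/(_ i): f0; rewrite lfunE !ffunE /= => ->.
Qed.

Definition mulmx_ffun r c (D : 'M[A]_(r, c)) (f : {ffun 'I_r -> A}) :
  {ffun 'I_c -> A} := ffun_of_row (row_of_ffun f *m D).

Fact mulmx_ffun_linear r c (D : 'M[A]_(r, c)) : linear (mulmx_ffun D).
Proof.
move=> a f g; apply/ffunP => i; rewrite !ffunE !mxE scaler_sumr -big_split /=.
by apply: eq_bigr => j _; rewrite !mxE !ffunE mulrDl scalerAl.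
Qed.
HB.instance Definition _ r c (D : 'M[A]_(r, c)) := GRing.isLinear.Build k _ _ _
  (mulmx_ffun D) (mulmx_ffun_linear D).

Variable A1 : {vspace A}.

Definition kerv r c (D : 'M[A]_(r, c)) : {vspace {ffun 'I_r -> A}} :=
  (pointwise A1 r :&: lker (linfun (mulmx_ffun D)))%VS.

Definition imgv r c (D : 'M[A]_(r, c)) : {vspace {ffun 'I_c -> A}} :=
  (linfun (mulmx_ffun D) @: pointwise A1 r)%VS.

Lemma kervP r c (D : 'M[A]_(r, c)) (v : 'rV[A]_r) :
  ffun_of_row v \in kerv D <-> entries_in A1 v /\ v *m D = 0.
Proof.
rewrite memv_cap memv_ker lfunE /= /mulmx_ffun ffun_of_rowK; split.
  case/andP=> /pointwiseP H /eqP H0; split.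
    by move=> i j; have := H j; rewrite ffunE ord1.
  by apply: (can_inj (@ffun_of_rowK _)); rewrite H0; apply/ffunP => j; rewrite !ffunE mxE.
case=> H ->; apply/andP; split.
  by apply/pointwiseP => i; rewrite ffunE.
by apply/eqP/ffunP => i; rewrite !ffunE mxE.
Qed.

Lemma imgvP r c (D : 'M[A]_(r, c)) (w : 'rV[A]_c) :
  ffun_of_row w \in imgv D <-> exists2 v, entries_in A1 v & w = v *m D.
Proof.
split.
  case/memv_imgP => f /pointwiseP Hf; rewrite lfunE /= /mulmx_ffun => /(can_inj (@ffun_of_rowK _)) ->.
  by exists (row_of_ffun f) => // i j; rewrite mxE.
case=> v Hv ->; apply/memv_imgP; exists (ffun_of_row v).
  by apply/pointwiseP => i; rewrite ffunE.
by rewrite lfunE /= /mulmx_ffun ffun_of_rowK.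
Qed.

Definition kdim r c (D : 'M[A]_(r, c)) : nat := \dim (kerv D).

Lemma kdimE r c (D : 'M[A]_(r, c)) : (kdim D + \dim (imgv D) = r * \dim A1)%N.
Proof. by rewrite limg_ker_dim dim_pointwise. Qed.

(** Rank-nullity, the image lying in [c] copies of [W]. *)
Lemma kdim_ge r c (D : 'M[A]_(r, c)) W :
  (forall x y, x \in A1 -> y \in A1 -> x * y \in W) -> entries_in A1 D ->
  (r * \dim A1 <= kdim D + c * \dim W)%N.
Proof.
move=> AW HD; rewrite -(kdimE D) leq_add2l -dim_pointwise dimvS //.
apply/subvP => f; rewrite -[f]row_of_ffunK => /imgvP[v Hv ->].
by apply/pointwiseP => i; rewrite ffunE; apply: (entries_inM AW).
Qed.

Lemma kdim_eq r c (D : 'M[A]_(r, c)) W :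
  (forall x y, x \in A1 -> y \in A1 -> x * y \in W) -> entries_in A1 D ->
  (forall w : 'rV_c, entries_in W w -> exists2 v, entries_in A1 v & w = v *m D) ->
  (r * \dim A1 = kdim D + c * \dim W)%N.
Proof.
move=> AW HD onto; rewrite -(kdimE D); congr addn; rewrite -dim_pointwise.
congr (\dim _); apply/eqP; rewrite eqEsubv; apply/andP; split; apply/subvP => f;
  rewrite -[f]row_of_ffunK.
  move=> /imgvP[v Hv ->].
  by apply/pointwiseP => i; rewrite ffunE; apply: (entries_inM AW).
move=> /pointwiseP Hf; apply/imgvP; apply: onto => i j; rewrite mxE.
by have := Hf j; rewrite ffunE mxE.
Qed.

Definition kbasis r c (D : 'M[A]_(r, c)) : 'M[A]_(kdim D, r) :=
  \matrix_i row_of_ffun (vbasis (kerv D))`_i.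

Lemma kbasis_row r c (D : 'M[A]_(r, c)) i :
  ffun_of_row (row i (kbasis D)) = (vbasis (kerv D))`_i.
Proof. by rewrite rowK row_of_ffunK. Qed.

Lemma kbasis_mem r c (D : 'M[A]_(r, c)) i :
  ffun_of_row (row i (kbasis D)) \in kerv D.
Proof. by rewrite kbasis_row vbasis_mem // mem_nth // size_tuple. Qed.

Lemma kbasis_entries r c (D : 'M[A]_(r, c)) : entries_in A1 (kbasis D).
Proof. by apply: entries_in_row => i; have /kervP[] := kbasis_mem i. Qed.

Lemma kbasisM r c (D : 'M[A]_(r, c)) : kbasis D *m D = 0.
Proof.
apply/row_matrixP => i; rewrite row_mul linear0.
by have /kervP[] := kbasis_mem i.
Qed.

Lemma ffun_of_row_kbasis r c (D : 'M[A]_(r, c)) (x : 'rV[k]_(kdim D)) :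
  ffun_of_row (kmx A x *m kbasis D) = \sum_i x 0 i *: (vbasis (kerv D))`_i.
Proof.
apply/ffunP => j; rewrite ffunE mxE sum_ffunE; apply: eq_bigr => i _.
by rewrite !mxE !ffunE -scalerAl mul1r.
Qed.

Lemma kbasisP r c (D : 'M[A]_(r, c)) (v : 'rV[A]_r) :
  entries_in A1 v -> v *m D = 0 -> exists x, v = kmx A x *m kbasis D.
Proof.
move=> Hv vD; have vin : ffun_of_row v \in kerv D by apply/kervP.
have := coord_vbasis vin => Hc.
exists (\row_i coord (vbasis (kerv D)) i (ffun_of_row v)).
apply: (can_inj (@ffun_of_rowK _)); rewrite ffun_of_row_kbasis {1}Hc.
by apply: eq_bigr => i _; rewrite mxE.
Qed.

Lemma kbasisPmx m r c (D : 'M[A]_(r, c)) (M : 'M[A]_(m, r)) :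
  entries_in A1 M -> M *m D = 0 -> exists X, M = kmx A X *m kbasis D.
Proof.
move=> HM MD; apply: row_factor => i; apply: kbasisP.
  exact: row_entries_in.
by rewrite -row_mul MD linear0.
Qed.

Lemma kbasis_free r c (D : 'M[A]_(r, c)) (x : 'rV[k]_(kdim D)) :
  kmx A x *m kbasis D = 0 -> x = 0.
Proof.
move=> x0; have /freeP := basis_free (vbasisP (kerv D)).
move/(_ (fun i => x 0 i)) => H; apply/rowP => i; rewrite mxE; apply: H.
by rewrite -ffun_of_row_kbasis x0; apply/ffunP => j; rewrite !ffunE mxE.
Qed.

Lemma kbasis_freemx m r c (D : 'M[A]_(r, c)) (X : 'M[k]_(m, kdim D)) :
  kmx A X *m kbasis D = 0 -> X = 0.
Proof.
move=> X0; apply/row_matrixP => i; rewrite linear0; apply: (@kbasis_free _ _ D).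
have := congr1 (row i) X0; rewrite row_mul linear0.
by rewrite /kmx map_row.
Qed.

(* The linear strand starting from D: each matrix is a k-basis of the rows
   over A1 killed by the previous one. *)
Record stage := Stage { srows : nat; scols : nat; smx : 'M[A]_(srows, scols) }.

Definition next_stage (s : stage) : stage := Stage (kbasis (smx s)).

Definition strand (s : stage) i : stage := iter i next_stage s.

Lemma strand_nextE s i : strand (next_stage s) i = strand s i.+1.
Proof. by rewrite /strand iterSr. Qed.

End LinearKernel.

(** * Self-injectivity of algebras with a nondegenerate form *)

Section FrobeniusAlgebras.
Variables (k : fieldType) (A : comFalgType k).

Section ExtendFunctional.
Variables (N : lmodType A) (S : N -> Prop) (phi : N -> k).
Hypothesis S0 : S 0.
Hypothesis S_lin : forall (a : k) x y, S x -> S y -> S (a%:A *: x + y).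
Hypothesis phi_lin : forall (a : k) x y, S x -> S y ->
  phi (a%:A *: x + y) = a * phi x + phi y.

(** Graphs of k-linear functionals on subspaces of [N] extending [phi]; the last clause makes the
    graph single-valued. [N] may have infinite dimension, whence the appeal to Zorn's lemma. *)
Let good (G : N * k -> Prop) :=
  [/\ forall x, S x -> G (x, phi x),
      forall (a : k) u v, G u -> G v -> G (a%:A *: u.1 + v.1, a * u.2 + v.2)
    & forall c, G (0, c) -> c = 0].

Let good_fun G x c d : good G -> G (x, c) -> G (x, d) -> c = d.
Proof.
case=> _ Glin G0 Gc Gd; have := Glin (-1) _ _ Gc Gd; rewrite /= !scaleN1r addNr.
by move/G0; rewrite mulN1r addrC => /eqP; rewrite subr_eq0 => /eqP ->.
Qed.

Lemma functional_extension : exists psi : N -> k,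
  (forall (a : k) x y, psi (a%:A *: x + y) = a * psi x + psi y) /\
  forall x, S x -> psi x = phi x.
Proof.
pose P (G : classical_sets.set (N * k)) := (forall u, ~ G u) \/ good G.
have phi0 : phi 0 = 0.
  have := phi_lin (-1) S0 S0; rewrite scaler0 addr0 mulN1r => h.
  by rewrite h addNr.
have good0 : good (fun u => S u.1 /\ u.2 = phi u.1).
  split=> // [a u v [Su ->] [Sv ->]|c [_ /=]]; last by rewrite phi0.
  by split; [exact: S_lin | rewrite /= phi_lin].
have [F FP Ftot|G [PG Gmax]] := @classical_sets.Zorn_bigcup (N * k)%type P.
  have [[X FX [u0 Xu0]]|noX] := boolp.pselect (exists2 X, F X & exists u, X u).
    right; have goodX Y : F Y -> (exists u, Y u) -> good Y.
      by move=> FY [u Yu]; case: (FP Y FY) => // /(_ u).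
    split.
    - by move=> x Sx; exists X => //; have [H _ _] := goodX _ FX (ex_intro _ u0 Xu0); apply: H.
    - move=> a u v [Y FY Yu] [Z FZ Zv].
      have [YZ|ZY] := Ftot _ _ FY FZ.
        exists Z => //; have [_ H _] := goodX _ FZ (ex_intro _ v Zv).
        by apply: H => //; apply: YZ.
      exists Y => //; have [_ H _] := goodX _ FY (ex_intro _ u Yu).
      by apply: H => //; apply: ZY.
    - move=> c [Y FY Yc]; have [_ _ H] := goodX _ FY (ex_intro _ _ Yc).
      exact: H.
  left=> u [X FX Xu]; apply: noX; exists X => //; by exists u.
have {PG} goodG : good G.
  case: PG => // G0; case: (Gmax (fun u => S u.1 /\ u.2 = phi u.1)).
    split; first by move=> u /G0.
    by move=> H; apply: (G0 (0, phi 0)); apply: H.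
  by right.
have Gtot x : exists c, G (x, c).
  apply: boolp.contrapT => Nx; case: (goodG) => [GS Glin G0].
  (* [H] extends [G] to the span of its domain and [x] by sending [x] to 0; maximality then puts [x]
     into the domain of [G]. *)
  pose H (u : N * k) := exists (a : k) (v : N * k),
    G v /\ u = (a%:A *: x + v.1, v.2).
  case: (Gmax H).
    split; first by move=> u Gu; exists 0, u; rewrite scale0r scale0r add0r -surjective_pairing.
    move=> HG; apply: Nx; exists 0; apply: HG; exists 1, (0, 0).
    split; last by rewrite /= scale1r scale1r addr0.
    by rewrite -[0 in X in (_, X)]phi0; apply: GS.
  right; split.
  - move=> z Sz; exists 0, (z, phi z); split; first exact: GS.
    by rewrite /= scale0r scale0r add0r.
  - move=> a u v [a1 [u1 [Gu1 ->]]] [a2 [v1 [Gv1 ->]]] /=.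
    exists (a * a1 + a2), (a%:A *: u1.1 + v1.1, a * u1.2 + v1.2); split.
      exact: Glin.
    congr pair; rewrite /= scalerDr !scalerA -scalerAl mul1r scalerA !scalerDl.
    by rewrite addrACA.
  - move=> c [a [[v1 v2] [Gv [/esym/eqP h ->]]]] /=.
    have [a0|a0] := eqVneq a 0.
      by apply: G0; move: h; rewrite a0 scale0r scale0r add0r /= => /eqP <-.
    case: Nx; exists (- a^-1 * v2).
    have G00 : G (0, 0) by rewrite -[0 in X in (_, X)]phi0; apply: GS.
    have := Glin (- a^-1) _ _ Gv G00; rewrite /= !addr0.
    move: h; rewrite addrC addr_eq0 => /eqP ->.
    rewrite scalerN -scaleNr scalerA -!scaleNr opprK -scalerAl mul1r scalerA.
    by rewrite mulVf // scale1r scale1r.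
have /boolp.choice[psi Hpsi] := Gtot.
exists psi; split=> [a x y|x Sx].
  apply: (good_fun goodG (Hpsi _)); case: goodG => _ Glin _.
  exact: (Glin a _ _ (Hpsi x) (Hpsi y)).
by apply: (good_fun goodG (Hpsi _)); case: goodG => GS _ _; apply: GS.
Qed.

End ExtendFunctional.

Variable lam : 'Hom(A, k^o).
Hypothesis lam_nondeg : forall x, x != 0 -> exists y, lam (x * y) != 0.

(* The pairing (x, y) |-> lam (x y) is perfect, so A is its own k-dual. *)
Lemma frobenius_riesz (g : A -> k) :
  (forall (a : k) x y, g (a *: x + y) = a * g x + g y) ->
  exists x, forall y, lam (x * y) = g y.
Proof.
move=> glin; pose Phi (x : A) : 'Hom(A, k^o) := (lam \o amull x)%VF.
have PhiE x y : Phi x y = lam (x * y) by rewrite comp_lfunE lfunE.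
have Phi_lin : linear Phi.
  move=> a x y; apply/lfunP => z.
  by rewrite add_lfunE scale_lfunE !PhiE mulrDl linearD /= -scalerAl linearZ.
pose PhiL : {linear A -> 'Hom(A, k^o)} :=
  HB.pack Phi (GRing.isLinear.Build k A 'Hom(A, k^o) _ Phi Phi_lin).
have inj : lker (linfun PhiL) == 0%VS.
  rewrite -subv0; apply/subvP => x; rewrite memv_ker lfunE memv0 /= => /eqP/lfunP x0.
  apply: contraT => /lam_nondeg[y]; rewrite -PhiE (x0 y) lfunE /=.
  by rewrite eqxx.
have onto : limg (linfun PhiL) = fullv.
  apply/eqP; rewrite eqEdim subvf /= limg_dim_eq ?(eqP inj) ?capv0 //.
  by rewrite !dimvf -[leqRHS]muln1.
pose gL : {linear A -> k^o} :=
  HB.pack (g : A -> k^o) (GRing.isLinear.Build k A k^o _ (g : A -> k^o) glin).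
have : linfun gL \in limg (linfun PhiL) by rewrite onto memvf.
case/memv_imgP => x _ Hx; exists x => y.
by rewrite -PhiE; have /lfunP/(_ y) := Hx; rewrite !lfunE /= lfunE /= => ->.
Qed.

Lemma frobenius_eq x y : (forall z, lam (x * z) = lam (y * z)) -> x = y.
Proof.
move=> H; apply/eqP; rewrite -subr_eq0; apply: contraT => /lam_nondeg[z].
by rewrite mulrBl linearB /= H subrr eqxx.
Qed.

(** As [A] is its own k-dual, an A-linear map g into [A] is the same as the functional y |-> lam (g
    y). So extending [f] along [i] amounts to extending the functional [lam \o f] from the image of
    [i] to [N]. *)
Lemma frobenius_self_injective : injective_module A^o.
Proof.
move=> M N i f inji.
pose S (y : N) := exists x, i x = y.
have /boolp.choice[j Hj] : forall y : N, exists x, S y -> i x = y.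
  by move=> y; have [[x <-]|nS] := boolp.pselect (S y); [exists x | exists 0].
have ij x : j (i x) = x by apply: inji; apply: Hj; exists x.
pose phi y : k := lam (f (j y)).
have [|||psi [psi_lin psiE]] := @functional_extension N S phi; first by exists 0; rewrite linear0.
- by move=> a x y [x' <-] [y' <-]; exists (a%:A *: x' + y'); rewrite linearP.
- move=> a x y [x' <-] [y' <-]; rewrite /phi -linearP !ij linearP /=.
  have -> : a%:A *: f x' = a *: (f x' : A) :> A.
    by rewrite /GRing.scale /= -scalerAl mul1r.
  by rewrite linearP.
have /boolp.choice[g Hg] : forall y : N, exists a : A, forall b, lam (a * b) = psi (b *: y).
  move=> y; apply: frobenius_riesz => a b c.
  by rewrite -psi_lin scalerA -scalerAl mul1r scalerDl.
have g_lin : linear (g : N -> A^o).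
  move=> a x y; apply: frobenius_eq => z.
  have psiD u v : psi (u + v) = psi u + psi v.
    by have := psi_lin 1 u v; rewrite !scale1r mul1r.
  transitivity (psi (z *: (a *: x + y))); first exact: Hg.
  transitivity (lam (a * g x * z) + lam (g y * z)); last by rewrite -linearD -mulrDl.
  by rewrite -mulrA mulrCA !Hg -psiD scalerDr scalerA mulrC.
pose gL : {linear N -> A^o} :=
  HB.pack (g : N -> A^o) (GRing.isLinear.Build A N A^o _ (g : N -> A^o) g_lin).
exists gL => x /=; apply: frobenius_eq => z.
transitivity (psi (z *: i x)); first exact: Hg.
rewrite -linearZ psiE; last by exists (z *: x).
by rewrite /phi ij linearZ mulrC.
Qed.

Lemma frobenius_gorenstein : gorenstein A.
Proof. by exists 0%N; apply: frobenius_self_injective. Qed.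

End FrobeniusAlgebras.

(** * Sequences of natural numbers *)

Section NatSequences.

Lemma nonincreasing_stabilizes (b : nat -> nat) (N : nat) :
  (forall j, N <= j -> b j.+1 <= b j)%N ->
  exists2 J, (N <= J)%N & forall j, (J <= j)%N -> b j = b J.
Proof.
move: {2}(b N) (leqnn (b N)) => c; elim: c N => [|c IH] N bN bd.
  exists N => // j; elim: j => [|j IHj]; first by rewrite leqn0 => /eqP ->.
  rewrite leq_eqVlt => /orP[/eqP <- //|Nj].
  by have := bd j Nj; rewrite IHj //; lia.
have [[j [Nj bj]]|no] := boolp.pselect (exists j, (N <= j /\ b j <= c)%N).
  have [i ji|J jJ HJ] := IH j bj; first by apply: bd; apply: leq_trans ji.
  by exists J => //; apply: leq_trans jJ.
exists N => // j Nj.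
have low i : (N <= i)%N -> (c < b i)%N.
  by move=> Ni; rewrite ltnNge; apply/negP => h; apply: no; exists i.
have up i : (N <= i)%N -> (b i <= c.+1)%N.
  elim: i => [|i IHi]; first by rewrite leqn0 => /eqP <-.
  rewrite leq_eqVlt => /orP[/eqP <- //|Ni].
  by apply: leq_trans (bd _ Ni) (IHi Ni).
by have := low _ Nj; have := up _ Nj; have := low _ (leqnn N); lia.
Qed.

(* The form f y^2 - e x y + x^2 at consecutive terms is divided by f at each
   step, so it vanishes; hence the ratio of the terms is 1, a root. *)
Lemma backward_recurrence (b : nat -> nat) (e f J : nat) :
  (1 < f)%N -> (forall j, 0 < b j)%N ->
  (forall j, (J <= j)%N -> b j + f * b j.+2 = e * b j.+1)%N -> e = f.+1.
Proof.
move=> f1 b0 rec.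
pose q j : int := (f * b j.+1 * b j.+1)%:Z - (e * b j.+1 * b j)%:Z + (b j * b j)%:Z.
have qS j : (J <= j)%N -> q j = f%:Z * q j.+1.
  move=> Jj; have /(congr1 Posz) := rec _ Jj; rewrite /q !(PoszD, PoszM).
  set x := (b j)%:Z; set y := (b j.+1)%:Z; set z := (b j.+2)%:Z.
  set F := f%:Z; set E := e%:Z => h.
  have -> : F * (F * z * z - E * z * y + y * y) =
     (F * z) * (F * z) - E * (F * z) * y + F * y * y by ring.
  have -> : F * z = E * y - x by rewrite -h; ring.
  ring.
have qn j n : (J <= j)%N -> q j = f%:Z ^+ n * q (j + n)%N.
  move=> Jj; elim: n => [|n IH]; first by rewrite addn0 expr0 mul1r.
  by rewrite IH qS ?addnS ?exprSr ?mulrA //; lia.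
(* [q j] is divisible by every power of [f], and as [f > 1] the power with exponent [|q j|] already
   exceeds [|q j|]. *)
have q0 j : (J <= j)%N -> q j = 0.
  move=> Jj; apply/eqP; apply: contraT => qj0.
  have := qn j `|q j|%N Jj; move/(congr1 absz); rewrite abszM abszX /= => h.
  have : (0 < `|q (j + `|q j|)%N|)%N.
    rewrite absz_gt0; apply: contraNneq qj0 => h0.
    by rewrite (qn j `|q j|%N Jj) h0 mulr0.
  have := ltn_expl `|q j| f1; move: h; set a := (f ^ _)%N; set c := `|q (j + _)|%N.
  by move: `|q j|%N => m; nia.
(* Where the form vanishes, the recurrence makes the sequence geometric; positive integers then
   cannot decrease forever. *)
have geo j : (J <= j)%N -> (b j * b j.+2 = b j.+1 * b j.+1)%N.
  move=> Jj; have h := q0 _ Jj; have := rec _ Jj; move: h; rewrite /q.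
  move: (b j) (b j.+1) (b j.+2) => x y z h r.
  have h' : (f * y * y + x * x = e * y * x)%N.
    by apply/eqP; rewrite -eqz_nat PoszD -subr_eq0 addrAC h.
  have : (f * (x * z) = f * (y * y))%N by have := congr1 (muln x) r; nia.
  by move/eqP; rewrite eqn_pmul2l ?(ltnW f1) // => /eqP.
have inc : (b J <= b J.+1)%N.
  rewrite leqNgt; apply/negP => lt0.
  have dec i : (J <= i)%N -> (b i.+1 < b i)%N.
    elim: i => [|i IHi]; first by rewrite leqn0 => /eqP h; rewrite -h.
    rewrite leq_eqVlt => /orP[/eqP <- //|Ji].
    have lt := IHi Ji; rewrite ltnNge; apply/negP => ge.
    have := leq_mul (leqnn (b i)) ge; rewrite (geo _ Ji).
    by rewrite leq_pmul2r ?b0 // leqNgt lt.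
  have [K JK HK] := @nonincreasing_stabilizes b J (fun j h => ltnW (dec j h)).
  by have := dec K JK; rewrite (HK K.+1) ?ltnn.
have h := q0 J (leqnn J); move: inc (b0 J) (b0 J.+1) h; rewrite /q.
move: (b J) (b J.+1) => x y xy x0 y0 h.
(* Reduce the ratio x / y to lowest terms p / r. The equation shows that r divides p^2, so r = 1,
   and x <= y gives p = 1. *)
have [g0 /eqP] : (0 < gcdn x y)%N /\ gcdn x y == gcdn x y by rewrite gcdn_gt0 x0.
have /dvdnP[p Hp] := dvdn_gcdl x y; have /dvdnP[r Hr] := dvdn_gcdr x y.
move: Hp Hr g0; set g := gcdn x y => Hp Hr g0 _.
have cop : coprime p r.
  have : (gcdn x y == g * gcdn p r)%N by rewrite {1}Hp {1}Hr muln_gcdr !(mulnC g).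
  rewrite -/g -{1}[g]muln1 eqn_pmul2l // eq_sym => h'.
  by rewrite /coprime.
have eqpr : (p * p + f * r * r = e * r * p)%N.
  have : (g * g * (p * p + f * r * r) = g * g * (e * r * p))%N.
    by move: h; rewrite Hp Hr => h; nia.
  by move/eqP; rewrite eqn_pmul2l ?muln_gt0 ?g0 // => /eqP.
have r1 : r = 1%N.
  have : (r %| p * p)%N.
    rewrite -(dvdn_addl (p * p) (dvdn_mull (f * r) (dvdnn r))).
    by rewrite eqpr mulnAC dvdn_mull.
  by rewrite Gauss_dvdr 1?coprime_sym // => h'; move: cop; rewrite /coprime (gcdn_idPr h') => /eqP.
have p1 : p = 1%N by move: xy y0; rewrite Hp Hr r1; move: x0; rewrite Hp; nia.
by move: eqpr; rewrite r1 p1; lia.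
Qed.

End NatSequences.

(* A copy inside A of a graded ring k + R1 + R2 generated in degree 1. *)
Record short_subring (k : fieldType) (A : comFalgType k) (R1 R2 : {vspace A})
    (p0 : 'Hom(A, k^o)) (p1 p2 : 'End(A)) : Prop := ShortSubring {
  short_one : [/\ p0 1 = 1, p1 1 = 0 & p2 1 = 0];
  short_R1 : forall x, x \in R1 -> [/\ p0 x = 0, p1 x = x & p2 x = 0];
  short_R2 : forall x, x \in R2 -> [/\ p0 x = 0, p1 x = 0 & p2 x = x];
  short_11 : forall x y, x \in R1 -> y \in R1 -> x * y \in R2;
  short_12 : forall x y, x \in R1 -> y \in R2 -> x * y = 0;
  short_22 : forall x y, x \in R2 -> y \in R2 -> x * y = 0;
  short_gen : (R2 <= R1 * R1)%VS }.

Section ShortSubring.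
Variables (k : fieldType) (A : comFalgType k) (R1 R2 : {vspace A}).
Variables (p0 : 'Hom(A, k^o)) (p1 p2 : 'End(A)).
Hypothesis sh : short_subring R1 R2 p0 p1 p2.

Definition short_carrier : {vspace A} := (1 + (R1 + R2))%VS.
Local Notation RR := short_carrier.

Lemma short_21 x y : x \in R2 -> y \in R1 -> x * y = 0.
Proof. by move=> x2 y1; rewrite mulrC (short_12 sh). Qed.

Lemma short_dec x : x \in RR ->
  [/\ x = in_alg A (p0 x) + (p1 x : A) + (p2 x : A), p1 x \in R1 & p2 x \in R2].
Proof.
case/memv_addP => _ /vlineP[a ->] [_ /memv_addP[y y1 [z z2 ->]] ->].
have [o0 o1 o2] := short_one sh; have [y0 yy y2] := short_R1 sh y1.
have [z0 z1 zz] := short_R2 sh z2.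
rewrite !linearD /= !linearZ /= o0 o1 o2 y0 yy y2 z0 z1 zz !scaler0 !add0r !addr0.
by rewrite /GRing.scale /= mulr1 addrA.
Qed.

Lemma short_1 : (1 <= RR)%VS. Proof. exact: addvSl. Qed.
Lemma short_R1S : (R1 <= RR)%VS.
Proof. by apply: subv_trans (addvSr _ _); apply: addvSl. Qed.
Lemma short_R2S : (R2 <= RR)%VS.
Proof. by apply: subv_trans (addvSr _ _); apply: addvSr. Qed.

Definition mx0 m n (M : 'M[A]_(m, n)) : 'M[k]_(m, n) := map_mx p0 M.
Definition mx1 m n (M : 'M[A]_(m, n)) : 'M[A]_(m, n) := map_mx p1 M.
Definition mx2 m n (M : 'M[A]_(m, n)) : 'M[A]_(m, n) := map_mx p2 M.

Lemma mx_dec m n (M : 'M[A]_(m, n)) : entries_in RR M ->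
  [/\ M = kmx A (mx0 M) + mx1 M + mx2 M, entries_in R1 (mx1 M)
    & entries_in R2 (mx2 M)].
Proof.
move=> HM; split.
- by apply/matrixP => i j; rewrite !mxE; have [e0 _ _] := short_dec (HM i j).
- by move=> i j; rewrite mxE; have [] := short_dec (HM i j).
- by move=> i j; rewrite mxE; have [] := short_dec (HM i j).
Qed.

Lemma mx1D m n (M N : 'M[A]_(m, n)) : mx1 (M + N) = mx1 M + mx1 N.
Proof. by apply/matrixP => i j; rewrite !mxE linearD. Qed.
Lemma mx2D m n (M N : 'M[A]_(m, n)) : mx2 (M + N) = mx2 M + mx2 N.
Proof. by apply/matrixP => i j; rewrite !mxE linearD. Qed.
Lemma mx0D m n (M N : 'M[A]_(m, n)) : mx0 (M + N) = mx0 M + mx0 N.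
Proof. by apply/matrixP => i j; rewrite !mxE linearD. Qed.

Lemma mx_k m n (c : 'M[k]_(m, n)) :
  [/\ mx0 (kmx A c) = c, mx1 (kmx A c) = 0 & mx2 (kmx A c) = 0].
Proof.
have [o0 o1 o2] := short_one sh.
split; apply/matrixP => i j; rewrite !mxE linearZ /= ?o0 ?o1 ?o2 ?scaler0 //.
by rewrite /GRing.scale /= mulr1.
Qed.

Lemma mx_1 m n (M : 'M[A]_(m, n)) : entries_in R1 M ->
  [/\ mx0 M = 0, mx1 M = M & mx2 M = 0].
Proof.
move=> H; split; apply/matrixP => i j; rewrite !mxE;
  by have [] := short_R1 sh (H i j).
Qed.

Lemma mx_2 m n (M : 'M[A]_(m, n)) : entries_in R2 M ->
  [/\ mx0 M = 0, mx1 M = 0 & mx2 M = M].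
Proof.
move=> H; split; apply/matrixP => i j; rewrite !mxE;
  by have [] := short_R2 sh (H i j).
Qed.

Lemma mx1_0 m n : mx1 (0 : 'M[A]_(m, n)) = 0.
Proof. by apply/matrixP => i j; rewrite !mxE linear0. Qed.
Lemma mx2_0 m n : mx2 (0 : 'M[A]_(m, n)) = 0.
Proof. by apply/matrixP => i j; rewrite !mxE linear0. Qed.
Lemma mx_sum0 m n (M1 M2 : 'M[A]_(m, n)) : entries_in R1 M1 -> entries_in R2 M2 ->
  M1 + M2 = 0 -> M1 = 0 /\ M2 = 0.
Proof.
move=> H1 H2 H; have [_ a1 a2] := mx_1 H1; have [_ b1 b2] := mx_2 H2.
split; first by rewrite -a1 -[mx1 M1]addr0 -b1 -mx1D H mx1_0.
by rewrite -b2 -[mx2 M2]add0r -a2 -mx2D H mx2_0.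
Qed.

Lemma short_mul m n p (M : 'M[A]_(m, n)) (D : 'M[A]_(n, p)) :
  entries_in RR M -> entries_in (R1 + R2)%VS D ->
  M *m D = kmx A (mx0 M) *m mx1 D + (kmx A (mx0 M) *m mx2 D + mx1 M *m mx1 D).
Proof.
move=> HM HD; have [eM M1 M2] := mx_dec HM.
have DRR : entries_in RR D by apply: entries_in_sub HD; apply: addvSr.
have [eD D1 D2] := mx_dec DRR.
have D0 : mx0 D = 0.
  apply/matrixP => i j; rewrite !mxE; have /memv_addP[x x1 [y y2 ->]] := HD i j.
  rewrite linearD /=; have [-> _ _] := short_R1 sh x1.
  by have [-> _ _] := short_R2 sh y2; rewrite addr0.
rewrite {1}eM {1}eD D0 kmx0 add0r !mulmxDl !mulmxDr.
rewrite (entries_inM0 (short_12 sh) M1 D2) (entries_inM0 short_21 M2 D1).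
by rewrite (entries_inM0 (short_22 sh) M2 D2) !addr0 addrA.
Qed.

Lemma entries_in_11 m n p (M : 'M[A]_(m, n)) (D : 'M[A]_(n, p)) :
  entries_in R1 M -> entries_in R1 D -> entries_in R2 (M *m D).
Proof. exact: (entries_inM (short_11 sh)). Qed.

End ShortSubring.

(* The part F_N -> F_(N-1) -> ... of an acyclic complex to the left of a spot,
   numbered so that the index increases along the differential. *)
Record left_complex (k : fieldType) (A : comFalgType k) (R1 R2 : {vspace A})
    (b : nat -> nat) (d : forall j, 'M[A]_(b j, b j.+1)) : Prop := LeftComplex {
  lc_dd : forall j, d j *m d j.+1 = 0;
  lc_min : forall j, entries_in (R1 + R2)%VS (d j);
  lc_ex : forall j (v : 'rV[A]_(b j.+1)),
    entries_in (short_carrier R1 R2) v -> v *m d j.+1 = 0 ->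
    exists2 w, entries_in (short_carrier R1 R2) w & v = w *m d j;
  lc_pos : forall j, (0 < b j)%N }.

(** * Acyclic complexes over short graded rings *)

Section LeftComplexTheory.
Variables (k : fieldType) (A : comFalgType k) (R1 R2 : {vspace A}).
Variables (p0 : 'Hom(A, k^o)) (p1 p2 : 'End(A)).
Hypothesis sh : short_subring R1 R2 p0 p1 p2.
Variables (b : nat -> nat) (d : forall j, 'M[A]_(b j, b j.+1)).
Hypothesis lc : left_complex R1 R2 d.
Local Notation RR := (short_carrier R1 R2).
Local Notation e := (\dim R1).
Local Notation f := (\dim R2).

Definition lin j : 'M[A]_(b j, b j.+1) := mx1 p1 (d j).
Local Notation L := lin.
Local Notation Q j := (mx2 p2 (d j)).

Lemma mRR : (R1 + R2 <= RR)%VS. Proof. exact: addvSr. Qed.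

Lemma d_RR j : entries_in RR (d j).
Proof. by apply: (entries_in_sub mRR); apply: (lc_min lc). Qed.

Lemma lin_R1 j : entries_in R1 (L j).
Proof. by have [] := mx_dec sh (@d_RR j). Qed.

Lemma quad_R2 j : entries_in R2 (Q j).
Proof. by have [] := mx_dec sh (@d_RR j). Qed.

Lemma mx0_m m n (M : 'M[A]_(m, n)) : entries_in (R1 + R2)%VS M -> mx0 p0 M = 0.
Proof.
move=> HM; apply/matrixP => i j; rewrite !mxE; have /memv_addP[x x1 [y y2 ->]] := HM i j.
rewrite linearD /=; have [-> _ _] := short_R1 sh x1.
by have [-> _ _] := short_R2 sh y2; rewrite addr0.
Qed.

Lemma lc_mul j m (M : 'M[A]_(m, b j)) : entries_in RR M ->
  M *m d j = kmx A (mx0 p0 M) *m L j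
             + (kmx A (mx0 p0 M) *m Q j + mx1 p1 M *m L j).
Proof. by move=> HM; rewrite (short_mul sh HM (lc_min lc (j := j))). Qed.

Lemma lc_mul_parts j m (M : 'M[A]_(m, b j)) : entries_in RR M ->
  [/\ mx0 p0 (M *m d j) = 0, mx1 p1 (M *m d j) = kmx A (mx0 p0 M) *m L j
    & mx2 p2 (M *m d j) = kmx A (mx0 p0 M) *m Q j + mx1 p1 M *m L j].
Proof.
move=> HM; have [_ M1 M2] := mx_dec sh HM; rewrite (lc_mul HM).
have h1 : entries_in R1 (kmx A (mx0 p0 M) *m L j).
  apply: entries_in_kmxl; exact: (@lin_R1 _).
have h2 : entries_in R2 (kmx A (mx0 p0 M) *m Q j + mx1 p1 M *m L j).
  apply: entries_inD; first by apply: entries_in_kmxl; exact: (@quad_R2 _).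
  by apply: (entries_in_11 sh) => //; exact: (@lin_R1 _).
have [a0 a1 a2] := mx_1 sh h1; have [b0 b1 b2] := mx_2 sh h2.
by rewrite mx0D mx1D mx2D a0 a1 a2 b0 b1 b2 !addr0 add0r.
Qed.

Lemma lin_lin j : L j *m L j.+1 = 0.
Proof.
have [_ _] := lc_mul_parts (@d_RR j); rewrite (lc_dd lc) mx2_0.
by rewrite mx0_m ?kmx0 ?mul0mx ?add0r; [move=> -> | exact: (lc_min lc (j := j))].
Qed.

(** As R1 R2 = 0, the whole differential kills [v]; the degree 1 part of a preimage under [d j] is
    its constant part times [L j]. *)
Lemma lin_ex j (v : 'rV[A]_(b j.+1)) : entries_in R1 v -> v *m L j.+1 = 0 ->
  exists c, v = kmx A c *m L j.
Proof.
move=> v1 vL; have vR := entries_in_sub (short_R1S R1 R2) v1.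
have [v0 vv _] := mx_1 sh v1.
have [|w wR vw] := lc_ex lc vR.
  by rewrite lc_mul // v0 vv vL kmx0 !mul0mx !addr0.
exists (mx0 p0 w); have [_ h _] := lc_mul_parts wR.
by rewrite -h -vw vv.
Qed.

(** Rows over R2 are cycles; these are the degree 1 and degree 2 parts of the equation
    [v = w *m d j]. *)
Lemma quad_ex j (v : 'rV[A]_(b j.+1)) : entries_in R2 v ->
  exists c w, [/\ entries_in R1 w, kmx A c *m L j = 0
                & v = kmx A c *m Q j + w *m L j].
Proof.
move=> v2; have vR := entries_in_sub (short_R2S R1 R2) v2.
have [v0 v1 vv] := mx_2 sh v2.
have [|w wR vw] := lc_ex lc vR.
  by rewrite lc_mul // v0 v1 kmx0 !mul0mx !addr0.
have [_ h1 h2] := lc_mul_parts wR; have [_ w1 _] := mx_dec sh wR.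
exists (mx0 p0 w), (mx1 p1 w); split=> //; first by rewrite -h1 -vw v1.
by rewrite -h2 -vw vv.
Qed.

(** The hypotheses make [c - w] a cycle, hence a boundary, and by minimality boundaries have no
    constant part. *)
Lemma lin_quad_inj j c (w : 'rV[A]_(b j.+1)) : entries_in R1 w ->
  kmx A c *m L j.+1 = 0 -> kmx A c *m Q j.+1 = w *m L j.+1 -> c = 0.
Proof.
move=> w1 cL cQ.
have cR : entries_in RR (kmx A c).
  exact: entries_in_sub (short_1 R1 R2) (@entries_in_kmx _ _ _ _ c).
have wR := entries_in_sub (short_R1S R1 R2) w1.
have cwR : entries_in RR (kmx A c - w) by apply: entries_inB.
have [c0 c1 c2] := mx_k sh c; have [w0 ww w2] := mx_1 sh w1.
have NE : kmx A c - w = kmx A c + kmx A (-1) *m w.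
  by rewrite /kmx map_mxN map_mx1 mulNmx mul1mx.
have [|u uR E] := lc_ex lc cwR.
  rewrite mulmxBl (lc_mul cR) (lc_mul wR) c0 c1 w0 ww cL cQ kmx0 !mul0mx.
  by rewrite !add0r !addr0 subrr.
have [h _ _] := lc_mul_parts uR.
by move: h; rewrite -E -[in X in X = _ -> _](opprK w) opprK -[kmx A c - w]/(_ + _) mx0D c0
  (_ : mx0 p0 (- w) = 0) ?addr0 //; apply/matrixP => i l;
  move/matrixP/(_ i l): w0; rewrite !mxE linearN /= => ->; rewrite oppr0.
Qed.

(** The constant rows killed by the linear part. A nonzero one must be detected by the quadratic
    part of the differential, so [kap] measures the failure of F to be linear. *)
Definition kap j := kdim 1%VS (L j).
Definition wdim j := kdim R1 (L j).

Lemma dim1A : \dim (1%VS : {vspace A}) = 1%N.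
Proof. by rewrite dim_vline oner_eq0. Qed.

Lemma imgv_lin j : imgv 1%VS (L j) = kerv R1 (L j.+1).
Proof.
apply/eqP; rewrite eqEsubv; apply/andP; split; apply/subvP => g;
  rewrite -[g]row_of_ffunK.
  case/imgvP => v /entries_in1P[c ->] ->; apply/kervP; split.
    by apply: entries_in_kmxl; exact: (@lin_R1 _).
  by rewrite -mulmxA lin_lin mulmx0.
case/kervP => v1 /(lin_ex v1)[c ->]; apply/imgvP; exists (kmx A c) => //.
exact: entries_in_kmx.
Qed.

Lemma kap_wdim j : b j = (kap j + wdim j.+1)%N.
Proof.
by have := kdimE 1%VS (L j); rewrite dim1A muln1 imgv_lin => <-.
Qed.

Lemma wdim_img j : (wdim j + \dim (imgv R1 (L j)) = b j * e)%N.
Proof. exact: kdimE. Qed.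

(** The rows over R2 are the direct sum of the [L]-image of the rows over R1 and the [Q]-image of
    the constants killed by [L]: they span by [quad_ex], and [lin_quad_inj] gives both directness
    and injectivity of [Q] there. *)
Lemma img_kap j : (\dim (imgv R1 (L j.+1)) + kap j.+1 = b j.+2 * f)%N.
Proof.
pose th := linfun (mulmx_ffun (Q j.+1)).
pose K := kerv 1%VS (L j.+1).
have capth : (imgv R1 (L j.+1) :&: (th @: K) = 0)%VS.
  apply/eqP; rewrite -subv0; apply/subvP => g; rewrite -[g]row_of_ffunK memv_cap memv0.
  case/andP => /imgvP[v v1 gv] /memv_imgP[h]; rewrite -[h]row_of_ffunK.
  case/kervP => /entries_in1P[c hc] cL.
  rewrite lfunE /= /mulmx_ffun ffun_of_rowK => /(can_inj (@ffun_of_rowK _ _ _)).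
  rewrite gv hc => /esym E; rewrite hc in cL.
  by rewrite -E (lin_quad_inj v1 cL E) kmx0 mul0mx; apply/eqP/ffunP => i; rewrite !ffunE mxE.
have dimth : \dim (th @: K) = kap j.+1.
  rewrite limg_dim_eq //; apply/eqP; rewrite -subv0; apply/subvP => g.
  rewrite -[g]row_of_ffunK memv_cap memv0 memv_ker lfunE /= /mulmx_ffun.
  case/andP => /kervP[/entries_in1P[c hc] cL]; rewrite hc in cL *.
  rewrite ffun_of_rowK => /eqP h.
  have E : kmx A c *m Q j.+1 = 0 *m L j.+1.
    by rewrite mul0mx -[LHS]ffun_of_rowK h; apply/rowP => i; rewrite !mxE ffunE.
  rewrite (lin_quad_inj (@entries_in0 _ _ R1 _ _) cL E) kmx0.
  by apply/eqP/ffunP => i; rewrite !ffunE mxE.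
rewrite -dimth -dimv_disjoint_sum // -dim_pointwise; congr (\dim _).
apply/eqP; rewrite eqEsubv; apply/andP; split; apply/subvP => g.
  case/memv_addP => x + [y + ->]; rewrite -[x]row_of_ffunK -[y]row_of_ffunK.
  case/imgvP => v v1 -> /memv_imgP[h]; rewrite -[h]row_of_ffunK.
  case/kervP => /entries_in1P[c hc] cL.
  rewrite lfunE /= /mulmx_ffun ffun_of_rowK => ->; apply/pointwiseP => i.
  rewrite !ffunE rpredD //; first exact: (entries_in_11 sh v1 (@lin_R1 _)).
  by rewrite hc; apply: entries_in_kmxl; exact: (@quad_R2 _).
move=> /pointwiseP g2.
have [|c [w [w1 cL E]]] := @quad_ex j.+1 (row_of_ffun g).
  by move=> i l; rewrite mxE.
apply/memv_addP; exists (ffun_of_row (w *m L j.+1)); first by apply/imgvP; exists w.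
exists (ffun_of_row (kmx A c *m Q j.+1)).
  apply/memv_imgP; exists (ffun_of_row (kmx A c)).
    by apply/kervP; split=> //; apply: entries_in_kmx.
  by rewrite lfunE /= /mulmx_ffun ffun_of_rowK.
rewrite addrC -[g]row_of_ffunK E.
by apply/ffunP => i; rewrite !ffunE mxE.
Qed.

(** A basis [N] of the constants killed by [L j] is row free, so rows over R1 times [N] form a space
    of dimension [kap j * e] inside the linear kernel. *)
Lemma kap_le j : (kap j * e <= wdim j)%N.
Proof.
have [N hN] := entries_in1P (@kbasis_entries _ _ 1%VS _ _ (L j)).
have k0 : kdim R1 (kmx A N) = 0%N.
  apply/eqP; rewrite /kdim dimv_eq0 -subv0; apply/subvP => g; rewrite memv0.
  rewrite -[g]row_of_ffunK => /kervP[_ h].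
  have fr : row_free N.
    rewrite -kermx_eq0; apply/eqP; apply: (@kbasis_freemx _ _ 1%VS _ _ _ (L j)).
    by rewrite hN -kmxM mulmx_ker kmx0.
  by rewrite (kmx_free_inj fr h); apply/eqP/ffunP => i; rewrite !ffunE mxE.
have := kdimE R1 (kmx A N); rewrite k0 add0n => <-; apply: dimvS.
apply/subvP => g; rewrite -[g]row_of_ffunK => /imgvP[v v1 ->]; apply/kervP.
split; first exact: entries_in_kmxr.
by rewrite -mulmxA -hN kbasisM mulmx0.
Qed.

Hypothesis e2 : (2 <= e)%N.

(** Let S be the line of a nonzero socle element. Rows over S lie in the linear kernel, so b_(j+1)
    <= wdim_(j+1) <= b_j. Once b is constant these kernels are exactly the rows over S; then the
    linear part has entries in S, kills all rows over R1, and its kernel has dimension e b_j >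
    b_j. *)
Lemma left_complex_socle x : x \in R1 -> (forall y, y \in R1 -> x * y = 0) -> x = 0.
Proof.
move=> x1 xs; apply/eqP; apply: contraT => x0.
pose S := <[x]>%VS; have dS : \dim S = 1%N by rewrite dim_vline x0.
have SW j : (pointwise S (b j) <= kerv R1 (L j))%VS.
  apply/subvP => g /pointwiseP gS; rewrite -[g]row_of_ffunK; apply/kervP; split.
    by move=> i l; rewrite mxE; have /vlineP[a ->] := gS l; apply: rpredZ.
  apply/rowP => l; rewrite !mxE big1 // => i _; rewrite mxE.
  by have /vlineP[a ->] := gS i; rewrite -scalerAl xs ?scaler0 ?lin_R1.
have Wge j : (b j <= wdim j)%N.
  by have := dimvS (SW j); rewrite dim_pointwise dS muln1.
have bd j : (b j.+1 <= b j)%N.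
  by rewrite [leqRHS]kap_wdim; apply: leq_trans (Wge _) (leq_addl _ _).
have [J _ HJ] := @nonincreasing_stabilizes b 0 (fun j _ => bd j).
have W1 : wdim J.+1 = b J.+1.
  by apply/eqP; rewrite eqn_leq Wge andbT HJ // (kap_wdim J) leq_addl.
have W2 : wdim J.+2 = b J.+2.
  apply/eqP; rewrite eqn_leq Wge andbT (HJ J.+2) ?(ltnW (leqnSn _)) //.
  by rewrite -(HJ J.+1) // (kap_wdim J.+1) leq_addl.
have WE : kerv R1 (L J.+2) = pointwise S (b J.+2).
  apply/esym/eqP; rewrite eqEdim SW /= dim_pointwise dS muln1.
  by rewrite -[leqLHS]/(wdim J.+2) W2.
(* The rows of [L J.+1] are linear cycles for [L J.+2], whose kernel consists of the rows over S. *)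
have LS i l : L J.+1 i l \in S.
  have : ffun_of_row (row i (L J.+1)) \in pointwise S (b J.+2).
    rewrite -WE; apply/kervP; split; first by apply: row_entries_in; exact: (@lin_R1 _).
    pose c : 'rV[k]_(b J.+1) := delta_mx 0 i.
    have rE : row i (L J.+1) = kmx A c *m L J.+1.
      by rewrite rowE /kmx map_delta_mx.
    have : (ffun_of_row (kmx A c *m L J.+1)) \in imgv 1%VS (L J.+1).
      by apply/imgvP; exists (kmx A c) => //; apply: entries_in_kmx.
    rewrite imgv_lin => /kervP[_]; by rewrite -rE.
  by move/pointwiseP/(_ l); rewrite ffunE mxE.
have : (b J.+1 * e <= wdim J.+1)%N.
  rewrite -dim_pointwise; apply: dimvS; apply/subvP => g /pointwiseP g1.
  rewrite -[g]row_of_ffunK; apply/kervP; split; first by move=> i l; rewrite mxE.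
  apply/rowP => l; rewrite !mxE big1 // => i _; rewrite mxE.
  by have /vlineP[a ->] := LS i l; rewrite -scalerAr mulrC xs ?scaler0.
by rewrite W1; have := lc_pos lc J.+1; move: e2 (b _); nia.
Qed.
End LeftComplexTheory.

(** * Growth of the strand of k and the dimension of the socle *)

Section SocleDimension.
Variables (k : fieldType) (A : comFalgType k) (R1 R2 : {vspace A}).
Variables (p0 : 'Hom(A, k^o)) (p1 p2 : 'End(A)).
Hypothesis sh : short_subring R1 R2 p0 p1 p2.
Variables (b : nat -> nat) (d : forall j, 'M[A]_(b j, b j.+1)).
Hypothesis lc : left_complex R1 R2 d.
Local Notation e := (\dim R1).
Local Notation f := (\dim R2).
Local Notation L := (lin p1 d).
Local Notation kap := (kap p1 d).
Local Notation wdim := (wdim R1 p1 d).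

(** With no columns every row is killed, so the strand from here is the linear strand of the
    resolution of k, beginning with ranks 1 and e. *)
Definition kstage : stage A := Stage (0 : 'M[A]_(1, 0)).

Local Notation st := (strand R1 kstage).

Lemma strand_entries i : entries_in R1 (smx (st i)).
Proof. by case: i => [|i] /=; [move=> ? [] | apply: kbasis_entries]. Qed.

Lemma strand_dim_ge i :
  (srows (st i.+1) * e <= srows (st i.+2) + srows (st i) * f)%N.
Proof. exact: (kdim_ge (short_11 sh) (@strand_entries i.+1)). Qed.

Lemma strand_dim1 : srows (st 1) = e.
Proof.
have := kdimE R1 (0 : 'M[A]_(1, 0)); rewrite mul1n => <-.
rewrite [X in (_ + X)%N](_ : _ = 0%N) ?addn0 //.
by apply/eqP; rewrite -leqn0; apply: leq_trans (dimvS (subvf _)) _; rewrite dimvf /dim /= card_ord mul0n.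
Qed.

(** A constant row killed by [L (j + i)] starts a map from the strand of k into F. By [lin_ex] each
    linear syzygy lifts one step to the left with coefficients in k, and independence of the rows of
    the strand keeps the maps injective. *)
Lemma strand_embed i j : kap (j + i) != 0%N ->
  exists N : 'M[k]_(srows (st i), b j), row_free N /\
    forall v : 'rV[A]_(srows (st i)), entries_in R1 v -> v *m smx (st i) = 0 ->
      v *m kmx A N *m L j = 0.
Proof.
elim: i j => [|i IH] j.
  rewrite addn0 => kj.
  have k0 : (0 < kap j)%N by rewrite lt0n.
  have [N hN] := entries_in1P (@kbasis_entries _ _ 1%VS _ _ (L j)).
  pose i0 : 'I_(kap j) := Ordinal k0.
  exists (row i0 N); split.
    rewrite -kermx_eq0; apply/eqP.
    have : kmx A (kermx (row i0 N) *m delta_mx 0 i0 : 'M[k]_(1, kap j))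
       *m kbasis 1%VS (L j) = 0.
      by rewrite hN -kmxM -mulmxA -rowE mulmx_ker kmx0.
    move/kbasis_freemx => h; apply/rowP => l; rewrite ord1.
    by move/rowP/(_ i0): h; rewrite !mxE big_ord1 !mxE !eqxx mulr1.
  move=> v _ _; rewrite -mulmxA.
  have -> : kmx A (row i0 N) = row i0 (kbasis 1%VS (L j)) by rewrite hN /kmx map_row.
  by rewrite -row_mul kbasisM linear0 mulmx0.
rewrite addnS -addSn => /IH[N [fN HN]].
have [N' HN'] : exists N', smx (st i.+1) *m kmx A N = kmx A N' *m L j.
  apply: row_factor => a; apply: (lin_ex sh lc).
    by apply: row_entries_in; apply: entries_in_kmxr; apply: kbasis_entries.
  rewrite -row_mul -[_ *m L j.+1]mulmxA; apply/rowP => l.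
  rewrite row_mul mulmxA HN ?mxE //; first by apply: row_entries_in; apply: kbasis_entries.
  by rewrite -row_mul kbasisM linear0.
exists N'; split.
  rewrite -kermx_eq0; apply/eqP; set K := kermx N'.
  have : kmx A K *m smx (st i.+1) *m kmx A N = 0.
    by rewrite -mulmxA HN' mulmxA -kmxM mulmx_ker kmx0 mul0mx.
  by move/(kmx_free_inj fN)/kbasis_freemx.
by move=> v v1 vD; rewrite -mulmxA -HN' mulmxA vD mul0mx.
Qed.

Hypothesis e3 : (3 <= e)%N.
Hypothesis f2 : (2 <= f)%N.

Lemma kap_bound j : (b j.+2 * f + kap j.+1 * (e - 1) <= b j.+1 * e)%N.
Proof.
have := kap_le R1 p1 d j.+1; have := img_kap sh lc j; have := wdim_img R1 p1 d j.+1.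
by move: (\dim (imgv _ _)) => x; move: e3 => e3'; nia.
Qed.

(** If e <= f, [kap_bound] makes the ranks eventually constant, equal to some c > 0. Then [kap]
    vanishes there and the counts give c e = c + c f, a contradiction. *)
Lemma socle_dim_lt : (f < e)%N.
Proof.
rewrite ltnNge; apply/negP => ef.
have bd j : (1 <= j)%N -> (b j.+1 <= b j)%N.
  by case: j => // j _; have := kap_bound j; move: e3 ef; nia.
have [J J1 HJ] := nonincreasing_stabilizes bd.
case: J J1 HJ => // J _ HJ.
have := kap_bound J; have := kap_bound J.+1; have := wdim_img R1 p1 d J.+2.
have := img_kap sh lc J.+1; have := kap_wdim sh lc J.+1; have := lc_pos lc J.+1.
move: (\dim (imgv _ _)) (kap J.+1) (kap J.+2) (wdim J.+2) => y k1 k2 w2.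
rewrite (HJ J.+2) // (HJ J.+3) //; last by rewrite ltnW.
move: (b J.+1) => c c0 h1 h2 h3 h4 h5.
have cfe : (c * e <= c * f)%N by rewrite leq_mul2l ef orbT.
have k10 : k1 = 0%N by move: e3; nia.
have k20 : k2 = 0%N by move: e3; nia.
by lia.
Qed.

(** Inductively s_(i+2) >= e s_(i+1) - f s_i >= (e - f / 2) s_(i+1), and f < e with e >= 3 makes the
    factor at least 2. *)
Lemma strand_dim_double i : (2 * srows (st i) <= srows (st i.+1))%N.
Proof.
elim: i => [|i IH]; first by rewrite strand_dim1 muln1 ltnW.
by have := strand_dim_ge i; move: IH socle_dim_lt e3; nia.
Qed.

Lemma strand_dim_exp i : (2 ^ i <= srows (st i))%N.
Proof.
elim: i => [//|i IH]; rewrite expnS; apply: leq_trans (strand_dim_double i).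
by rewrite leq_mul2l.
Qed.

(** Otherwise the term of index j of the strand of k, of rank at least 2^j, embeds over k into the
    fixed space of dimension b_0 <= j. *)
Lemma kap_eventually0 j : (b 0 <= j)%N -> kap j = 0%N.
Proof.
move=> bj; apply/eqP; apply: contraT => kj.
have [N [fN _]] := @strand_embed j 0 kj.
have := strand_dim_exp j; have := ltn_expl j (ltnSn 1).
have : (srows (st j) <= b 0)%N by rewrite -(eqP fN) rank_leq_col.
lia.
Qed.

Lemma socle_dim : e = f.+1.
Proof.
apply: (@backward_recurrence b e f (b 0)) => //; first exact: (lc_pos lc).
move=> j bj; have := kap_wdim sh lc j; have := wdim_img R1 p1 d j.+1.
have := img_kap sh lc j; rewrite !kap_eventually0 ?(leq_trans bj) //.
by move: (\dim (imgv _ _)) => x; lia.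
Qed.

End SocleDimension.

(** * Graded local algebras *)

Section Residue.
Variables (k : fieldType) (A : comFalgType k) (m : {vspace A}).
Hypothesis m1 : (1 :&: m = 0)%VS.

Lemma residue_is_linear : linear (residue m : A -> k^o).
Proof. by move=> a x y; rewrite /residue !linearP. Qed.
HB.instance Definition _ := GRing.isLinear.Build k A k^o _ (residue m)
  residue_is_linear.

Lemma residue1 : residue m 1 = 1.
Proof.
rewrite /residue daddv_pi_id ?memv_line //.
have fr : free [tuple (1 : A)] by rewrite seq1_free oner_eq0.
exact: (coord_free ord0 ord0 fr).
Qed.

Lemma residue_m x : x \in m -> residue m x = 0.
Proof.
move=> xm; rewrite /residue.
have xm1 : x \in (1 + m)%VS by rewrite -[x]add0r memv_add ?mem0v.
have := daddv_pi_add m1 xm1.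
rewrite [X in _ + X](@daddv_pi_id _ _ m 1%VS) //; last by rewrite capvC.
move/(canRL (addrK _)); rewrite subrr => ->.
by rewrite linear0.
Qed.

End Residue.

Section Duality.
Variables (k : fieldType) (V : vectType k).

(** A basis of [U] gives an injective evaluation map from [V] to k^(dim U), so dim [V] <= dim
    [U]. *)
Lemma dual_separating_full (U : {vspace 'Hom(V, k^o)}) :
  (forall x : V, (forall al, al \in U -> al x = 0) -> x = 0) -> U = fullv.
Proof.
move=> sep; pose n := \dim U.
pose g (x : V) : {ffun 'I_n -> k^o} := [ffun i : 'I_n => (vbasis U)`_i x].
have g_lin : linear g by move=> a x y; apply/ffunP => i; rewrite !ffunE linearP.
pose gL : {linear V -> {ffun 'I_n -> k^o}} :=
  HB.pack g (GRing.isLinear.Build k V {ffun 'I_n -> k^o} _ g g_lin).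
have ker0 : lker (linfun gL) == 0%VS.
  rewrite -subv0; apply/subvP => x; rewrite memv_ker lfunE memv0 /= => /eqP g0.
  apply/eqP/sep => al /coord_vbasis ->; rewrite sum_lfunE big1 // => i _.
  rewrite scale_lfunE; move/ffunP/(_ i): g0; rewrite !ffunE => ->.
  by rewrite scaler0.
have dV : (\dim (fullv : {vspace V}) <= n)%N.
  have := limg_ker_dim (linfun gL) fullv; rewrite (eqP ker0) capv0 dimv0 add0n => <-.
  apply: leq_trans (dimvS (subvf _)) _.
  by rewrite dimvf /dim /= card_ord muln1.
apply/eqP; rewrite eqEdim subvf /=; move: dV; rewrite !dimvf.
by rewrite -[X in (X <= _)%N]muln1.
Qed.

End Duality.

Section Ideals.
Variable A : comNzRingType.

Lemma in_idl_ideal (s : seq A) :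
  [/\ in_idl s 0, forall x y, in_idl s x -> in_idl s y -> in_idl s (x + y),
      forall a x, in_idl s x -> in_idl s (a * x)
    & forall i, (i < size s)%N -> in_idl s s`_i].
Proof.
split.
- by exists (fun=> 0); rewrite big1 // => i _; rewrite mul0r.
- move=> x y [c ->] [d ->]; exists (fun i => c i + d i).
  by rewrite -big_split; apply: eq_bigr => i _; rewrite mulrDl.
- move=> a x [c ->]; exists (fun i => a * c i).
  by rewrite mulr_sumr; apply: eq_bigr => i _; rewrite mulrA.
- move=> i si; exists (fun j => (j == i)%:R).
  rewrite (bigD1 (Ordinal si)) //= eqxx mul1r big1 ?addr0 // => j ne.
  by rewrite (_ : (j == i :> nat) = false) ?mul0r //; apply: contraNF ne => /eqP e; apply/eqP/val_inj.
Qed.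

End Ideals.

Section Generators.
Variables (k : fieldType) (A : comFalgType k).

Lemma in_idl_span (s : seq A) (U : {vspace A}) :
  (forall i, (i < size s)%N -> s`_i \in U) -> (forall a x, x \in U -> a * x \in U) ->
  forall x, in_idl s x -> x \in U.
Proof. by move=> sU UM x [c ->]; rewrite rpred_sum // => i _; apply/UM/sU. Qed.

Lemma in_idl_vbasis (U : {vspace A}) x : x \in U -> in_idl (vbasis U) x.
Proof.
have [i0 iD iM ii] := in_idl_ideal (vbasis U).
move/coord_vbasis ->; apply: big_ind => // i _.
by rewrite -mulr_algl; apply/iM/ii; rewrite size_tuple.
Qed.

Lemma minimal_generators_exist (m : {vspace A}) : (forall a x, x \in m -> a * x \in m) ->
  exists s, minimal_generators m s.
Proof.
move=> mM; have [n [s gs sn]] : exists n, exists2 s, generates m s & size s = n.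
  exists (\dim m), (vbasis m); last by rewrite size_tuple.
  move=> a; split; first exact: in_idl_vbasis.
  by apply: in_idl_span => // i si; rewrite vbasis_mem // mem_nth.
elim/ltn_ind: n s gs sn => n IH s gs sn.
have [[s' gs' lt]|no] :=
    boolp.pselect (exists2 s', generates m s' & (size s' < size s)%N).
  by apply: (IH (size s')) gs' _ => //; rewrite -sn.
exists s; split=> // s' gs'; rewrite leqNgt; apply/negP => lt.
by apply: no; exists s'.
Qed.

Variables (m A1 : {vspace A}) (c0 : A -> k) (q1 : 'End(A)).
Hypothesis mM : forall a x, x \in m -> a * x \in m.
Hypothesis A1m : (A1 <= m)%VS.
Hypothesis m_gen : forall a, a \in m -> in_idl (vbasis A1) a.
Hypothesis q1_id : forall x, x \in A1 -> q1 x = x.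
Hypothesis q1_mul : forall a x : A, x \in m -> q1 (a * x) = c0 a *: q1 x.

Lemma vbasis_generates : generates m (vbasis A1).
Proof.
move=> a; split; first exact: m_gen.
apply: in_idl_span => // i si; apply: (subvP A1m).
by rewrite vbasis_mem // mem_nth.
Qed.

(** [q1] plays the role of the projection of m onto m / m^2: it is linear over the residue field, so
    the images of any generators span [A1]. *)
Lemma generates_size s : generates m s -> (\dim A1 <= size s)%N.
Proof.
move=> gs; have sm i : (i < size s)%N -> s`_i \in m.
  by move=> si; apply/gs; have [_ _ _ ii] := in_idl_ideal s; apply: ii.
apply: leq_trans (_ : \dim <<map q1 s>>%VS <= _)%N; last first.
  by apply: leq_trans (dim_span _) _; rewrite size_map.
apply/dimvS/subvP => a a1; rewrite -(q1_id a1).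
have /gs[c ->] := subvP A1m _ a1.
rewrite linear_sum rpred_sum //= => i _; rewrite q1_mul ?sm // rpredZ //.
by rewrite memv_span // map_f // mem_nth.
Qed.

Lemma vbasis_minimal_generators : minimal_generators m (vbasis A1).
Proof.
split; first exact: vbasis_generates.
by move=> s /generates_size; rewrite size_tuple.
Qed.

Lemma embdimE e : embdim m e <-> e = \dim A1.
Proof.
split=> [[s [gs mins] <-]|->].
  apply/eqP; rewrite eqn_leq generates_size // andbT.
  by have := mins _ vbasis_generates; rewrite size_tuple.
by exists (vbasis A1); [apply: vbasis_minimal_generators | rewrite size_tuple].
Qed.

End Generators.

Section ShortGraded.
Variables (k : fieldType) (R : comFalgType k) (G : nat -> {vspace R}) (m : {vspace R}).
Hypothesis std : standard_graded_local m G.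
Hypothesis soc : socle_degree m 2.
Local Notation R1 := (G 1%N).
Local Notation R2 := (G 1%N * G 1%N)%VS.

Lemma graded_m i : (0 < i)%N -> (G i <= m)%VS.
Proof.
case: std => -[G0 _ _ [n [full ->]]] _ i0.
have [ni|ni] := ltnP i n.
  by rewrite (bigD1_seq i) ?mem_index_iota ?i0 ?iota_uniq //= addvSl.
apply/subvP => x xi.
(* For i >= n the component is 0: x is also a sum of components of index below n, against
   directness. *)
have : x \in (\sum_(0 <= j < n) G j)%VS by rewrite -full memvf.
rewrite big_mkord => /memv_sumP[vs vsG E].
case: std => -[_ _ dir _] _.
have /directv_sum_independent := dir i.+1.
move/(_ (fun l => if l == i :> nat then - x else
   if insub (val l) is Some l' then vs l' else 0)).
have H : forall l : 'I_i.+1, true -> (if l == i :> nat then - x else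
   if insub (val l) is Some l' then vs l' else 0) \in G l.
  move=> l _; case: eqP => [->|_]; first by rewrite rpredN.
  case: insubP => [l' _ <-|_]; [exact: vsG | exact: mem0v].
move/(_ H); rewrite (bigD1 ord_max) //= eqxx.
suff -> : \sum_(l < i.+1 | l != ord_max) (if l == i :> nat then - x else
   if insub (val l) is Some l' then vs l' else 0) = x.
  rewrite addNr => /(_ erefl ord_max isT); rewrite /= eqxx => /eqP.
  by rewrite oppr_eq0 => /eqP ->; rewrite mem0v.
rewrite [RHS]E; transitivity (\sum_(l < i.+1 | (l < n)%N)
    if insub (val l) is Some l' then vs l' else 0).
  rewrite big_mkcond [RHS]big_mkcond; apply: eq_bigr => l _.
  rewrite -val_eqE /=; case: (eqVneq (l : nat) i) => [->|li] /=.
    by rewrite ltnNge ni.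
  by case: (ltnP l n) => // nl; rewrite insubF // ltnNge nl.
have nSi : (n <= i.+1)%N by apply: leq_trans ni _.
pose F l := if @insub nat (fun j => j < n)%N 'I_n l is Some l' then vs l' else 0.
rewrite -(big_ord_widen i.+1 F nSi); apply: eq_bigr => l _.
by rewrite /F valK.
Qed.

Lemma expv_m3 : (m ^+ 3 = 0)%VS.
Proof.
case: soc => + _; rewrite /ideal_pow => h; apply/eqP; rewrite -subv0 -h.
by rewrite -{1}[(m ^+ 3)%VS]prod1v; apply: prodvSl; apply: subvf.
Qed.

Lemma graded_cube : (R1 * R2 = 0)%VS.
Proof.
apply/eqP; rewrite -subv0 -expv_m3; have h := graded_m (ltn0Sn 0).
by rewrite expvSl expv2; apply: prodvS => //; apply: prodvS.
Qed.

Lemma graded_R2S : (R2 <= G 2%N)%VS.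
Proof. by case: std => -[_ GM _ _] _; apply/prodvP => x y; apply: GM. Qed.

(** Generation by R1 gives A = 1 + R1 A; after substituting this into itself, the term R1^3 A
    vanishes because m^3 = 0. *)
Lemma graded_full : fullv = short_carrier R1 R2.
Proof.
case: std => _ ag; have E : fullv = (1 + R1 * fullv)%VS by rewrite -{1}ag agenvEl ag.
rewrite {1}E {1}E {1}E !prodvDr !prodv1 !prodvA -(prodvA R1 R1 R1).
by rewrite graded_cube prod0v addv0.
Qed.

Lemma graded_comp i x : x \in G i -> exists a y z, [/\ y \in R1, z \in R2 &
  x = a%:A + y + z].
Proof.
move=> _; have : x \in short_carrier R1 R2 by rewrite -graded_full memvf.
case/memv_addP => _ /vlineP[a ->] [_ /memv_addP[y y1 [z z2 ->]] ->].
by exists a, y, z; rewrite addrA.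
Qed.

Lemma graded_unique i x a y z : (2 < i)%N -> x \in G i -> y \in R1 -> z \in G 2%N ->
  x = a%:A + y + z -> [/\ x = 0, a = 0, y = 0 & z = 0].
Proof.
case: std => -[G0 _ dir _] _ i2 xi y1 z2 E.
have /directv_sum_independent := dir i.+1.
pose v (l : nat) := if l == 0%N then a%:A else if l == 1%N then y else
   if l == 2 then z else if l == i then - x else 0.
move/(_ (fun l => v l)).
have H : forall l : 'I_i.+1, true -> v l \in G l.
  move=> l _; rewrite /v; case: eqP => [->|_]; first by rewrite G0 rpredZ ?memv_line.
  case: eqP => [->//|_]; case: eqP => [->//|_]; case: eqP => [->|_].
    by rewrite rpredN.
  exact: mem0v.
have [n0 n1 n2] : [/\ (i == 0) = false, (i == 1) = false & (i == 2) = false]%N.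
  by move: i2; clear; case: i => [|[|[|i]]].
have vi : v i = - x by rewrite /v n0 n1 n2 eqxx.
move/(_ H) => {H}; have S : \sum_(l < i.+1) v l = 0.
  rewrite -(big_mkord xpredT v) big_nat_recr //= vi; apply/eqP; rewrite subr_eq0.
  have -> : \sum_(0 <= l < i) v l = \sum_(0 <= l < 3) v l + \sum_(3 <= l < i) v l.
    by rewrite (@big_cat_nat _ _ _ 3).
  have -> : \sum_(3 <= l < i) v l = 0.
    rewrite big_nat_cond big1 // => l; rewrite andbT /v => /andP[l3 li].
    by case: l l3 li => [|[|[|l]]] //= _ li; rewrite ltn_eqF.
  rewrite big_nat_recr // big_nat_recr // big_nat_recr // big_geq //= add0r addr0.
  by rewrite E.
move/(_ S) => H.
have h0 := H (@Ordinal i.+1 0 isT) isT.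
have h1 := H (@Ordinal i.+1 1 (ltnW (ltnW i2))) isT.
have h2 := H (@Ordinal i.+1 2 (ltnW i2)) isT.
have hi := H ord_max isT.
rewrite /v /= in h0 h1 h2 hi; split=> //.
  by move: hi; rewrite n0 n1 n2 eqxx => /eqP; rewrite oppr_eq0 => /eqP.
by move/eqP: h0; rewrite scaler_eq0 oner_eq0 orbF => /eqP.
Qed.

Lemma graded_high i : (2 < i)%N -> G i = 0%VS.
Proof.
move=> i2; apply/eqP; rewrite -subv0; apply/subvP => x xi.
have [a [y [z [y1 z2 E]]]] := graded_comp xi.
have [-> _ _ _] := graded_unique i2 xi y1 (subvP graded_R2S _ z2) E.
exact: mem0v.
Qed.

Lemma graded_sum0 a y z : y \in R1 -> z \in G 2%N -> a%:A + y + z = 0 ->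
  [/\ a = 0, y = 0 & z = 0].
Proof.
move=> y1 z2 E.
by have [] := graded_unique (ltnSn 2) (mem0v (G 3)) y1 z2 (esym E).
Qed.

Lemma graded_2 : G 2%N = R2.
Proof.
apply/eqP; rewrite eqEsubv graded_R2S andbT; apply/subvP => x x2.
have [a [y [z [y1 z2 E]]]] := graded_comp x2.
have [|||_ _ /eqP] := @graded_sum0 a y (z - x).
- exact: y1.
- by rewrite rpredB // (subvP graded_R2S).
- by rewrite addrA -E subrr.
by rewrite subr_eq0 => /eqP <-.
Qed.

Lemma graded_mE : m = (R1 + R2)%VS.
Proof.
apply/eqP; rewrite eqEsubv; apply/andP; split; last first.
  by rewrite subv_add !(graded_m) // -graded_2 graded_m.
case: std => -[_ _ _ [n [_ ->]]] _; rewrite big_nat_cond.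
apply: (big_ind (fun U => U <= R1 + R2)%VS); first exact: sub0v.
  by move=> U V HU HV; rewrite subv_add HU.
move=> [|[|[|i]]] //= _; first exact: addvSl.
  by rewrite graded_2 addvSr.
by rewrite graded_high // sub0v.
Qed.

Lemma graded_m1 : (1 :&: m = 0)%VS.
Proof.
apply/eqP; rewrite -subv0; apply/subvP => x; rewrite memv_cap memv0 graded_mE.
case/andP => /vlineP[a ->] /memv_addP[y y1 [z z2 /eqP]].
rewrite -subr_eq0 opprD addrA => /eqP h.
have [|||-> _ _] := @graded_sum0 a (- y) (- z); rewrite ?rpredN ?graded_2 //.
by rewrite scale0r.
Qed.

Lemma graded_m_ideal a x : x \in m -> a * x \in m.
Proof.
rewrite graded_mE => /memv_addP[y y1 [z z2 ->]].
have : a \in short_carrier R1 R2 by rewrite -graded_full memvf.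
case/memv_addP => _ /vlineP[c ->] [_ /memv_addP[u u1 [v v2 ->]] ->].
have hz : forall w, w \in R1 -> w * z = 0.
  by move=> w w1; apply/eqP; rewrite -memv0 -graded_cube memv_mul.
have hv : v * y = 0.
  by apply/eqP; rewrite mulrC -memv0 -graded_cube memv_mul.
have vz : v * z = 0.
  apply/eqP; rewrite -memv0 -(prodv0 R1) -{1}graded_cube.
  rewrite prodvA; exact: memv_mul.
rewrite !mulrDl !mulrDr (hz _ u1) hv vz !addr0 -!scalerAl !mul1r.
by rewrite -addrA memv_add ?rpredZ // rpredD ?rpredZ ?memv_mul.
Qed.

Definition gp0 : 'Hom(R, k^o) := linfun (residue m : R -> k^o).
Definition gp1 : 'End(R) := daddv_pi R1 (1 + R2)%VS.
Definition gp2 : 'End(R) := daddv_pi R2 (1 + R1)%VS.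

Lemma graded_d1 : (R1 :&: (1 + R2) = 0)%VS.
Proof.
apply/eqP; rewrite -subv0; apply/subvP => x; rewrite memv_cap memv0.
case/andP => x1 /memv_addP[_ /vlineP[a ->] [z z2 h]].
have [|||_ /eqP + _] := @graded_sum0 a (- x) z; rewrite ?rpredN ?graded_2 //.
  by rewrite h addrAC subrr.
by rewrite oppr_eq0.
Qed.

Lemma graded_d2 : (R2 :&: (1 + R1) = 0)%VS.
Proof.
apply/eqP; rewrite -subv0; apply/subvP => x; rewrite memv_cap memv0.
case/andP => x2 /memv_addP[_ /vlineP[a ->] [z z1 h]].
have [|||_ _ /eqP] := @graded_sum0 a z (- x); rewrite ?rpredN ?graded_2 //.
  by rewrite h subrr.
by rewrite oppr_eq0.
Qed.

Lemma daddv_pi0 (U V : {vspace R}) x : (U :&: V = 0)%VS -> x \in V -> daddv_pi U V x = 0.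
Proof.
move=> UV xV; have xUV : x \in (U + V)%VS by rewrite -[x]add0r memv_add ?mem0v.
have := daddv_pi_add UV xUV.
rewrite [X in _ + X](@daddv_pi_id _ _ V U) //; last by rewrite capvC.
by move/(canRL (addrK _)); rewrite subrr.
Qed.

Lemma graded_short : short_subring R1 R2 gp0 gp1 gp2.
Proof.
have e1 : 1 \in (1 + R2 : {vspace R})%VS by apply: (subvP (addvSl _ _)); apply: memv_line.
have e2 : 1 \in (1 + R1 : {vspace R})%VS by apply: (subvP (addvSl _ _)); apply: memv_line.
have m1 x : x \in R1 -> x \in m by move=> x1; rewrite graded_mE -[x]addr0 memv_add ?mem0v.
have m2 x : x \in R2 -> x \in m by move=> x1; rewrite graded_mE -[x]add0r memv_add ?mem0v.
split.
- rewrite /gp0 /gp1 /gp2 lfunE /= residue1 ?graded_m1 // !daddv_pi0 //.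
  + exact: graded_d2.
  + exact: graded_d1.
- move=> x x1; have x2 : x \in (1 + R1)%VS by apply: (subvP (addvSr _ _)).
  split; first by rewrite lfunE /= residue_m ?graded_m1 ?m1.
    exact: daddv_pi_id graded_d1 x1.
  exact: daddv_pi0 graded_d2 x2.
- move=> x x1; have x2 : x \in (1 + R2)%VS by apply: (subvP (addvSr _ _)).
  split; first by rewrite lfunE /= residue_m ?graded_m1 ?m2.
    exact: daddv_pi0 graded_d1 x2.
  exact: daddv_pi_id graded_d2 x1.
- by move=> x y x1 y1; apply: memv_mul.
- by move=> x y x1 y1; apply/eqP; rewrite -memv0 -graded_cube memv_mul.
- move=> x y x1 y1; apply/eqP; rewrite -memv0 -(prodv0 R1) -{1}graded_cube.
  rewrite prodvA; exact: memv_mul.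
- exact: subvv.
Qed.

Lemma graded_R2_neq0 : R2 != 0%VS.
Proof.
case: soc => _; apply: contra => /eqP h; rewrite /ideal_pow expv2 graded_mE.
by rewrite h addv0 h prodv0.
Qed.

End ShortGraded.

(** * The trivial extension *)

Section TrivextParts.
Variables (k : fieldType) (R : comFalgType k).
Local Notation T := (trivext R).
Implicit Types (p : 'End(R)) (u v : T).

Lemma trivextE u v : u * v = (u.1 * v.1, dual_act u.1 v.2 + dual_act v.1 u.2).
Proof. by []. Qed.

Lemma trivext_mul1E u v : (u * v).1 = u.1 * v.1.
Proof. by []. Qed.

Lemma trivext_mul2E u v x : (u * v).2 x = v.2 (u.1 * x) + u.2 (v.1 * x).
Proof. by rewrite /= add_lfunE !dual_actE. Qed.

Lemma trivext_eqP u v : u.1 = v.1 -> (forall x, u.2 x = v.2 x) -> u = v.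
Proof. by case: u v => [a al] [b be] /= -> h; congr pair; apply/lfunP. Qed.

Lemma trivextD1 u v : (u + v).1 = u.1 + v.1. Proof. by []. Qed.
Lemma trivextD2 u v x : (u + v).2 x = u.2 x + v.2 x.
Proof. exact: add_lfunE. Qed.
Lemma trivextZ1 (a : k) u : (a *: u).1 = a *: u.1. Proof. by []. Qed.
Lemma trivextZ2 (a : k) u x : (a *: u).2 x = a *: u.2 x.
Proof. exact: scale_lfunE. Qed.

(** For an idempotent [p] these two maps project T onto the image of [p] and onto the functionals
    factoring through [p], that is, the dual of that image. *)
Definition ring_part p u : T := (p u.1, 0).
Definition dual_part p u : T := (0, (u.2 \o p)%VF).

Fact ring_part_linear p : linear (ring_part p).
Proof.
move=> a u v; apply: trivext_eqP => [|x]; first exact: linearP.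
by rewrite trivextD2 trivextZ2 zero_lfunE scaler0 addr0.
Qed.
HB.instance Definition _ p := GRing.isLinear.Build k T T _ (ring_part p)
  (@ring_part_linear p).

Fact dual_part_linear p : linear (dual_part p).
Proof.
move=> a u v; apply: trivext_eqP => [|x]; first by rewrite /= scaler0 addr0.
by rewrite trivextD2 trivextZ2 !comp_lfunE trivextD2 trivextZ2.
Qed.
HB.instance Definition _ p := GRing.isLinear.Build k T T _ (dual_part p)
  (@dual_part_linear p).

Lemma dual_part2E p u x : (dual_part p u).2 x = u.2 (p x).
Proof. exact: comp_lfunE. Qed.

Definition ringv p : {vspace T} := limg (linfun (ring_part p)).
Definition dualv p : {vspace T} := limg (linfun (dual_part p)).

Lemma ringvP p u : (forall x, p (p x) = p x) ->
  reflect (p u.1 = u.1 /\ u.2 = 0) (u \in ringv p).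
Proof.
move=> pp; apply: (iffP memv_imgP) => [[v _ ->]|[h1 h2]].
  by rewrite lfunE /= pp.
exists u; rewrite ?memvf // lfunE /= /ring_part h1 -h2.
by case: (u).
Qed.

Lemma dualvP p u : (forall x, p (p x) = p x) ->
  reflect (u.1 = 0 /\ forall x, u.2 (p x) = u.2 x) (u \in dualv p).
Proof.
move=> pp; apply: (iffP memv_imgP) => [[v _ ->]|[h1 h2]].
  by rewrite lfunE /=; split=> // x; rewrite !comp_lfunE pp.
exists u; rewrite ?memvf // lfunE /=; apply: trivext_eqP => //= x.
by rewrite comp_lfunE h2.
Qed.

Lemma dim_ringv p : \dim (ringv p) = \dim (limg p).
Proof.
have f1_lin : linear (fun u : T => u.1) by [].
pose f1 : {linear T -> R} :=
  HB.pack (fun u : T => u.1) (GRing.isLinear.Build k T R _ (fun u : T => u.1) f1_lin).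
have -> : limg p = (linfun f1 @: ringv p)%VS.
  apply/eqP; rewrite eqEsubv; apply/andP; split; apply/subvP => x.
    case/memv_imgP => y _ ->; apply/memv_imgP.
    exists ((p y, 0) : T); last by rewrite lfunE.
    by apply/memv_imgP; exists ((y, 0) : T); rewrite ?memvf // lfunE.
  case/memv_imgP => u /memv_imgP[v _ ->] ->; rewrite !lfunE /=.
  by rewrite memv_img ?memvf.
rewrite limg_dim_eq //; apply/eqP; rewrite -subv0; apply/subvP => u.
rewrite memv_cap memv_ker lfunE memv0 /= => /andP[/memv_imgP[v _ ->]].
by rewrite !lfunE /= /ring_part => /eqP ->.
Qed.

Lemma dim_dualv p : (forall x, p (p x) = p x) -> \dim (dualv p) = \dim (limg p).
Proof.
move=> pp; pose U := limg p; pose H := 'Hom(subvs_of U, k^o).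
pose g (al : H) : T := (0, (al \o linfun (vsproj U) \o p)%VF).
have gE al x : (g al).2 x = al (vsproj U (p x)).
  by rewrite /= !comp_lfunE lfunE.
have g_lin : linear g.
  move=> a al be; apply: trivext_eqP => [|x]; first by rewrite /= scaler0 addr0.
  by rewrite trivextD2 trivextZ2 !gE add_lfunE scale_lfunE.
pose gL : {linear H -> T} := HB.pack g (GRing.isLinear.Build k H T _ g g_lin).
have -> : dualv p = limg (linfun gL).
  apply/eqP; rewrite eqEsubv; apply/andP; split; apply/subvP => u.
    move/(dualvP _ pp) => [u1 u2]; apply/memv_imgP.
    exists (u.2 \o linfun (@vsval k R U))%VF; rewrite ?memvf // lfunE /=.
    apply: trivext_eqP => // x; rewrite gE comp_lfunE lfunE /= vsprojK ?u2 //.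
    by rewrite memv_img ?memvf.
  case/memv_imgP => al _ ->; rewrite lfunE /=; apply/(dualvP _ pp); split=> // x.
  by rewrite !gE pp.
rewrite (@limg_dim_eq _ _ _ (linfun gL)).
  by rewrite dimvf -[LHS]/(dim (subvs_of U) * 1)%N muln1.
apply/eqP; rewrite -subv0; apply/subvP => al; rewrite memv_cap memv_ker memv0 lfunE /=.
case/andP => _ /eqP h; apply/eqP/lfunP => y; rewrite lfunE /=.
have /memv_imgP[x _ hx] := subvsP y.
have : (g al).2 (p x) = 0 by rewrite h /= lfunE.
by rewrite gE pp -hx vsvalK.
Qed.

End TrivextParts.

Section TrivextShort.
Variables (k : fieldType) (R : comFalgType k) (R1 R2 : {vspace R}).
Variables (p0 : 'Hom(R, k^o)) (p1 p2 : 'End(R)).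
Hypothesis sh : short_subring R1 R2 p0 p1 p2.
Hypothesis full : fullv = short_carrier R1 R2.
Local Notation T := (trivext R).
Implicit Types (u v : T).

Definition scalar_line (a : k^o) : R := in_alg R a.
Fact scalar_line_linear : linear scalar_line.
Proof. by move=> a x y; rewrite /scalar_line /= scalerDl -scalerA. Qed.
HB.instance Definition _ := GRing.isLinear.Build k k^o R _ scalar_line
  scalar_line_linear.

Definition unit_part : 'End(R) := (linfun scalar_line \o p0)%VF.

Lemma unit_partE x : unit_part x = in_alg R (p0 x).
Proof. by rewrite comp_lfunE lfunE. Qed.

Lemma full_dec (x : R) :
  [/\ x = in_alg R (p0 x) + (p1 x : R) + (p2 x : R), p1 x \in R1 & p2 x \in R2].
Proof. by apply: (short_dec sh); rewrite -full memvf. Qed.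

Lemma p1K x : p1 (p1 x) = p1 x.
Proof. by have [_ /(short_R1 sh)[]] := full_dec x. Qed.
Lemma p2K x : p2 (p2 x) = p2 x.
Proof. by have [_ _ /(short_R2 sh)[]] := full_dec x. Qed.
Lemma p0_alg (a : k) : p0 (in_alg R a) = a.
Proof.
by rewrite linearZ /=; have [-> _ _] := short_one sh; rewrite /GRing.scale /= mulr1.
Qed.
Lemma upK x : unit_part (unit_part x) = unit_part x.
Proof.
by rewrite !unit_partE linearZ /=; have [-> _ _] := short_one sh; rewrite /GRing.scale /= mulr1.
Qed.

Lemma limg_p1 : limg p1 = R1.
Proof.
apply/eqP; rewrite eqEsubv; apply/andP; split; apply/subvP => x.
  by case/memv_imgP => y _ ->; have [] := full_dec y.
by move=> x1; have [_ <- _] := short_R1 sh x1; rewrite memv_img ?memvf.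
Qed.

Lemma limg_p2 : limg p2 = R2.
Proof.
apply/eqP; rewrite eqEsubv; apply/andP; split; apply/subvP => x.
  by case/memv_imgP => y _ ->; have [] := full_dec y.
by move=> x1; have [_ _ <-] := short_R2 sh x1; rewrite memv_img ?memvf.
Qed.

Lemma limg_up : limg unit_part = 1%VS.
Proof.
apply/eqP; rewrite eqEsubv; apply/andP; split; apply/subvP => x.
  by case/memv_imgP => y _ ->; rewrite unit_partE rpredZ ?memv_line.
case/vlineP => a ->; apply/memv_imgP; exists a%:A; rewrite ?memvf //.
rewrite unit_partE linearZ /=; have [-> _ _] := short_one sh.
by rewrite /GRing.scale /= mulr1.
Qed.

(** The index is the degree in T. The dual of R_j sits in degree 3 - j, so [TE1] is built from [p2],
    [TE2] from [p1] and [TE3] from the projection to k. *)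
Definition TR1 : {vspace T} := ringv p1.
Definition TR2 : {vspace T} := ringv p2.
Definition TE1 : {vspace T} := dualv p2.
Definition TE2 : {vspace T} := dualv p1.
Definition TE3 : {vspace T} := dualv unit_part.

Lemma TR1P u : reflect (u.1 \in R1 /\ u.2 = 0) (u \in TR1).
Proof.
apply: (iffP (ringvP _ p1K)) => -[h1 h2]; split=> //.
  by rewrite -h1; have [] := full_dec u.1.
by have [] := short_R1 sh h1.
Qed.

Lemma TR2P u : reflect (u.1 \in R2 /\ u.2 = 0) (u \in TR2).
Proof.
apply: (iffP (ringvP _ p2K)) => -[h1 h2]; split=> //.
  by rewrite -h1; have [] := full_dec u.1.
by have [] := short_R2 sh h1.
Qed.

Lemma TE1P u : reflect (u.1 = 0 /\ forall x, u.2 (p2 x) = u.2 x) (u \in TE1).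
Proof. exact: (dualvP _ p2K). Qed.
Lemma TE2P u : reflect (u.1 = 0 /\ forall x, u.2 (p1 x) = u.2 x) (u \in TE2).
Proof. exact: (dualvP _ p1K). Qed.
Lemma TE3P u : reflect (u.1 = 0 /\ forall x, u.2 (in_alg R (p0 x)) = u.2 x) (u \in TE3).
Proof.
apply: (iffP (dualvP _ upK)) => -[h1 h2]; split=> // x.
  by rewrite -unit_partE h2.
by rewrite unit_partE h2.
Qed.

Lemma dim_TR1 : \dim TR1 = \dim R1. Proof. by rewrite dim_ringv limg_p1. Qed.
Lemma dim_TR2 : \dim TR2 = \dim R2. Proof. by rewrite dim_ringv limg_p2. Qed.
Lemma dim_TE1 : \dim TE1 = \dim R2.
Proof. by rewrite (dim_dualv p2K) limg_p2. Qed.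
Lemma dim_TE2 : \dim TE2 = \dim R1.
Proof. by rewrite (dim_dualv p1K) limg_p1. Qed.
Lemma dim_TE3 : \dim TE3 = 1%N.
Proof. by rewrite (dim_dualv upK) limg_up dim_vline oner_eq0. Qed.

Definition ring_proj (u : T) : R := u.1.
Fact ring_proj_linear : linear ring_proj. Proof. by []. Qed.
HB.instance Definition _ := GRing.isLinear.Build k T R _ ring_proj ring_proj_linear.

Definition tp0 : 'Hom(T, k^o) := (p0 \o linfun ring_proj)%VF.
Lemma tp0E u : tp0 u = p0 u.1.
Proof. by rewrite comp_lfunE lfunE. Qed.

Definition tr1 : 'End(T) := linfun (ring_part p1).
Definition tr2 : 'End(T) := linfun (ring_part p2).
Definition te1 : 'End(T) := linfun (dual_part p2).
Definition te2 : 'End(T) := linfun (dual_part p1).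
Definition te3 : 'End(T) := linfun (dual_part unit_part).

Lemma tr1E u : tr1 u = ring_part p1 u. Proof. by rewrite lfunE. Qed.
Lemma tr2E u : tr2 u = ring_part p2 u. Proof. by rewrite lfunE. Qed.
Lemma te1E u : te1 u = dual_part p2 u. Proof. by rewrite lfunE. Qed.
Lemma te2E u : te2 u = dual_part p1 u. Proof. by rewrite lfunE. Qed.
Lemma te3E u : te3 u = dual_part unit_part u. Proof. by rewrite lfunE. Qed.
Local Notation partE := (tp0E, tr1E, tr2E, te1E, te2E, te3E).

Lemma trivext_dec u : u = (in_alg T (tp0 u) : T) + tr1 u + tr2 u + te1 u + te2 u + te3 u.
Proof.
rewrite !partE; apply: trivext_eqP => [|x].
  by rewrite !trivextD1 /= !addr0; have [] := full_dec u.1.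
rewrite !trivextD2 trivextZ2 !zero_lfunE scaler0 !add0r !dual_part2E unit_partE.
have [E _ _] := full_dec x; rewrite [in LHS]E !linearD /=.
by rewrite addrC [X in _ + X]addrC addrA.
Qed.

Lemma tr1_in u : tr1 u \in TR1. Proof. by rewrite memv_img ?memvf. Qed.
Lemma tr2_in u : tr2 u \in TR2. Proof. by rewrite memv_img ?memvf. Qed.
Lemma te1_in u : te1 u \in TE1. Proof. by rewrite memv_img ?memvf. Qed.
Lemma te2_in u : te2 u \in TE2. Proof. by rewrite memv_img ?memvf. Qed.
Lemma te3_in u : te3 u \in TE3. Proof. by rewrite memv_img ?memvf. Qed.

Lemma dual_R2 (al : 'Hom(R, k^o)) x : (forall x, al (p2 x) = al x) ->
  al ((in_alg R (p0 x))) = 0 /\ al (p1 x) = 0.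
Proof.
move=> h; have [_ o1 o2] := short_one sh; split.
  by rewrite -h linearZ /= o2 scaler0 linear0.
have [_ x1 _] := full_dec x; have [_ _ z] := short_R1 sh x1.
by rewrite -h z linear0.
Qed.

Lemma dual_R1 (al : 'Hom(R, k^o)) x : (forall x, al (p1 x) = al x) ->
  al ((in_alg R (p0 x))) = 0 /\ al (p2 x) = 0.
Proof.
move=> h; have [_ o1 o2] := short_one sh; split.
  by rewrite -h linearZ /= o1 scaler0 linear0.
have [_ _ x1] := full_dec x; have [_ z _] := short_R2 sh x1.
by rewrite -h z linear0.
Qed.

Lemma dual_R0 (al : 'Hom(R, k^o)) x : (forall x, al ((in_alg R (p0 x))) = al x) ->
  al (p1 x) = 0 /\ al (p2 x) = 0.
Proof.
move=> h; have [_ x1 x2] := full_dec x; split.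
  by have [z _ _] := short_R1 sh x1; rewrite -h z /= scale0r linear0.
by have [z _ _] := short_R2 sh x2; rewrite -h z /= scale0r linear0.
Qed.

Lemma TR1_parts u : u \in TR1 ->
  [/\ tp0 u = 0, tr1 u = u, tr2 u = 0 & [/\ te1 u = 0, te2 u = 0 & te3 u = 0]].
Proof.
case/TR1P => h1 h2; have [z0 z1 z2] := short_R1 sh h1.
rewrite !partE; split=> //.
- by rewrite /= /ring_part z1 -h2; case: (u).
- by rewrite /= /ring_part z2.
- by split; apply: trivext_eqP => // x; rewrite dual_part2E h2 !zero_lfunE.
Qed.

Lemma TR2_parts u : u \in TR2 ->
  [/\ tp0 u = 0, tr1 u = 0, tr2 u = u & [/\ te1 u = 0, te2 u = 0 & te3 u = 0]].
Proof.
case/TR2P => h1 h2; have [z0 z1 z2] := short_R2 sh h1.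
rewrite !partE; split=> //.
- by rewrite /= /ring_part z1.
- by rewrite /= /ring_part z2 -h2; case: (u).
- by split; apply: trivext_eqP => // x; rewrite dual_part2E h2 !zero_lfunE.
Qed.

Lemma TE1_parts u : u \in TE1 ->
  [/\ tp0 u = 0, tr1 u = 0, tr2 u = 0 & [/\ te1 u = u, te2 u = 0 & te3 u = 0]].
Proof.
case/TE1P => h1 h2; rewrite !partE; split; rewrite ?h1 ?linear0 //.
- by rewrite /ring_part h1 linear0.
- by rewrite /ring_part h1 linear0.
- split; apply: trivext_eqP => // x; rewrite dual_part2E ?zero_lfunE ?h2 //.
    by have [] := dual_R2 x h2.
  by rewrite unit_partE; have [] := dual_R2 x h2.
Qed.

Lemma TE2_parts u : u \in TE2 ->
  [/\ tp0 u = 0, tr1 u = 0, tr2 u = 0 & [/\ te1 u = 0, te2 u = u & te3 u = 0]].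
Proof.
case/TE2P => h1 h2; rewrite !partE; split; rewrite ?h1 ?linear0 //.
- by rewrite /ring_part h1 linear0.
- by rewrite /ring_part h1 linear0.
- split; apply: trivext_eqP => // x; rewrite dual_part2E ?zero_lfunE ?h2 //.
    by have [] := dual_R1 x h2.
  by rewrite unit_partE; have [] := dual_R1 x h2.
Qed.

Lemma TE3_parts u : u \in TE3 ->
  [/\ tp0 u = 0, tr1 u = 0, tr2 u = 0 & [/\ te1 u = 0, te2 u = 0 & te3 u = u]].
Proof.
case/TE3P => h1 h2; rewrite !partE; split; rewrite ?h1 ?linear0 //.
- by rewrite /ring_part h1 linear0.
- by rewrite /ring_part h1 linear0.
- split; apply: trivext_eqP => // x; rewrite dual_part2E ?zero_lfunE ?unit_partE ?h2 //.
    by have [] := dual_R0 x h2.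
  by have [] := dual_R0 x h2.
Qed.

Lemma one_parts :
  [/\ tp0 1 = 1, tr1 1 = 0, tr2 1 = 0 & [/\ te1 1 = 0, te2 1 = 0 & te3 1 = 0]].
Proof.
have [o0 o1 o2] := short_one sh.
rewrite !partE; split; rewrite /= ?/ring_part ?o0 ?o1 ?o2 //.
by split; apply: trivext_eqP => // x; rewrite dual_part2E !zero_lfunE.
Qed.

Lemma TR1_TR1 u v : u \in TR1 -> v \in TR1 -> u * v \in TR2.
Proof.
case/TR1P => u1 u2 /TR1P[v1 v2]; apply/TR2P; split; first exact: (short_11 sh).
by apply/lfunP => x; rewrite trivext_mul2E u2 v2 !lfunE addr0.
Qed.

Lemma TR1_TR2 u v : u \in TR1 -> v \in TR2 -> u * v = 0.
Proof.
case/TR1P => u1 u2 /TR2P[v1 v2]; apply: trivext_eqP => [|x].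
  exact: (short_12 sh).
by rewrite trivext_mul2E u2 v2 !lfunE addr0.
Qed.

Lemma TR2_TR2 u v : u \in TR2 -> v \in TR2 -> u * v = 0.
Proof.
case/TR2P => u1 u2 /TR2P[v1 v2]; apply: trivext_eqP => [|x].
  exact: (short_22 sh).
by rewrite trivext_mul2E u2 v2 !lfunE addr0.
Qed.

Lemma R1_mul r x : r \in R1 ->
  [/\ p0 (r * x) = 0, p1 (r * x) = p0 x *: r & p2 (r * x) = r * p1 x].
Proof.
move=> r1; have [E x1 x2] := full_dec x.
have -> : r * x = p0 x *: r + r * p1 x.
  by rewrite {1}E !mulrDr (short_12 sh r1 x2) addr0 -scalerAr mulr1.
have [a0 a1 a2] := short_R1 sh r1; have [b0 b1 b2] := short_R2 sh (short_11 sh r1 x1).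
by rewrite !linearD !linearZ /= a0 a1 a2 b0 b1 b2 !scaler0 !addr0 !add0r.
Qed.

Lemma R2_mul r x : r \in R2 -> r * x = p0 x *: r.
Proof.
move=> r2; have [E x1 x2] := full_dec x.
rewrite {1}E !mulrDr (short_22 sh r2 x2) (short_21 sh r2 x1) !addr0.
by rewrite -scalerAr mulr1.
Qed.

Lemma TR1_TE1 u v : u \in TR1 -> v \in TE1 -> u * v \in TE2.
Proof.
case/TR1P => u1 u2 /TE1P[v1 v2]; apply/TE2P; split.
  by rewrite trivext_mul1E v1 mulr0.
move=> x; rewrite !trivext_mul2E u2 !zero_lfunE !addr0 -v2 -[RHS]v2.
have [_ _ ->] := R1_mul x u1; have [_ _ ->] := R1_mul (p1 x) u1.
by rewrite p1K.
Qed.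

Lemma TR1_TE2 u v : u \in TR1 -> v \in TE2 -> u * v \in TE3.
Proof.
case/TR1P => u1 u2 /TE2P[v1 v2]; apply/TE3P; split.
  by rewrite trivext_mul1E v1 mulr0.
move=> x; rewrite !trivext_mul2E u2 !zero_lfunE !addr0 -v2 -[RHS]v2.
have [_ -> _] := R1_mul x u1; have [_ -> _] := R1_mul (in_alg R (p0 x)) u1.
by rewrite p0_alg.
Qed.

Lemma TR1_TE3 u v : u \in TR1 -> v \in TE3 -> u * v = 0.
Proof.
case/TR1P => u1 u2 /TE3P[v1 v2]; apply: trivext_eqP => [|x].
  by rewrite trivext_mul1E v1 mulr0.
rewrite !trivext_mul2E u2 !zero_lfunE !addr0 -v2.
by have [-> _ _] := R1_mul x u1; rewrite /= scale0r linear0.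
Qed.

Lemma TR2_TE1 u v : u \in TR2 -> v \in TE1 -> u * v \in TE3.
Proof.
case/TR2P => u1 u2 /TE1P[v1 v2]; apply/TE3P; split.
  by rewrite trivext_mul1E v1 mulr0.
move=> x; rewrite !trivext_mul2E u2 !zero_lfunE !addr0 !(R2_mul _ u1).
by rewrite p0_alg.
Qed.

Lemma TR2_TE2 u v : u \in TR2 -> v \in TE2 -> u * v = 0.
Proof.
case/TR2P => u1 u2 /TE2P[v1 v2]; apply: trivext_eqP => [|x].
  by rewrite trivext_mul1E v1 mulr0.
rewrite !trivext_mul2E u2 !zero_lfunE !addr0 (R2_mul _ u1) -v2 linearZ /=.
by have [_ -> _] := short_R2 sh u1; rewrite scaler0 linear0.
Qed.

Lemma TR2_TE3 u v : u \in TR2 -> v \in TE3 -> u * v = 0.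
Proof.
case/TR2P => u1 u2 /TE3P[v1 v2]; apply: trivext_eqP => [|x].
  by rewrite trivext_mul1E v1 mulr0.
rewrite !trivext_mul2E u2 !zero_lfunE !addr0 -v2.
have -> : p0 (u.1 * x) = 0.
  by rewrite (R2_mul _ u1) linearZ /=; have [-> _ _] := short_R2 sh u1; rewrite scaler0.
by rewrite /= scale0r linear0.
Qed.

Definition TE : {vspace T} := (TE1 + (TE2 + TE3))%VS.

Lemma TEP u : reflect (u.1 = 0) (u \in TE).
Proof.
apply: (iffP idP) => [|h].
  by case/memv_addP => ? /TE1P[h1 _] [? /memv_addP[? /TE2P[h2 _] [? /TE3P[h3 _] ->]] ->];
    rewrite !trivextD1 h1 h2 h3 !addr0.
rewrite (trivext_dec u) tp0E.
have -> : tr1 u = 0 by rewrite tr1E /ring_part h linear0.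
have -> : tr2 u = 0 by rewrite tr2E /ring_part h linear0.
rewrite h linear0 rmorph0 !add0r -addrA.
by rewrite !memv_add ?te1_in ?te2_in ?te3_in.
Qed.

Lemma TE_TE u v : u \in TE -> v \in TE -> u * v = 0.
Proof.
move=> /TEP u1 /TEP v1; apply: trivext_eqP => [|x].
  by rewrite trivext_mul1E u1 mul0r.
by rewrite trivext_mul2E u1 v1 !mul0r !linear0 addr0 lfunE.
Qed.

Hypothesis nosoc : forall x, x \in R1 -> (forall y, y \in R1 -> x * y = 0) -> x = 0.
Hypothesis R2n0 : R2 != 0%VS.

Lemma dual_sep (x : R) : (forall al : 'Hom(R, k^o), al x = 0) -> x = 0.
Proof.
move=> h; apply/eqP; apply: contraT => x0.
have fr : free [tuple x] by rewrite seq1_free.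
have c_lin : linear (fun y => coord [tuple x] ord0 y : k^o) by move=> a y z; rewrite linearP.
pose cL : {linear R -> k^o} :=
  HB.pack (fun y => coord [tuple x] ord0 y : k^o)
   (GRing.isLinear.Build k R k^o _ (fun y => coord [tuple x] ord0 y : k^o) c_lin).
have := h (linfun cL); rewrite lfunE /= => h0.
have /eqP : (1 : k) = 0 := etrans (esym (coord_free ord0 ord0 fr)) h0.
by rewrite oner_eq0.
Qed.

Definition dual_proj (u : T) : 'Hom(R, k^o) := u.2.
Fact dual_proj_linear : linear dual_proj. Proof. by []. Qed.
HB.instance Definition _ := GRing.isLinear.Build k T 'Hom(R, k^o) _ dual_proj
  dual_proj_linear.

(** Reads a subspace of T as a space of functionals, so that [dual_separating_full] applies. *)
Definition dual_slice (W : {vspace T}) : {vspace 'Hom(R, k^o)} :=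
  (linfun dual_proj @: (W :&: TE))%VS.

Lemma dual_sliceP (W : {vspace T}) (al : 'Hom(R, k^o)) :
  reflect (((0, al) : T) \in W) (al \in dual_slice W).
Proof.
apply: (iffP memv_imgP) => [[u + ->]|h].
  rewrite memv_cap lfunE /= => /andP[uW /TEP u1].
  by move: uW; rewrite /dual_proj -{1}u1; case: (u).
exists ((0, al) : T); last by rewrite lfunE.
by rewrite memv_cap h /=; apply/TEP.
Qed.

(** Dual to the absence of socle in R1: an element of R1 at which all functionals from R1 [TE1]
    vanish is annihilated by R1. *)
Lemma TE2_gen : (TE2 <= TR1 * TE1)%VS.
Proof.
apply/subvP => u uE2.
(* The other two components are added so that separation of points can be tested on all of R; the
   projection [te2] removes them at the end. *)
have uTE : u \in (TR1 * TE1 + (TE1 + TE3))%VS.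
  have [/TE2P[u1 _]] := (uE2, tt) => _.
  have -> : u = (0, u.2) by case: (u) u1 => /= a b ->.
  apply/dual_sliceP; rewrite (_ : dual_slice _ = fullv) ?memvf //.
  apply: dual_separating_full => x hx.
  have x2 : p2 x = 0.
    apply: dual_sep => al; have := hx (al \o p2)%VF; rewrite comp_lfunE; apply.
    apply/dual_sliceP; apply: (subvP (addvSr _ _)); apply: (subvP (addvSl _ _)).
    by apply/TE1P; split=> //= y; rewrite !comp_lfunE p2K.
  have x0 : p0 x = 0.
    have : unit_part x = 0.
      apply: dual_sep => al; have := hx (al \o unit_part)%VF; rewrite comp_lfunE; apply.
      apply/dual_sliceP; apply: (subvP (addvSr _ _)); apply: (subvP (addvSr _ _)).
      by apply/TE3P; split=> // y; rewrite -unit_partE [LHS]comp_lfunE [RHS]comp_lfunE upK.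
    by rewrite unit_partE /= => /eqP; rewrite scaler_eq0 oner_eq0 orbF => /eqP.
  have [E x1R _] := full_dec x; rewrite E x0 x2 rmorph0 add0r addr0.
  apply: nosoc => // r r1; apply: dual_sep => al.
  have rT : ((r, 0) : T) \in TR1 by apply/TR1P.
  have aT : ((0, (al \o p2)%VF) : T) \in TE1.
    by apply/TE1P; split=> //= y; rewrite !comp_lfunE p2K.
  have := hx (((r, 0) : T) * (0, (al \o p2)%VF)).2.
  rewrite trivext_mul2E /= zero_lfunE addr0 comp_lfunE.
  have [_ _ ->] := R1_mul x r1; rewrite mulrC; apply.
  apply/dual_sliceP; apply: (subvP (addvSl _ _)).
  have -> : ((0, dual_act r (al \o p2)%VF + dual_act 0 0) : T) =
     ((r, 0) : T) * ((0, (al \o p2)%VF) : T) by rewrite trivextE /= mulr0.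
  exact: memv_mul.
have [_ _ _ [_ hu _]] := TE2_parts uE2.
case/memv_addP: uTE => a aW [_ /memv_addP[b bE [c cE ->]] E].
have [_ _ _ [_ hb _]] := TE1_parts bE; have [_ _ _ [_ hc _]] := TE3_parts cE.
have aE2 : a \in TE2.
  by apply: (subvP (_ : (TR1 * TE1 <= TE2)%VS)) aW; apply/prodvP => ? ?; apply: TR1_TE1.
have [_ _ _ [_ ha _]] := TE2_parts aE2.
by rewrite -hu E !linearD /= ha hb hc !addr0.
Qed.

(** Dual to R2 being nonzero: a scalar at which all functionals from R2 [TE1] vanish annihilates
    R2. *)
Lemma TE3_gen : (TE3 <= TR2 * TE1)%VS.
Proof.
apply/subvP => u uE3.
have uTE : u \in (TR2 * TE1 + (TE1 + TE2))%VS.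
  have [/TE3P[u1 _]] := (uE3, tt) => _.
  have -> : u = (0, u.2) by case: (u) u1 => /= a b ->.
  apply/dual_sliceP; rewrite (_ : dual_slice _ = fullv) ?memvf //.
  apply: dual_separating_full => x hx.
  have x2 : p2 x = 0.
    apply: dual_sep => al; have := hx (al \o p2)%VF; rewrite comp_lfunE; apply.
    apply/dual_sliceP; apply: (subvP (addvSr _ _)); apply: (subvP (addvSl _ _)).
    by apply/TE1P; split=> //= y; rewrite !comp_lfunE p2K.
  have x1 : p1 x = 0.
    apply: dual_sep => al; have := hx (al \o p1)%VF; rewrite comp_lfunE; apply.
    apply/dual_sliceP; apply: (subvP (addvSr _ _)); apply: (subvP (addvSr _ _)).
    by apply/TE2P; split=> //= y; rewrite !comp_lfunE p1K.
  have [E x1R _] := full_dec x; rewrite E x1 x2 !addr0.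
  apply/eqP; apply: contraT; rewrite /= scaler_eq0 oner_eq0 orbF => x0.
  case/eqP: R2n0; apply/eqP; rewrite -subv0; apply/subvP => r r2; rewrite memv0.
  suff : p0 x *: r = 0 by move/eqP; rewrite scaler_eq0 (negbTE x0).
  apply: dual_sep => al.
  have rT : ((r, 0) : T) \in TR2 by apply/TR2P.
  have aT : ((0, (al \o p2)%VF) : T) \in TE1.
    by apply/TE1P; split=> //= y; rewrite !comp_lfunE p2K.
  have := hx (((r, 0) : T) * (0, (al \o p2)%VF)).2.
  rewrite trivext_mul2E /= zero_lfunE addr0 comp_lfunE (R2_mul _ r2) linearZ /=.
  have [_ _ ->] := short_R2 sh r2; apply.
  apply/dual_sliceP; apply: (subvP (addvSl _ _)).
  have -> : ((0, dual_act r (al \o p2)%VF + dual_act 0 0) : T) =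
     ((r, 0) : T) * ((0, (al \o p2)%VF) : T) by rewrite trivextE /= mulr0.
  exact: memv_mul.
have [_ _ _ [_ _ hu]] := TE3_parts uE3.
case/memv_addP: uTE => a aW [_ /memv_addP[b bE [c cE ->]] E].
have [_ _ _ [_ _ hb]] := TE1_parts bE; have [_ _ _ [_ _ hc]] := TE2_parts cE.
have aE3 : a \in TE3.
  by apply: (subvP (_ : (TR2 * TE1 <= TE3)%VS)) aW; apply/prodvP => ? ?; apply: TR2_TE1.
have [_ _ _ [_ _ ha]] := TE3_parts aE3.
by rewrite -hu E !linearD /= ha hb hc !addr0.
Qed.

End TrivextShort.

(* A graded algebra k + A1 + A2 + A3, generated in degree 1, with perfect
   pairing of A1 and A2 into the line A3. *)
Record graded_duality (k : fieldType) (A : comFalgType k) (A1 A2 A3 : {vspace A})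
    (c0 : 'Hom(A, k^o)) (q1 q2 q3 : 'End(A)) : Prop := GradedDuality {
  gd_one : [/\ c0 1 = 1, q1 1 = 0, q2 1 = 0 & q3 1 = 0];
  gd_A1 : forall x, x \in A1 -> [/\ c0 x = 0, q1 x = x, q2 x = 0 & q3 x = 0];
  gd_A2 : forall x, x \in A2 -> [/\ c0 x = 0, q1 x = 0, q2 x = x & q3 x = 0];
  gd_A3 : forall x, x \in A3 -> [/\ c0 x = 0, q1 x = 0, q2 x = 0 & q3 x = x];
  gd_dec : forall x, x = (in_alg A (c0 x) : A) + q1 x + q2 x + q3 x;
  gd_in : forall x, [/\ q1 x \in A1, q2 x \in A2 & q3 x \in A3];
  gd_11 : forall x y, x \in A1 -> y \in A1 -> x * y \in A2;
  gd_12 : forall x y, x \in A1 -> y \in A2 -> x * y \in A3;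
  gd_13 : forall x y, x \in A1 -> y \in A3 -> x * y = 0;
  gd_22 : forall x y, x \in A2 -> y \in A2 -> x * y = 0;
  gd_23 : forall x y, x \in A2 -> y \in A3 -> x * y = 0;
  gd_33 : forall x y, x \in A3 -> y \in A3 -> x * y = 0;
  gd_gen2 : (A2 <= A1 * A1)%VS;
  gd_gen3 : (A3 <= A1 * A2)%VS;
  gd_nondeg1 : forall x, x \in A1 -> (forall y, y \in A2 -> x * y = 0) -> x = 0;
  gd_nondeg2 : forall x, x \in A2 -> (forall y, y \in A1 -> x * y = 0) -> x = 0;
  gd_dim3 : \dim A3 = 1%N }.

Lemma prodv_ind (k : fieldType) (A : comFalgType k) (U V : {vspace A}) (P : A -> Prop) :
  P 0 -> (forall x y, P x -> P y -> P (x + y)) -> (forall (a : k) x, P x -> P (a *: x)) ->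
  (forall u v, u \in U -> v \in V -> P (u * v)) ->
  forall x, x \in (U * V)%VS -> P x.
Proof.
move=> P0 PD PZ PM x; rewrite unlock => /coord_span ->.
apply: big_ind => // i _; apply: PZ.
have si : (i < size (allpairs *%R (vbasis U) (vbasis V)))%N.
  by rewrite size_allpairs !size_tuple.
have /allpairsP[[u v] /= [uU vV ->]] := mem_nth 0 si.
by apply: PM; apply: vbasis_mem.
Qed.

(** * Graded algebras with duality: powers of the maximal ideal and Hilbert function *)

Section GradedDuality.
Variables (k : fieldType) (A : comFalgType k) (A1 A2 A3 : {vspace A}).
Variables (c0 : 'Hom(A, k^o)) (q1 q2 q3 : 'End(A)).
Hypothesis gd : graded_duality A1 A2 A3 c0 q1 q2 q3.

Definition gd_max : {vspace A} := (A1 + (A2 + A3))%VS.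
Local Notation m := gd_max.

Lemma gd_maxP x : reflect (c0 x = 0) (x \in m).
Proof.
apply: (iffP idP) => [|x0].
  case/memv_addP => a a1 [_ /memv_addP[b b2 [c c3 ->]] ->]; rewrite !linearD /=.
  have [-> _ _ _] := gd_A1 gd a1; have [-> _ _ _] := gd_A2 gd b2.
  by have [-> _ _ _] := gd_A3 gd c3; rewrite !addr0.
rewrite (gd_dec gd x) x0 rmorph0 add0r -addrA.
by have [h1 h2 h3] := gd_in gd x; rewrite !memv_add.
Qed.

Lemma gd_mul x y : x * y =
  in_alg A (c0 x * c0 y) + ((c0 x : k) *: q1 y + (c0 y : k) *: q1 x)
   + ((c0 x : k) *: q2 y + (c0 y : k) *: q2 x + q1 x * q1 y)
   + ((c0 x : k) *: q3 y + (c0 y : k) *: q3 x + q1 x * q2 y + q2 x * q1 y).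
Proof.
rewrite {1}(gd_dec gd x) {1}(gd_dec gd y).
have [x1 x2 x3] := gd_in gd x; have [y1 y2 y3] := gd_in gd y.
rewrite !mulrDl !mulrDr (gd_13 gd x1 y3) (gd_22 gd x2 y2) (gd_23 gd x2 y3).
rewrite (gd_33 gd x3 y3) [q3 x * q1 y]mulrC (gd_13 gd y1 x3) [q3 x * q2 y]mulrC (gd_23 gd y2 x3).
rewrite !addr0 /= -!scalerAl !mul1r -!scalerAr !mulr1 scalerA.
set a := c0 x; set b := c0 y; set u1 := q1 x; set u2 := q2 x; set u3 := q3 x.
set v1 := q1 y; set v2 := q2 y; set v3 := q3 y.
move: ((a * b)%:A) (a *: v1) (a *: v2) (a *: v3) (b *: u1) (b *: u2) (b *: u3).
by move=> z1 z2 z3 z4 z5 z6 z7; ring.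
Qed.

Lemma gd_uniq (a : k) u1 u2 u3 (x := in_alg A a + u1 + u2 + u3) :
  u1 \in A1 -> u2 \in A2 -> u3 \in A3 ->
  [/\ c0 x = a, q1 x = u1, q2 x = u2 & q3 x = u3].
Proof.
move=> h1 h2 h3; have [o0 o1 o2 o3] := gd_one gd.
have [a0 a1 a2 a3] := gd_A1 gd h1; have [b0 b1 b2 b3] := gd_A2 gd h2.
have [d0 d1 d2 d3] := gd_A3 gd h3.
rewrite /x !linearD !linearZ /= o0 o1 o2 o3 a0 a1 a2 a3 b0 b1 b2 b3 d0 d1 d2 d3.
by rewrite !scaler0 !addr0 !add0r /GRing.scale /= mulr1.
Qed.

Lemma gd_c0_alg (a : k) : c0 (in_alg A a) = a.
Proof.
by rewrite linearZ /=; have [-> _ _ _] := gd_one gd; rewrite /GRing.scale /= mulr1.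
Qed.

Lemma gd_mul_parts x y :
  [/\ c0 (x * y) = c0 x * c0 y,
      q1 (x * y) = (c0 x : k) *: q1 y + (c0 y : k) *: q1 x,
      q2 (x * y) = (c0 x : k) *: q2 y + (c0 y : k) *: q2 x + q1 x * q1 y
    & q3 (x * y) = (c0 x : k) *: q3 y + (c0 y : k) *: q3 x + q1 x * q2 y + q2 x * q1 y].
Proof.
have [x1 x2 x3] := gd_in gd x; have [y1 y2 y3] := gd_in gd y.
rewrite gd_mul; apply: gd_uniq.
- by rewrite rpredD ?rpredZ.
- by rewrite !rpredD ?rpredZ ?(gd_11 gd).
- apply: rpredD; last by rewrite mulrC (gd_12 gd).
  by rewrite !rpredD ?rpredZ ?(gd_12 gd).
Qed.

Lemma gd_q1M a x : x \in m -> q1 (a * x) = (c0 a : k) *: q1 x.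
Proof.
by move/gd_maxP => x0; have [_ -> _ _] := gd_mul_parts a x; rewrite x0 scale0r addr0.
Qed.

Lemma gd_max_ideal a x : x \in m -> a * x \in m.
Proof.
move/gd_maxP => x0; apply/gd_maxP.
by have [-> _ _ _] := gd_mul_parts a x; rewrite x0 mulr0.
Qed.

Lemma gd_A1m : (A1 <= m)%VS. Proof. exact: addvSl. Qed.
Lemma gd_A2m : (A2 <= m)%VS.
Proof. by apply: subv_trans (addvSr _ _); apply: addvSl. Qed.
Lemma gd_A3m : (A3 <= m)%VS.
Proof. by apply: subv_trans (addvSr _ _); apply: addvSr. Qed.

Lemma gd_disjoint : (1 :&: m = 0)%VS.
Proof.
apply/eqP; rewrite -subv0; apply/subvP => x; rewrite memv_cap memv0.
case/andP => /vlineP[a ->] /gd_maxP.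
by rewrite (gd_c0_alg a) => ->; rewrite scale0r.
Qed.

Lemma gd_full : fullv = (1 + m)%VS.
Proof.
apply/esym/eqP; rewrite eqEsubv subvf /=; apply/subvP => x _.
rewrite (gd_dec gd x) -!addrA memv_add ?rpredZ ?memv_line //.
by have [h1 h2 h3] := gd_in gd x; rewrite !memv_add.
Qed.

Definition gd_ideal (i : nat) : {vspace A} :=
  match i with 0 => fullv | 1 => m | 2 => (A2 + A3)%VS | 3 => A3 | _ => 0%VS end.

Lemma gd_A23P x : reflect (c0 x = 0 /\ q1 x = 0) (x \in (A2 + A3)%VS).
Proof.
apply: (iffP memv_addP) => [[a a2 [b b3 ->]]|[x0 x1]].
  have [h0 h1 _ _] := gd_A2 gd a2; have [g0 g1 _ _] := gd_A3 gd b3.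
  by rewrite !linearD /= h0 h1 g0 g1 !addr0.
have [_ h2 h3] := gd_in gd x.
exists (q2 x) => //; exists (q3 x) => //.
by rewrite {1}(gd_dec gd x) x0 x1 rmorph0 !add0r.
Qed.

Lemma gd_max2 : (m * m = A2 + A3)%VS.
Proof.
apply/eqP; rewrite eqEsubv; apply/andP; split.
  apply/prodvP => x y /gd_maxP x0 /gd_maxP y0; apply/gd_A23P.
  by have [-> -> _ _] := gd_mul_parts x y; rewrite x0 y0 mulr0 !scale0r addr0.
rewrite subv_add; apply/andP; split.
  by apply: subv_trans (gd_gen2 gd) _; apply: prodvS; apply: gd_A1m.
by apply: subv_trans (gd_gen3 gd) _; apply: prodvS; [apply: gd_A1m | apply: gd_A2m].
Qed.

Lemma gd_max3 : (m * (A2 + A3) = A3)%VS.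
Proof.
apply/eqP; rewrite eqEsubv; apply/andP; split; last first.
  apply: subv_trans (gd_gen3 gd) _; apply: prodvS; first exact: gd_A1m.
  exact: addvSl.
apply/prodvP => x y /gd_maxP x0 /gd_A23P[y0 y1].
rewrite (gd_dec gd (x * y)).
have [-> -> -> _] := gd_mul_parts x y; rewrite x0 y0 y1 !mulr0 !scale0r ?scaler0 !addr0.
by rewrite rmorph0 !add0r; have [_ _] := gd_in gd (x * y).
Qed.

Lemma gd_max4 : (m * A3 = 0)%VS.
Proof.
apply/eqP; rewrite -subv0; apply/prodvP => x y /gd_maxP x0 y3; rewrite memv0.
rewrite (gd_dec gd x) x0 rmorph0 add0r !mulrDl.
have [h1 h2 h3] := gd_in gd x.
by rewrite (gd_13 gd h1 y3) (gd_23 gd h2 y3) (gd_33 gd h3 y3) !addr0.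
Qed.

Lemma gd_expv (i : nat) : (m ^+ i.+1 = gd_ideal i.+1)%VS.
Proof.
elim: i => [|i IH]; first by rewrite expv1.
rewrite expvSl IH; case: i IH => [|[|[|i]]] _ /=.
- exact: gd_max2.
- exact: gd_max3.
- exact: gd_max4.
- exact: prodv0.
Qed.

Lemma gd_ideal_pow i : ideal_pow m i = gd_ideal i.
Proof.
case: i => [|i]; rewrite /ideal_pow; first by rewrite expv0 prodv1.
rewrite gd_expv; apply/eqP; rewrite eqEsubv; apply/andP; split; last first.
  by rewrite -{1}[gd_ideal _]prod1v; apply: prodvSl; apply: subvf.
rewrite -gd_expv expvSl prodvA; apply: prodvSl.
by apply/prodvP => a x _; apply: gd_max_ideal.
Qed.

Lemma gd_dims : [/\ \dim (gd_ideal 0) = (\dim A1 + \dim A2).+2,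
  \dim (gd_ideal 1) = (\dim A1 + \dim A2).+1, \dim (gd_ideal 2) = (\dim A2).+1
  & \dim (gd_ideal 3) = 1%N].
Proof.
have d3 := gd_dim3 gd.
have d2 : \dim (gd_ideal 2) = (\dim A2).+1.
  rewrite /= dimv_disjoint_sum ?d3 ?addn1 //; apply/eqP; rewrite -subv0.
  apply/subvP => x; rewrite memv_cap memv0 => /andP[/(gd_A2 gd)[_ _ h _] /(gd_A3 gd)[_ _ g _]].
  by rewrite -h g.
have d1 : \dim (gd_ideal 1) = (\dim A1 + \dim A2).+1.
  rewrite /= dimv_disjoint_sum ?[X in (_ + X)%N]d2 ?addnS //; apply/eqP; rewrite -subv0.
  apply/subvP => x; rewrite memv_cap memv0 => /andP[/(gd_A1 gd)[_ h _ _] /gd_A23P[_ g]].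
  by rewrite -h g.
split=> //; rewrite /= gd_full dimv_disjoint_sum ?gd_disjoint //.
by rewrite dim_vline oner_eq0 [X in (_ + X)%N]d1.
Qed.

Lemma gd_hilb i : hilb m i = nth 0%N [:: 1; \dim A1; \dim A2; 1]%N i.
Proof.
rewrite /hilb !gd_ideal_pow; have [d0 d1 d2 d3] := gd_dims.
case: i => [|[|[|[|i]]]]; rewrite ?d0 ?d1 ?d2 ?d3 /= ?dimv0 ?nth_nil ?subn0 //; lia.
Qed.

Lemma gd_socle_degree : socle_degree m 3.
Proof.
split; rewrite gd_ideal_pow //=; rewrite -dimv_eq0.
by rewrite (gd_dim3 gd).
Qed.

Lemma gd_max_gen a : a \in m -> in_idl (vbasis A1) a.
Proof.
have [i0 iD iM ii] := in_idl_ideal (vbasis A1).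
have h1 x : x \in A1 -> in_idl (vbasis A1) x by apply: in_idl_vbasis.
have hprod (U : {vspace A}) x : x \in (A1 * U)%VS -> in_idl (vbasis A1) x.
  apply: prodv_ind => // [c y|u v uA _]; first by rewrite -mulr_algl; apply: iM.
  by rewrite mulrC; apply/iM/h1.
case/memv_addP => x /h1 hx [_ /memv_addP[y y2 [z z3 ->]] ->].
apply: (iD _ _) => //; apply: (iD _ _).
  exact: hprod (subvP (gd_gen2 gd) _ y2).
exact: hprod (subvP (gd_gen3 gd) _ z3).
Qed.

Lemma gd_embdim e : embdim m e <-> e = \dim A1.
Proof.
apply: (embdimE (c0 := c0) (q1 := q1)).
- exact: gd_max_ideal.
- exact: gd_A1m.
- exact: gd_max_gen.
- by move=> x /(gd_A1 gd)[].
- exact: gd_q1M.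
Qed.

(** For embedding dimension e and socle degree 3 the bounds are 1, e, e, 1, because
    ['C(e + 1, e - 1)] is at least e. *)
Lemma gd_compressed : gorenstein A -> \dim A1 = \dim A2 -> (1 < \dim A1)%N ->
  compressed m.
Proof.
move=> gor d12 n1; exists (\dim A1), 3; split=> //.
- exact/gd_embdim.
- exact: gd_socle_degree.
move=> i; rewrite gd_hilb -d12; move: n1; case: (\dim A1) => [//|n] /= n1.
have b1 : 'C(n + 1, n) = n.+1 by rewrite -bin_sub ?leq_addr // addKn bin1 addn1.
have b2 : (n.+1 <= 'C(n + 2, n))%N.
  by rewrite -b1 addn1 addn2 leq_bin2l.
have b3 : (1 <= 'C(n + 3, n))%N by rewrite bin_gt0 leq_addr.
case: i => [|[|[|[|i]]]] //= _; rewrite ?subn0 ?subnn ?(subSS, subn1) ?addn0 ?binn ?b1 /=.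
- by apply/esym/minn_idPl.
- by apply/esym/minn_idPl.
- by apply/esym/minn_idPr.
- by apply/esym/minn_idPr.
Qed.

End GradedDuality.

Lemma addr_regroup (V : zmodType) (z a b c d w : V) :
  z + a + b + c + d + w = z + (a + c) + (b + d) + w.
Proof. by rewrite !addrA; congr (_ + _ + _); rewrite addrAC. Qed.

Section TrivextDuality.
Variables (k : fieldType) (R : comFalgType k) (R1 R2 : {vspace R}).
Variables (p0 : 'Hom(R, k^o)) (p1 p2 : 'End(R)).
Hypothesis sh : short_subring R1 R2 p0 p1 p2.
Hypothesis full : fullv = short_carrier R1 R2.
Hypothesis nosoc : forall x, x \in R1 -> (forall y, y \in R1 -> x * y = 0) -> x = 0.
Hypothesis R2n0 : R2 != 0%VS.
Local Notation T := (trivext R).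
Implicit Types (u v : T).

Definition T1 : {vspace T} := (TR1 p1 + TE1 p2)%VS.
Definition T2 : {vspace T} := (TR2 p2 + TE2 p1)%VS.
Definition T3 : {vspace T} := TE3 p0.
Definition tq1 : 'End(T) := (tr1 p1 + te1 p2)%VF.
Definition tq2 : 'End(T) := (tr2 p2 + te2 p1)%VF.
Definition tq3 : 'End(T) := te3 p0.

Lemma T1P u : u \in T1 -> exists a b, [/\ a \in TR1 p1, b \in TE1 p2 & u = a + b].
Proof. by case/memv_addP => a a1 [b b1 ->]; exists a, b. Qed.
Lemma T2P u : u \in T2 -> exists a b, [/\ a \in TR2 p2, b \in TE2 p1 & u = a + b].
Proof. by case/memv_addP => a a1 [b b1 ->]; exists a, b. Qed.

Lemma TE_sub1 : (TE1 p2 <= TE p0 p1 p2)%VS. Proof. exact: addvSl. Qed.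
Lemma TE_sub2 : (TE2 p1 <= TE p0 p1 p2)%VS.
Proof. by apply: subv_trans (addvSr _ _); apply: addvSl. Qed.
Lemma TE_sub3 : (TE3 p0 <= TE p0 p1 p2)%VS.
Proof. by apply: subv_trans (addvSr _ _); apply: addvSr. Qed.

Lemma TEE0 u v (U V : {vspace T}) : (U <= TE p0 p1 p2)%VS -> (V <= TE p0 p1 p2)%VS ->
  u \in U -> v \in V -> u * v = 0.
Proof.
by move=> UE VE uU vV; apply: (TE_TE sh full); [apply: (subvP UE) | apply: (subvP VE)].
Qed.

Lemma dualT_E1 (al : 'Hom(R, k^o)) : ((0, (al \o p2)%VF) : T) \in TE1 p2.
Proof.
apply/(TE1P sh full); split=> // y.
by rewrite [LHS]comp_lfunE [RHS]comp_lfunE (p2K sh full).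
Qed.

Lemma dualT_E2 (al : 'Hom(R, k^o)) : ((0, (al \o p1)%VF) : T) \in TE2 p1.
Proof.
apply/(TE2P sh full); split=> // y.
by rewrite [LHS]comp_lfunE [RHS]comp_lfunE (p1K sh full).
Qed.

Lemma ringT_1 r : r \in R1 -> ((r, 0) : T) \in TR1 p1.
Proof. by move=> r1; apply/(TR1P sh full). Qed.
Lemma ringT_2 r : r \in R2 -> ((r, 0) : T) \in TR2 p2.
Proof. by move=> r1; apply/(TR2P sh full). Qed.

Lemma trivext_graded_duality : graded_duality T1 T2 T3 (tp0 p0) tq1 tq2 tq3.
Proof.
split.
- have [o0 o1 o2 [o3 o4 o5]] := one_parts sh.
  by split; rewrite // add_lfunE ?o1 ?o2 ?o3 ?o4 addr0.
- move=> _ /T1P[a [b [a1 b1 ->]]].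
  have [a00 a01 a02 [a03 a04 a05]] := TR1_parts sh full a1.
  have [b00 b01 b02 [b03 b04 b05]] := TE1_parts sh full b1.
  by split; rewrite ?add_lfunE !linearD /= ?a00 ?a01 ?a02 ?a03 ?a04 ?a05
    ?b00 ?b01 ?b02 ?b03 ?b04 ?b05 !(addr0, add0r).
- move=> _ /T2P[a [b [a1 b1 ->]]].
  have [a00 a01 a02 [a03 a04 a05]] := TR2_parts sh full a1.
  have [b00 b01 b02 [b03 b04 b05]] := TE2_parts sh full b1.
  by split; rewrite ?add_lfunE !linearD /= ?a00 ?a01 ?a02 ?a03 ?a04 ?a05
    ?b00 ?b01 ?b02 ?b03 ?b04 ?b05 !(addr0, add0r).
- move=> a a1; have [a00 a01 a02 [a03 a04 a05]] := TE3_parts sh full a1.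
  by split; rewrite ?add_lfunE ?a00 ?a01 ?a02 ?a03 ?a04 ?a05 ?addr0.
- move=> u; rewrite {1}(trivext_dec sh full u) !add_lfunE.
  exact: addr_regroup.
- move=> u; split; rewrite ?add_lfunE; last exact: te3_in.
    by rewrite memv_add ?tr1_in ?te1_in.
  by rewrite memv_add ?tr2_in ?te2_in.
- move=> _ _ /T1P[a [b [a1 b1 ->]]] /T1P[c [d [c1 d1 ->]]].
  rewrite mulrDl !mulrDr (TEE0 TE_sub1 TE_sub1 b1 d1) addr0 -addrA.
  rewrite memv_add ?(TR1_TR1 sh full) //.
  by rewrite rpredD // 1?[b * c]mulrC (TR1_TE1 sh full).
- move=> _ _ /T1P[a [b [a1 b1 ->]]] /T2P[c [d [c1 d1 ->]]].
  rewrite mulrDl !mulrDr (TEE0 TE_sub1 TE_sub2 b1 d1) addr0.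
  rewrite (TR1_TR2 sh full a1 c1) add0r; apply: rpredD.
    exact: (TR1_TE2 sh full a1 d1).
  by rewrite mulrC; apply: (TR2_TE1 sh full c1 b1).
- move=> _ v /T1P[a [b [a1 b1 ->]]] v3.
  by rewrite mulrDl (TR1_TE3 sh full a1 v3) (TEE0 TE_sub1 TE_sub3 b1 v3) addr0.
- move=> _ _ /T2P[a [b [a1 b1 ->]]] /T2P[c [d [c1 d1 ->]]].
  rewrite mulrDl !mulrDr (TR2_TR2 sh full a1 c1) (TR2_TE2 sh full a1 d1).
  rewrite [b * c]mulrC (TR2_TE2 sh full c1 b1).
  by rewrite (TEE0 TE_sub2 TE_sub2 b1 d1) !addr0.
- move=> _ v /T2P[a [b [a1 b1 ->]]] v3.
  by rewrite mulrDl (TR2_TE3 sh full a1 v3) (TEE0 TE_sub2 TE_sub3 b1 v3) addr0.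
- by move=> u v; apply: TEE0 TE_sub3 TE_sub3.
- rewrite subv_add; apply/andP; split; last first.
    apply: subv_trans (TE2_gen sh full nosoc) _; apply: prodvS; first exact: addvSl.
    exact: addvSr.
  apply/subvP => u /(TR2P sh full)[u1 u2].
  have : u.1 \in (R1 * R1)%VS := subvP (short_gen sh) _ u1.
  suff H : forall x, x \in (R1 * R1)%VS -> ((x, 0) : T) \in (T1 * T1)%VS.
    by move/H; rewrite -u2; case: (u).
  apply: prodv_ind; first exact: mem0v.
  + move=> x y hx hy; have -> : ((x + y, 0) : T) = ((x, 0) : T) + ((y, 0) : T).
      by congr pair; rewrite addr0.
    exact: rpredD.
  + move=> a x hx; have -> : ((a *: x, 0) : T) = a *: ((x, 0) : T).
      by congr pair; rewrite scaler0.
    exact: rpredZ.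
  + move=> x y x1 y1; have -> : ((x * y, 0) : T) = ((x, 0) : T) * ((y, 0) : T).
      apply: trivext_eqP => // z.
      by rewrite trivext_mul2E !lfunE addr0.
    by apply: memv_mul; apply: (subvP (addvSl _ _)); apply: ringT_1.
- apply: subv_trans (TE3_gen sh full R2n0) _.
  apply/prodvP => a b a2 b1; rewrite mulrC memv_mul //.
    by apply: (subvP (addvSr _ _)).
  by apply: (subvP (addvSl _ _)).
- move=> _ /T1P[a [b [a1 b1 ->]]] h.
  have /(TR1P sh full)[aR a2] := a1; have /(TE1P sh full)[bR b2] := b1.
  (* Evaluated at 1, the product with (0, al) gives al at [a.1], and the product with (x, 0) gives
     [b.2 x]. *)
  have a0 : a.1 = 0.
    have [_ aa _] := short_R1 sh aR; rewrite -aa.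
    apply: dual_sep => al.
    have := h _ (subvP (addvSr _ _) _ (dualT_E2 al)).
    rewrite mulrDl (TEE0 TE_sub1 TE_sub2 b1 (dualT_E2 al)) addr0.
    move/(congr1 (fun u : T => u.2 1)).
    by rewrite trivext_mul2E a2 !zero_lfunE addr0 mulr1 [LHS]comp_lfunE.
  have b0 x : b.2 x = 0.
    rewrite -b2; have [_ _ x2] := full_dec sh full x.
    have := h _ (subvP (addvSl _ _) _ (ringT_2 x2)).
    move/(congr1 (fun u : T => u.2 1)).
    by rewrite trivext_mul2E /= !zero_lfunE add0r add_lfunE a2 zero_lfunE add0r mulr1.
  by apply: trivext_eqP => [|x]; rewrite ?trivextD1 ?trivextD2 ?a0 ?bR ?a2 ?b0 ?lfunE ?addr0.
- move=> _ /T2P[a [b [a1 b1 ->]]] h.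
  have /(TR2P sh full)[aR a2] := a1; have /(TE2P sh full)[bR b2] := b1.
  have a0 : a.1 = 0.
    have [_ _ aa] := short_R2 sh aR; rewrite -aa.
    apply: dual_sep => al.
    have := h _ (subvP (addvSr _ _) _ (dualT_E1 al)).
    rewrite mulrDl (TEE0 TE_sub2 TE_sub1 b1 (dualT_E1 al)) addr0.
    move/(congr1 (fun u : T => u.2 1)).
    by rewrite trivext_mul2E a2 !zero_lfunE addr0 mulr1 [LHS]comp_lfunE.
  have b0 x : b.2 x = 0.
    rewrite -b2; have [_ x1 _] := full_dec sh full x.
    have := h _ (subvP (addvSl _ _) _ (ringT_1 x1)).
    move/(congr1 (fun u : T => u.2 1)).
    by rewrite trivext_mul2E /= !zero_lfunE add0r add_lfunE a2 zero_lfunE add0r mulr1.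
  by apply: trivext_eqP => [|x]; rewrite ?trivextD1 ?trivextD2 ?a0 ?bR ?a2 ?b0 ?lfunE ?addr0.
- exact: (dim_TE3 sh).
Qed.

Lemma trivext_dimT : \dim T1 = (\dim R1 + \dim R2)%N /\ \dim T2 = (\dim R1 + \dim R2)%N.
Proof.
split; rewrite dimv_disjoint_sum.
- by rewrite (dim_TR1 sh full) (dim_TE1 sh full).
- apply/eqP; rewrite -subv0; apply/subvP => x; rewrite memv_cap memv0.
  case/andP => /(TR1_parts sh full)[_ h _ _] /(TE1_parts sh full)[_ g _ _].
  by rewrite -h g.
- by rewrite (dim_TR2 sh full) (dim_TE2 sh full) addnC.
- apply/eqP; rewrite -subv0; apply/subvP => x; rewrite memv_cap memv0.
  case/andP => /(TR2_parts sh full)[_ _ h _] /(TE2_parts sh full)[_ _ g _].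
  by rewrite -h g.
Qed.

(** Under the form u |-> [u.2 1], the product (x, alpha)(0, beta) goes to beta(x) and (x, alpha)(y,
    0) goes to alpha(y), so no nonzero element is orthogonal to T. *)
Lemma trivext_gorenstein : gorenstein T.
Proof.
pose lam (u : T) : k^o := u.2 1.
have lam_lin : linear lam by move=> a u v; rewrite /lam trivextD2 trivextZ2.
pose lamL : {linear T -> k^o} := HB.pack lam (GRing.isLinear.Build k T k^o _ lam lam_lin).
apply: (@frobenius_gorenstein k T (linfun lamL)) => u u0.
apply: boolp.contrapT => no.
have z v : (u * v).2 1 = 0.
  apply/eqP; apply: contraT => h; case: no; exists v.
  by rewrite lfunE.
case/eqP: u0; apply: trivext_eqP => [|x].
  apply: dual_sep => al; have := z ((0, al) : T).
  by rewrite trivext_mul2E /= mulr1 mul0r linear0 addr0.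
have := z ((x, 0) : T).
by rewrite trivext_mul2E /= !mulr1 !zero_lfunE add0r.
Qed.

Lemma trivext_maxE (m : {vspace R}) : m = (R1 + R2)%VS ->
  trivext_max m = gd_max T1 T2 T3.
Proof.
move=> mE; have gd := trivext_graded_duality.
pose f1 (u : T) : R := u.1.
apply/eqP; rewrite eqEsubv; apply/andP; split; apply/subvP => u.
  rewrite /trivext_max -memv_preim lfunE /= mE => um.
  apply/(gd_maxP gd); rewrite tp0E.
  case/memv_addP: um => a a1 [b b2 ->]; rewrite linearD /=.
  by have [-> _ _] := short_R1 sh a1; have [-> _ _] := short_R2 sh b2; rewrite addr0.
move/(gd_maxP gd); rewrite tp0E => u0.
rewrite /trivext_max -memv_preim lfunE /= mE.
have [E h1 h2] := full_dec sh full u.1; rewrite E u0 rmorph0 add0r.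
exact: memv_add.
Qed.

End TrivextDuality.

Section GradedDualityGrading.
Variables (k : fieldType) (A : comFalgType k) (A1 A2 A3 : {vspace A}).
Variables (c0 : 'Hom(A, k^o)) (q1 q2 q3 : 'End(A)).
Hypothesis gd : graded_duality A1 A2 A3 c0 q1 q2 q3.

Definition gd_grading (i : nat) : {vspace A} := nth 0%VS [:: 1%VS; A1; A2; A3] i.

Lemma gd_grading_high i x : x \in gd_grading i.+4 -> x = 0.
Proof. by rewrite /gd_grading /= nth_nil memv0 => /eqP. Qed.

Lemma gd_graded_local : graded_local (gd_max A1 A2 A3) gd_grading.
Proof.
have [o0 o1 o2 o3] := gd_one gd.
split=> //.
- have one_mul i x y : x \in (1%VS : {vspace A}) -> y \in gd_grading i -> x * y \in gd_grading i.
    by move=> /vlineP[a ->] yi; rewrite -scalerAl mul1r rpredZ.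
  have M i j x y : (i <= j)%N -> x \in gd_grading i -> y \in gd_grading j ->
      x * y \in gd_grading (i + j).
    case: i j => [|[|[|[|i]]]] [|[|[|[|j]]]] // _;
      try (by move=> _ /gd_grading_high ->; rewrite mulr0 mem0v);
      try (by move=> /gd_grading_high -> _; rewrite mul0r mem0v);
      try (exact: one_mul); rewrite /= => xi yi.
    + exact: (gd_11 gd).
    + exact: (gd_12 gd).
    + by rewrite (gd_13 gd xi yi) mem0v.
    + by rewrite (gd_22 gd xi yi) mem0v.
    + by rewrite (gd_23 gd xi yi) mem0v.
    + by rewrite (gd_33 gd xi yi) mem0v.
  move=> i j x y xi yj; have [ij|/ltnW ji] := leqP i j; first exact: M.
  by rewrite mulrC addnC M.
- move=> n; apply/directv_sum_independent => us usG S l _.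
  have proj (q : 'End(A)) : q (us l) = us l ->
      (forall j, j != l -> q (us j) = 0) -> us l = 0.
    move=> ql qj; have := congr1 q S; rewrite linear0 linear_sum (bigD1 l) //= ql.
    by rewrite big1 ?addr0 // => j /qj.
  have parts j : us j = 0 \/ [\/ us j \in 1%VS /\ nat_of_ord j = 0%N, us j \in A1 /\ nat_of_ord j = 1%N,
     us j \in A2 /\ nat_of_ord j = 2 | us j \in A3 /\ nat_of_ord j = 3].
    have := usG j isT; rewrite /gd_grading; case: (nat_of_ord j) => [|[|[|[|i]]]].
    + by move=> /= h; right; apply: Or41; split.
    + by move=> /= h; right; apply: Or42; split.
    + by move=> /= h; right; apply: Or43; split.
    + by move=> /= h; right; apply: Or44; split.
    + by rewrite /= nth_nil memv0 => /eqP h; left.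
  have one_z (q : 'End(A)) x : q 1 = 0 -> x \in (1%VS : {vspace A}) -> q x = 0.
    by move=> q0 /vlineP[a ->]; rewrite linearZ /= q0 scaler0.
  have lj j : j != l -> nat_of_ord j <> nat_of_ord l by move=> jl e; case/eqP: jl; apply: val_inj.
  have [//|[[u1 l1]|[u1 l1]|[u1 l1]|[u1 l1]]] := parts l.
  + case/vlineP: u1 => a ea; have := congr1 c0 S; rewrite linear0 linear_sum (bigD1 l) //=.
    rewrite big1 ?addr0 => [|j /lj jl].
      by rewrite ea (gd_c0_alg gd a) => ->; rewrite scale0r.
    have [->|[[_ e]|[/(gd_A1 gd)[-> *]//]|[/(gd_A2 gd)[-> *]//]|[/(gd_A3 gd)[-> *]//]]] := parts j.
      by rewrite linear0.
    by case: jl; rewrite e l1.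
  + apply: (proj q1) => [|j /lj jl]; first by have [] := gd_A1 gd u1.
    have [->|[[h e]|[_ e]|[/(gd_A2 gd)[_ -> *]//]|[/(gd_A3 gd)[_ -> *]//]]] := parts j.
    * by rewrite linear0.
    * by rewrite one_z.
    * by case: jl; rewrite e l1.
  + apply: (proj q2) => [|j /lj jl]; first by have [] := gd_A2 gd u1.
    have [->|[[h e]|[/(gd_A1 gd)[_ _ -> *]//]|[_ e]|[/(gd_A3 gd)[_ _ -> *]//]]] := parts j.
    * by rewrite linear0.
    * by rewrite one_z.
    * by case: jl; rewrite e l1.
  + apply: (proj q3) => [|j /lj jl]; first by have [] := gd_A3 gd u1.
    have [->|[[h e]|[/(gd_A1 gd)[_ _ _ -> *]//]|[/(gd_A2 gd)[_ _ _ -> *]//]|[_ e]]] := parts j.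
    * by rewrite linear0.
    * by rewrite one_z.
    * by case: jl; rewrite e l1.
- exists 4; split; rewrite unlock /= !addv0; last by [].
  by rewrite (gd_full gd).
Qed.

End GradedDualityGrading.

(** * Consequences of the acyclic complex for R and T *)

Section CompleteData.
Variables (k : fieldType) (R : comFalgType k) (G : nat -> {vspace R}) (m : {vspace R}).
Variable F : complex R.
Hypothesis std : standard_graded_local m G.
Hypothesis soc : socle_degree m 2.
Hypothesis e3 : (3 <= \dim (G 1%N))%N.
Hypothesis ngor : ~ gorenstein R.
Hypothesis Fn0 : nonzero_complex F.
Hypothesis Fmin : minimal_complex m F.
Hypothesis Fac : acyclic F.
Local Notation R1 := (G 1%N).
Local Notation R2 := (G 1%N * G 1%N)%VS.
Local Notation p0 := (gp0 m).
Local Notation p1 := (gp1 G).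
Local Notation p2 := (gp2 G).
Local Notation T := (trivext R).

Let sh : short_subring R1 R2 p0 p1 p2 := graded_short std soc.
Let full : fullv = short_carrier R1 R2 := graded_full std soc.
Let R2n0 : R2 != 0%VS := graded_R2_neq0 std soc.

Lemma cdiff_m n : entries_in m (cdiff F n).
Proof.
move=> i j; have := Fmin (delta_mx 0 i : 'rV_(crank F n)) j.
by rewrite -rowE mxE.
Qed.

Lemma R2_m x y : x \in R2 -> y \in m -> x * y = 0.
Proof.
move=> x2; rewrite (graded_mE std soc) => /memv_addP[u u1 [v v2 ->]].
by rewrite mulrDr (short_21 sh x2 u1) (short_22 sh x2 v2) addr0.
Qed.

(** A basis vector of F_(n-1) times a nonzero element of R2 is a cycle, as m R2 = 0, so it must come
    from F_n. *)
Lemma crank_right n : crank F (n - 1) != 0%N -> crank F n != 0%N.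
Proof.
move=> h; apply/negP => /eqP c0.
have [x x2 x0] : exists2 x, x \in R2 & x != 0.
  by exists (vpick R2); rewrite ?memv_pick ?vpick0.
have h0 : (0 < crank F (n - 1))%N by rewrite lt0n.
pose v : 'rV[R]_(crank F (n - 1)) := \row_j (if j == Ordinal h0 then x else 0).
have vd : v *m cdiff F (n - 1) = 0.
  apply/rowP => j; rewrite !mxE big1 // => i _; rewrite mxE.
  by case: eqP => _; rewrite ?mul0r // R2_m ?cdiff_m.
have [w wv] := Fac vd; have : v 0 (Ordinal h0) = 0.
  rewrite wv mxE big1 // => i _; exfalso; by move: i; rewrite c0 => -[].
by rewrite mxE eqxx => /eqP; rewrite (negbTE x0).
Qed.

(** If F_(n-2) were 0, a basis vector of F_(n-1) would be a cycle, hence a boundary, and would have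
    entries in m. *)
Lemma crank_left n : crank F (n - 1) != 0%N -> crank F (n - 1 - 1) != 0%N.
Proof.
move=> h; apply/negP => /eqP c0.
have h0 : (0 < crank F (n - 1))%N by rewrite lt0n.
pose v : 'rV[R]_(crank F (n - 1)) := delta_mx 0 (Ordinal h0).
have vd : v *m cdiff F (n - 1) = 0.
  by apply/rowP => j; exfalso; move: j; rewrite c0 => -[].
have [w wv] := Fac vd; have : v 0 (Ordinal h0) \in m.
  by rewrite wv mxE rpred_sum // => i _; apply: (graded_m_ideal std soc); apply: cdiff_m.
rewrite mxE !eqxx /= => m1; have : (1 : R) \in (1 :&: m)%VS.
  by rewrite memv_cap memv_line.
by rewrite (graded_m1 std soc) memv0 oner_eq0.
Qed.

Lemma crank_pos n : (0 < crank F n)%N.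
Proof.
rewrite lt0n; case: Fn0 => n0 h0.
have step i : crank F (n0 + i%:Z) != 0%N /\ crank F (n0 - i%:Z) != 0%N.
  elim: i => [|i [IH1 IH2]]; first by split; [rewrite addr0 | rewrite subr0].
  rewrite -addn1 PoszD; split.
    by apply: crank_right; rewrite addrA addrK.
  have := @crank_left (n0 - i%:Z + 1); rewrite addrK => /(_ IH2).
  by rewrite opprD addrA.
have [h1 h2] := step `|n - n0|%N.
have [le|/ltW le] := Num.Theory.lerP n0 n.
  by have -> : n = n0 + `|n - n0|%N%:Z by lia.
by have -> : n = n0 - `|n - n0|%N%:Z by lia.
Qed.

(** Iterating the predecessor makes [lft n j.+1] convertible to [lft n j - 1], which is what the
    type of [cdiff] asks for. *)
Definition lft (n : int) j : int := iter j (fun i => i - 1) n.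

Lemma complex_left n : left_complex R1 R2 (fun j => cdiff F (lft n j)).
Proof.
split.
- by move=> j; exact: cdiff2.
- by move=> j i l; rewrite -(graded_mE std soc); apply: cdiff_m.
- move=> j v _ vd; have [w ->] := Fac vd.
  by exists w => // i l; rewrite -full memvf.
- by move=> j; apply: crank_pos.
Qed.

Lemma R_nosoc x : x \in R1 -> (forall y, y \in R1 -> x * y = 0) -> x = 0.
Proof. exact: (left_complex_socle sh (complex_left 0) (ltnW e3)). Qed.

(** If R2 were a line, the coordinate of the degree 2 part would be a nondegenerate form, R1 having
    no socle, and R would be Gorenstein. *)
Lemma R2_dim_gt1 : (1 < \dim R2)%N.
Proof.
rewrite ltnNge; apply/negP => le1; apply: ngor.
have d1 : \dim R2 = 1%N.
  by apply/eqP; rewrite eqn_leq le1 lt0n dimv_eq0.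
have [w w2 w0] : exists2 x, x \in R2 & x != 0.
  by exists (vpick R2); rewrite ?memv_pick ?vpick0.
have wR2 : R2 = <[w]>%VS.
  by apply/esym/eqP; rewrite eqEdim -memvE w2 d1 dim_vline w0.
have fr : free [tuple w] by rewrite seq1_free.
pose lam (x : R) : k^o := coord [tuple w] ord0 (p2 x).
have lam_lin : linear lam by move=> a x y; rewrite /lam !linearP.
pose lamL : {linear R -> k^o} := HB.pack lam (GRing.isLinear.Build k R k^o _ lam lam_lin).
have lam_n0 x : p2 x != 0 -> linfun lamL x != 0.
  rewrite lfunE /= /lam; have [_ _] := full_dec sh full x; rewrite wR2.
  case/vlineP => a ->; rewrite scaler_eq0 (negbTE w0) orbF linearZ /=.
  have -> : coord [tuple w] ord0 w = 1 := coord_free ord0 ord0 fr.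
  by rewrite /GRing.scale /= mulr1.
apply: (@frobenius_gorenstein k R (linfun lamL)) => x x0.
have [E x1 x2] := full_dec sh full x.
have [p00|p00] := eqVneq (p0 x) 0; last first.
  exists w; apply: lam_n0; rewrite mulrC (R2_mul sh full x w2) linearZ /=.
  by have [_ _ ->] := short_R2 sh w2; rewrite scaler_eq0 negb_or p00.
have [p10|p10] := eqVneq (p1 x) 0.
  exists 1; apply: lam_n0; rewrite mulr1; apply: contraNneq x0 => h.
  by rewrite E p00 p10 h rmorph0 !addr0.
have [[y y1 xy]|no] := boolp.pselect (exists2 y, y \in R1 & p1 x * y != 0).
  exists y; apply: lam_n0; have [_ _] := R1_mul sh full x y1.
  by rewrite mulrC => ->; rewrite mulrC.
case/eqP: p10; apply: R_nosoc => // y y1; apply/eqP; apply: contraT => h.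
by case: no; exists y.
Qed.

Lemma R_dims : \dim R1 = (\dim R2).+1.
Proof. exact: (socle_dim sh (complex_left 0) e3 R2_dim_gt1). Qed.

Definition Tgd := trivext_graded_duality sh full R_nosoc R2n0.

Lemma T_max : trivext_max m = gd_max (T1 p1 p2) (T2 p1 p2) (T3 p0).
Proof. exact: (trivext_maxE sh full R_nosoc R2n0 (graded_mE std soc)). Qed.

Lemma dual_vanish (al : 'Hom(R, k^o)) i :
  (forall j y, (j + i != 3)%N -> y \in G j -> al y = 0) <->
  match i with 1 => forall x, al (p2 x) = al x | 2 => forall x, al (p1 x) = al x
  | 3 => forall x, al (in_alg R (p0 x)) = al x | _ => al = 0 end.
Proof.
have G0 : G 0%N = 1%VS by case: std => -[].
have G2 := graded_2 std soc; have Gh := graded_high std soc.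
have dec x : al x = al (in_alg R (p0 x)) + al (p1 x) + al (p2 x).
  by have [E _ _] := full_dec sh full x; rewrite {1}E !linearD.
have mem0 x : in_alg R (p0 x) \in G 0%N by rewrite G0 /= rpredZ ?memv_line.
have mem1 x : p1 x \in G 1%N by have [] := full_dec sh full x.
have mem2 x : p2 x \in G 2%N by rewrite G2; have [] := full_dec sh full x.
have hi j y : (2 < j)%N -> y \in G j -> al y = 0.
  by move=> j2; rewrite Gh // memv0 => /eqP ->; rewrite linear0.
case: i => [|[|[|[|i]]]]; split.
- move=> h; apply/lfunP => x; rewrite dec (h _ _ _ (mem0 x)) // (h _ _ _ (mem1 x)) //.
  by rewrite (h _ _ _ (mem2 x)) // lfunE !addr0.
- by move=> -> *; rewrite lfunE.
- by move=> h x; rewrite [RHS]dec (h _ _ _ (mem0 x)) // (h _ _ _ (mem1 x)) // !add0r.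
- move=> h [|[|[|j]]] // y _; last exact: hi.
    rewrite G0 => /vlineP[a ->]; rewrite -h linearZ /=.
    by have [_ _ ->] := short_one sh; rewrite scaler0 linear0.
  by move=> y1; rewrite -h; have [_ _ ->] := short_R1 sh y1; rewrite linear0.
- by move=> h x; rewrite [RHS]dec (h _ _ _ (mem0 x)) // (h _ _ _ (mem2 x)) // addr0 add0r.
- move=> h [|[|[|j]]] // y _; last exact: hi.
    rewrite G0 => /vlineP[a ->]; rewrite -h linearZ /=.
    by have [_ -> _] := short_one sh; rewrite scaler0 linear0.
  by rewrite G2 => y1; rewrite -h; have [_ -> _] := short_R2 sh y1; rewrite linear0.
- by move=> h x; rewrite [RHS]dec (h _ _ _ (mem1 x)) // (h _ _ _ (mem2 x)) // !addr0.
- move=> h [|[|[|j]]] // y _; last exact: hi.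
    by move=> y1; rewrite -h; have [-> _ _] := short_R1 sh y1; rewrite rmorph0 linear0.
  by rewrite G2 => y1; rewrite -h; have [-> _ _] := short_R2 sh y1; rewrite rmorph0 linear0.
- move=> h; apply/lfunP => x; rewrite dec (h _ _ _ (mem0 x)) // (h _ _ _ (mem1 x)) //.
  by rewrite (h _ _ _ (mem2 x)) // lfunE !addr0.
- by move=> -> *; rewrite lfunE.
Qed.

Lemma T_grading :
  trivext_grading G (gd_grading (T1 p1 p2) (T2 p1 p2) (T3 p0)).
Proof.
have G0 : G 0%N = 1%VS by case: std => -[].
have G2 := graded_2 std soc; have Gh := graded_high std soc.
have split2 (u : T) : u = ((u.1, 0) : T) + (0, u.2).
  by case: (u) => a b; congr pair; rewrite /= ?addr0 ?add0r.
move=> i u; rewrite dual_vanish; case: i => [|[|[|[|i]]]] /=.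
- rewrite G0; split.
    by case/vlineP => a ->; rewrite /= scaler0; split=> //; rewrite rpredZ ?memv_line.
  case=> /vlineP[a u1] u2; apply/vlineP; exists a.
  by rewrite (split2 u) u1 u2; congr pair; rewrite /= ?scaler0 !addr0.
- split.
    case/T1P => a [b [a1 b1 ->]]; have /(TR1P sh full)[aR a2] := a1.
    have /(TE1P sh full)[bR b2] := b1; split; first by rewrite trivextD1 bR addr0.
    by move=> x; rewrite !trivextD2 a2 !zero_lfunE b2.
  case=> u1 u2; rewrite (split2 u) memv_add //; first by apply/(TR1P sh full).
  by apply/(TE1P sh full).
- rewrite G2; split.
    case/T2P => a [b [a1 b1 ->]]; have /(TR2P sh full)[aR a2] := a1.
    have /(TE2P sh full)[bR b2] := b1; split; first by rewrite trivextD1 bR addr0.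
    by move=> x; rewrite !trivextD2 a2 !zero_lfunE b2.
  case=> u1 u2; rewrite (split2 u) memv_add //; first by apply/(TR2P sh full).
  by apply/(TE2P sh full).
- rewrite Gh // memv0; split; first by case/(TE3P sh) => -> h.
  by case=> /eqP u1 u2; apply/(TE3P sh).
- rewrite /gd_grading /= nth_nil Gh // memv0; split; first by rewrite memv0 => /eqP ->.
  rewrite !memv0; case=> /eqP u1 u2; apply/eqP.
  by rewrite (split2 u) u1 u2; congr pair; rewrite /= addr0.
Qed.

End CompleteData.

(** * Exact zero divisors *)

Section DualityZeroDivisors.
Variables (k : fieldType) (A : comFalgType k) (A1 A2 A3 : {vspace A}).
Variables (c0 : 'Hom(A, k^o)) (q1 q2 q3 : 'End(A)).
Hypothesis gd : graded_duality A1 A2 A3 c0 q1 q2 q3.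

Definition lin_ann (x : A) : {vspace A} := (A1 :&: lker (amulr x))%VS.

Lemma lin_annP x y : reflect (y \in A1 /\ y * x = 0) (y \in lin_ann x).
Proof.
rewrite memv_cap memv_ker lfunE /=.
by apply: (iffP andP) => -[? /eqP]; split=> //; apply/eqP.
Qed.

Definition mult_img (x : A) : {vspace A} := limg (amulr x).

(** The ideal of [a] lies in k a + (q1 a) A1 + A3, and the middle term has dimension dim A1 minus
    that of the linear annihilator. *)
Lemma gd_mult_dim a : c0 a = 0 ->
  (\dim (mult_img a) + \dim (lin_ann (q1 a)) <= (\dim A1).+2)%N.
Proof.
move=> a0.
have S : (limg (amulr a) <= <[a]> + (amulr (q1 a) @: A1 + A3))%VS.
  apply/subvP => _ /memv_imgP[x _ ->]; rewrite lfunE /= {1}(gd_dec gd x) -!addrA mulrDl.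
  have [a1 a2 a3] := gd_in gd a; have [x1 x2 x3] := gd_in gd x.
  rewrite memv_add //; first by rewrite /= -scalerAl mul1r rpredZ ?memv_line.
  have aE : a = q1 a + (q2 a + q3 a) by rewrite {1}(gd_dec gd a) a0 rmorph0 add0r addrA.
  have -> : (q1 x + (q2 x + q3 x)) * a = q1 x * q1 a + (q1 x * q2 a + q2 x * q1 a).
    rewrite {1}aE !(mulrDl, mulrDr) (gd_13 gd x1 a3) (gd_22 gd x2 a2) (gd_23 gd x2 a3).
    rewrite [q3 x * q1 a]mulrC (gd_13 gd a1 x3) [q3 x * q2 a]mulrC (gd_23 gd a2 x3).
    by rewrite (gd_33 gd x3 a3) !addr0 !addrA.
  rewrite memv_add //; first by apply/memv_imgP; exists (q1 x); rewrite // lfunE.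
  by apply: rpredD; [|rewrite mulrC]; apply: (gd_12 gd).
have := limg_ker_dim (amulr (q1 a)) A1; rewrite -/(lin_ann _).
have h1 := leq_trans (dimvS S) (dimv_add_leqif _ _).
have := leq_trans h1 (leq_add (leqnn _) (dimv_add_leqif _ _)).
rewrite dim_vline (gd_dim3 gd).
move=> H1 H2; rewrite -H2 addnC -addn2 -addnA leq_add2l; apply: leq_trans H1 _.
by rewrite addnCA leq_add2l; case: (a == 0).
Qed.

(** After scaling, [a] differs from 1 by an element of the maximal ideal, whose fourth power is 0; a
    geometric series inverts it. *)
Lemma gd_unit a : c0 a != 0 -> a \is a GRing.unit.
Proof.
move=> a0; set x := (in_alg A (c0 a)^-1) * a.
have x1 : c0 (1 - x) = 0.
  rewrite linearB /=; have [-> _ _ _] := gd_one gd.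
  have [-> _ _ _] := gd_mul_parts gd (in_alg A (c0 a)^-1) a.
  by rewrite (gd_c0_alg gd) mulVf ?subrr.
have nil : (1 - x) ^+ 4 = 0.
  have h : forall i, (1 - x) ^+ i.+1 \in (gd_max A1 A2 A3 ^+ i.+1)%VS.
    elim=> [|i IH]; first by rewrite expv1; apply/(gd_maxP gd).
    by rewrite exprS expvSl memv_mul //; apply/(gd_maxP gd).
  by have := h 3; rewrite (gd_expv gd) memv0 => /eqP.
have ux : x \is a GRing.unit.
  apply/unitrP; exists (\sum_(i < 4) (1 - x) ^+ i).
  have E : (\sum_(i < 4) (1 - x) ^+ i) * x = 1.
    have := subrX1 (1 - x) 4; rewrite nil sub0r => h.
    have xE : x = - (1 - x - 1) by rewrite addrAC subrr sub0r opprK.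
    by rewrite [X in _ * X]xE mulrN mulrC -h opprK.
  by split; rewrite // mulrC.
by move: ux; rewrite unitrM => /andP[].
Qed.

Lemma gd_zero_divisor a b : a * b = 0 -> b != 0 -> c0 a = 0.
Proof.
move=> ab b0; apply/eqP; apply: contraT => /gd_unit ua.
by move: b0; rewrite -(mulKr ua b) ab mulr0 eqxx.
Qed.

Hypothesis A12 : \dim A1 = \dim A2.
Hypothesis A1_dim : (2 < \dim A1)%N.

(** As (0 : a) = (c), the dimensions of aA and cA add up to dim A = 2 dim A1 + 2, so by
    [gd_mult_dim] the two linear annihilators have total dimension at most 2. Each contains the
    linear part of the other element; neither linear part is 0, as its annihilator would be all of
    A1. *)
Lemma gd_exact_zero_divisor (a : A) : exact_zero_divisor a ->
  exists x z, [/\ x \in A1, z \in A1, x * z = 0, z != 0 &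
    forall y, y \in A1 -> y * x = 0 -> y \in <[z]>%VS]
    /\ (x != 0 /\ forall y, y \in A1 -> y * z = 0 -> y \in <[x]>%VS).
Proof.
case=> a0 [b b0 ab] [c hc].
have ac : c * a = 0 by apply/hc; exists 1; rewrite mul1r.
have a00 := gd_zero_divisor ab b0; have c00 := gd_zero_divisor ac a0.
have [a1 _ _] := gd_in gd a; have [c1 _ _] := gd_in gd c.
have kE : lker (amulr a) = limg (amulr c).
  apply/vspaceP => x; rewrite memv_ker lfunE /=; apply/eqP/memv_imgP => [/hc[y ->]|[y _ ->]].
    by exists y; rewrite ?memvf ?lfunE.
  by rewrite lfunE; apply/hc; exists y.
have dsum : (\dim (mult_img a) + \dim (mult_img c) = (\dim A1 + \dim A1).+2)%N.
  have := limg_ker_dim (amulr a) fullv; rewrite capfv kE addnC => ->.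
  by have [] := gd_dims gd; rewrite /= -A12.
have := gd_mult_dim a00; have := gd_mult_dim c00.
have ann0 : lin_ann 0 = A1.
  apply/vspaceP => y; apply/lin_annP/idP => [[]//|y1]; by rewrite mulr0.
have [c10|c10] := eqVneq (q1 c) 0; first by rewrite c10 ann0; lia.
have [a10|a10] := eqVneq (q1 a) 0; first by rewrite a10 ann0; lia.
move=> dc da.
have ac1 : q1 c * q1 a = 0.
  have [_ _ h _] := gd_mul_parts gd c a.
  by move: h; rewrite ac a00 c00 linear0 !scale0r !add0r.
have La : (<[q1 c]> <= lin_ann (q1 a))%VS by rewrite -memvE; apply/lin_annP.
have Lc : (<[q1 a]> <= lin_ann (q1 c))%VS by rewrite -memvE; apply/lin_annP; rewrite mulrC.
have := dimvS La; have := dimvS Lc; rewrite !dim_vline a10 c10 /= => h1 h2.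
have Ea : <[q1 c]>%VS = lin_ann (q1 a).
  by apply/eqP; rewrite eqEdim La dim_vline c10; lia.
have Ec : <[q1 a]>%VS = lin_ann (q1 c).
  by apply/eqP; rewrite eqEdim Lc dim_vline a10; lia.
exists (q1 a), (q1 c); split; split=> //.
- by rewrite mulrC.
- by move=> y y1 yx; rewrite Ea; apply/lin_annP.
- by move=> y y1 yx; rewrite Ec; apply/lin_annP.
Qed.

End DualityZeroDivisors.

Section TrivextZeroDivisors.
Variables (k : fieldType) (R : comFalgType k) (R1 R2 : {vspace R}).
Variables (p0 : 'Hom(R, k^o)) (p1 p2 : 'End(R)).
Hypothesis sh : short_subring R1 R2 p0 p1 p2.
Hypothesis full : fullv = short_carrier R1 R2.
Hypothesis nosoc : forall x, x \in R1 -> (forall y, y \in R1 -> x * y = 0) -> x = 0.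
Hypothesis R2n0 : R2 != 0%VS.
Hypothesis R12 : \dim R1 = (\dim R2).+1.
Hypothesis R2_gt1 : (1 < \dim R2)%N.
Local Notation T := (trivext R).

Let gd := trivext_graded_duality sh full nosoc R2n0.

(* If x R1 <> R2, a functional on R2 killing x R1 annihilates (x, alpha). *)
Lemma annihilator_line_onto (a c : T) : a \in T1 p1 p2 -> c.1 != 0 ->
  (forall y, y \in T1 p1 p2 -> y * a = 0 -> y \in <[c]>%VS) ->
  forall w, w \in R2 -> exists2 y, y \in R1 & w = a.1 * y.
Proof.
move=> a1 c0 ann w w2.
have a11 : a.1 \in R1.
  case/T1P: a1 => u [v [/(TR1P sh full)[u1 _] /(TE1P sh full)[v1 _] ->]].
  by rewrite trivextD1 v1 addr0.
pose M := (amull a.1 @: R1)%VS.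
have [|wM] := boolP (w \in M).
  by case/memv_imgP => y y1 ->; exists y => //; rewrite lfunE.
pose de : 'Hom(R, k^o) := 0.
have [de0 [deM dew]] : exists de : 'Hom(R, k^o), (forall y, y \in M -> de y = 0) /\ de w != 0.
  pose pr := (\1 - projv M)%VF : 'End(R).
  have prw : pr w != 0.
    rewrite add_lfunE opp_lfunE id_lfunE subr_eq0; apply: contra wM => /eqP ->.
    exact: memv_proj.
  have [al alw] : exists al : 'Hom(R, k^o), al (pr w) <> 0.
    apply: boolp.contrapT => no; case/eqP: prw; apply: dual_sep => al.
    by apply: boolp.contrapT => h; apply: no; exists al.
  exists (al \o pr)%VF; split; last by rewrite comp_lfunE; apply/eqP.
  by move=> y yM; rewrite comp_lfunE add_lfunE opp_lfunE id_lfunE projv_id // subrr linear0.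
have d1 := dualT_E1 sh full de0.
have d1T : ((0, (de0 \o p2)%VF) : T) \in T1 p1 p2 by apply: (subvP (addvSr _ _)).
have [h1 h2 h3] := short_R2 sh w2.
have /vlineP[l lc] : ((0, (de0 \o p2)%VF) : T) \in <[c]>%VS.
  apply: ann => //; apply: trivext_eqP => [|x].
    by rewrite trivext_mul1E mul0r.
  rewrite trivext_mul2E /= mul0r linear0 add0r [RHS]zero_lfunE [LHS]comp_lfunE.
  apply: deM; have [_ _ ->] := R1_mul sh full x a11.
  apply/memv_imgP; exists (p1 x); rewrite ?lfunE //.
  by have [] := full_dec sh full x.
have l0 : l = 0.
  by have /eqP := congr1 (fun u : T => u.1) lc; rewrite trivextZ1 eq_sym scaler_eq0 (negbTE c0) orbF => /eqP.
case/eqP: dew; have := congr1 (fun u : T => u.2 w) lc.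
by rewrite l0 scale0r [X in _ = X -> _]zero_lfunE [X in X = _ -> _]comp_lfunE h3.
Qed.

Lemma trivext_exact_zero_divisor (a : T) : exact_zero_divisor a ->
  exists x : R, exact_zero_divisor x.
Proof.
have [dT1 dT2] := trivext_dimT sh full.
case/(gd_exact_zero_divisor gd); rewrite ?dT1 ?dT2 //; first by lia.
move=> x [z [[x1 z1 xz z0 annx] [x0 annz]]].
have TR1e : (TE1 p2 <= T1 p1 p2)%VS := addvSr _ _.
(* If [u] had no R-part, all of [TE1], of dimension at least 2, would annihilate it and lie in a
   line. *)
have nz (u v : T) : (forall y, y \in T1 p1 p2 -> y * u = 0 -> y \in <[v]>%VS) ->
    u.1 != 0.
  move=> h; apply/eqP => u0.
  have : (TE1 p2 <= <[v]>)%VS.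
    apply/subvP => y y1; apply: h; first exact: (subvP TR1e).
    have /(TE1P sh full)[yR _] := y1.
    by apply: (TE_TE sh full); apply/(TEP sh full).
  by move/dimvS; rewrite (dim_TE1 sh full) dim_vline; case: (v != 0) => /=; lia.
have xR := nz _ _ annx; have zR := nz _ _ annz.
have ontox := annihilator_line_onto x1 zR annx.
have ontoz := annihilator_line_onto z1 xR annz.
have in1 (u : T) : u \in T1 p1 p2 -> u.1 \in R1.
  case/T1P => a' [b [/(TR1P sh full)[u1 _] /(TE1P sh full)[v1 _] ->]].
  by rewrite trivextD1 v1 addr0.
have x11 := in1 _ x1; have z11 := in1 _ z1.
have xz1 : x.1 * z.1 = 0 by have := congr1 (fun u : T => u.1) xz.
exists x.1; split=> //; first by exists z.1.
exists z.1 => y; split; last by case=> w ->; rewrite -mulrA [z.1 * _]mulrC xz1 mulr0.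
move=> yx.
have [E y1 y2] := full_dec sh full y.
have [h1 h2 h3] := R1_mul sh full y x11.
move: h2 h3; rewrite mulrC yx !linear0 => /esym/eqP.
rewrite scaler_eq0 (negbTE xR) orbF => /eqP y0 xy1.
(* [x.1] maps R1 onto R2 and dim R1 = dim R2 + 1, so its kernel in R1 is a line. *)
have K : (R1 :&: lker (amull x.1) = <[z.1]>)%VS.
  apply/esym/eqP; rewrite eqEdim -memvE memv_cap z11 memv_ker lfunE /= xz1 eqxx /=.
  have := limg_ker_dim (amull x.1) R1.
  have : (R2 <= amull x.1 @: R1)%VS.
    apply/subvP => w /ontox[v v1 ->]; apply/memv_imgP; exists v; rewrite ?lfunE //.
  move=> /dimvS h1' h2'; rewrite dim_vline zR /=.
  by rewrite -(leq_add2r (\dim (amull x.1 @: R1))) h2' R12 add1n ltnS.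
have : p1 y \in (R1 :&: lker (amull x.1))%VS.
  by rewrite memv_cap y1 memv_ker lfunE /= -xy1.
rewrite K => /vlineP[l lE].
have [r r1 rE] := ontoz _ y2.
exists (in_alg R l + r); rewrite E y0 rmorph0 add0r lE rE mulrDl [r * _]mulrC.
by rewrite /= -scalerAl mul1r.
Qed.

End TrivextZeroDivisors.

(** * Complete intersections *)

Section KoszulBound.
Variable Q : comNzRingType.
Implicit Types (s y f : seq Q).

Lemma in_idl_sum s (I : Type) (r : seq I) (P : pred I) (F : I -> Q) :
  (forall i, P i -> in_idl s (F i)) -> in_idl s (\sum_(i <- r | P i) F i).
Proof. by have [h0 hD _ _] := in_idl_ideal s => h; apply: big_ind. Qed.

Lemma in_idl_opp s x : in_idl s x -> in_idl s (- x).
Proof. by have [_ _ hM _] := in_idl_ideal s => h; rewrite -mulN1r; apply: hM. Qed.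

Lemma in_idl_mulr s x a : in_idl s x -> in_idl s (x * a).
Proof. by have [_ _ hM _] := in_idl_ideal s => h; rewrite mulrC; apply: hM. Qed.

Lemma in_idl_rcons s g x : in_idl (rcons s g) x <-> exists t, in_idl s (x - t * g).
Proof.
split=> [[c ->]|[t [c E]]].
  rewrite size_rcons big_ord_recr /= nth_rcons ltnn eqxx; exists (c (size s)).
  rewrite addrK; exists c; apply: eq_bigr => i _; by rewrite nth_rcons ltn_ord.
exists (fun i => if (i < size s)%N then c i else t).
rewrite size_rcons big_ord_recr /= nth_rcons !ltnn eqxx -[LHS](subrK (t * g)) E.
by congr (_ + _); apply: eq_bigr => i _; rewrite nth_rcons ltn_ord.
Qed.

Definition idl_row s n (v : 'rV[Q]_n) := forall j, in_idl s (v 0 j).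

Lemma idl_rowD s n (v w : 'rV[Q]_n) : idl_row s v -> idl_row s w -> idl_row s (v + w).
Proof. by move=> hv hw j; rewrite mxE; have [_ h _ _] := in_idl_ideal s; apply: h. Qed.

Lemma idl_rowN s n (v : 'rV[Q]_n) : idl_row s v -> idl_row s (- v).
Proof. by move=> hv j; rewrite mxE; apply: in_idl_opp. Qed.

Lemma idl_rowM s m n (v : 'rV[Q]_m) (M : 'M[Q]_(m, n)) : idl_row s v -> idl_row s (v *m M).
Proof. by move=> hv j; rewrite mxE; apply: in_idl_sum => i _; apply: in_idl_mulr. Qed.

Lemma idl_rowZ s n (v : 'rV[Q]_n) a : idl_row s v -> idl_row s (a *: v).
Proof. by move=> hv j; rewrite mxE; have [_ _ h _] := in_idl_ideal s; apply: h. Qed.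

(* The Koszul complex on y as one matrix D on a graded basis, together with
   contracting homotopies for the multiplications by the y_l. *)
Record koszul y N (deg : 'I_N -> nat) (D : 'M[Q]_N) (H : nat -> 'M[Q]_N) : Prop := Koszul {
  ko_D : forall i j, deg j != (deg i).+1 -> D i j = 0;
  ko_y : forall i j, in_idl y (D i j);
  ko_H : forall l i j, deg i != (deg j).+1 -> H l i j = 0;
  ko_DD : D *m D = 0;
  ko_homotopy : forall l, (l < size y)%N -> D *m H l + H l *m D = (y`_l)%:M;
  ko_top : forall i, (deg i <= size y)%N;
  ko_bot : exists i, deg i = 0%N }.

Lemma koszul_exists y : exists N (deg : 'I_N -> nat) D H, koszul y deg D H.
Proof.
elim/last_ind: y => [|y g [N [deg [D [H ko]]]]].
  exists 1%N, (fun=> 0%N), 0, (fun=> 0); split.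
  - by move=> i j _; rewrite mxE.
  - by move=> i j; rewrite mxE; case: (in_idl_ideal ([::] : seq Q)).
  - by move=> l i j _; rewrite mxE.
  - by rewrite mulmx0.
  - by [].
  - by [].
  - by exists ord0.
(* The complex on [rcons y g] is the cone of multiplication by [g]: a second copy of the basis, one
   degree higher. *)
exists (N + N)%N, (fun i => match split i with inl j => deg j | inr j => (deg j).+1 end).
exists (block_mx D g%:M 0 (- D)).
(* Old homotopies act on both copies; the homotopy for [g] is the identity from the second copy back
   to the first. *)
exists (fun l => if (l < size y)%N then block_mx (H l) 0 0 (- H l) else block_mx 0 0 1%:M 0).
split.
- move=> i j; case: (split_ordP i) => a ->; case: (split_ordP j) => c ->;
    rewrite ?(unsplitK (inl _)) ?(unsplitK (inr _)) ?block_mxEul ?block_mxEur ?block_mxEdl ?block_mxEdr ?mxE //.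
  + exact: (ko_D ko).
  + by rewrite eqSS; case: (altP (a =P c)) => [->|]; rewrite ?eqxx ?mulr0n.
  + by rewrite eqSS => h; rewrite (ko_D ko) ?oppr0.
- have mono x : in_idl y x -> in_idl (rcons y g) x.
    by move=> h; apply/in_idl_rcons; exists 0; rewrite mul0r subr0.
  move=> i j; case: (split_ordP i) => a ->; case: (split_ordP j) => c ->;
    rewrite ?block_mxEul ?block_mxEur ?block_mxEdl ?block_mxEdr ?mxE.
  + exact/mono/(ko_y ko).
  + apply/in_idl_rcons; exists (a == c)%:R; rewrite mulr_natl subrr.
    by case: (in_idl_ideal y).
  + by case: (in_idl_ideal (rcons y g)).
  + exact/in_idl_opp/mono/(ko_y ko).
- move=> l i j; case: (split_ordP i) => a ->; case: (split_ordP j) => c ->; case: ltnP => _;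
    rewrite ?(unsplitK (inl _)) ?(unsplitK (inr _)) ?block_mxEul ?block_mxEur ?block_mxEdl ?block_mxEdr ?mxE //.
  + exact: (ko_H ko).
  + by rewrite eqSS; case: (altP (a =P c)) => [->|]; rewrite ?eqxx.
  + by rewrite eqSS => h; rewrite (ko_H ko) ?oppr0.
- rewrite mulmx_block (ko_DD ko) !mulmx0 !mul0mx [- D *m - D]mulmxN mulNmx (ko_DD ko).
  by rewrite [_ *m - D]mulmxN scalar_mxC subrr !oppr0 !addr0 block_mx0.
- move=> l; rewrite size_rcons ltnS leq_eqVlt nth_rcons => /orP[/eqP ->|ly].
    rewrite ltnn eqxx !mulmx_block !mulmx0 !mul0mx !mulmx1 !mul1mx !addr0 !add0r.
    by rewrite add_block_mx !addr0 !add0r addNr scalar_mx_block.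
  have e1 (X Y : 'M[Q]_N) : - X *m - Y = X *m Y by rewrite mulmxN mulNmx opprK.
  have e2 : g%:M *m - H l + H l *m g%:M = 0 by rewrite mulmxN scalar_mxC addNr.
  rewrite ly !mulmx_block !mulmx0 !mul0mx !addr0 !add0r add_block_mx !e1 e2 addr0.
  by rewrite (ko_homotopy ko) // scalar_mx_block.
- by move=> i; rewrite size_rcons; case: split => a; rewrite ?ltnS ?(ko_top ko) // leqW ?(ko_top ko).
- by have [i i0] := ko_bot ko; exists (lshift N i); rewrite (unsplitK (inl _)).
Qed.

Section Cohomology.
Variables (y : seq Q) (N : nat) (deg : 'I_N -> nat) (D : 'M[Q]_N) (H : nat -> 'M[Q]_N).
Hypothesis ko : koszul y deg D H.

Definition in_deg (i : nat) (x : 'rV[Q]_N) := forall j, deg j != i -> x 0 j = 0.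
(** The condition [(deg j).+1 != i] forces [w] to be 0 when [i] is 0, so degree 0 has no
    coboundaries modulo [s] other than 0. *)
Definition coboundary s (i : nat) (x : 'rV[Q]_N) :=
  exists w : 'rV[Q]_N, (forall j, (deg j).+1 != i -> w 0 j = 0) /\ idl_row s (x - w *m D).
Definition cohomology0 s (i : nat) :=
  forall x, in_deg i x -> idl_row s (x *m D) -> coboundary s i x.

Lemma in_deg_D i (x : 'rV[Q]_N) : in_deg i x -> in_deg i.+1 (x *m D).
Proof.
move=> xi j jd; rewrite mxE big1 // => l _.
have [dl|/xi -> //] := eqVneq (deg l) i; last by rewrite mul0r.
by rewrite (ko_D ko) ?mulr0 // dl.
Qed.

Lemma deg_D_pred i (w : 'rV[Q]_N) j : (forall j, (deg j).+1 != i -> w 0 j = 0) ->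
  deg j != i -> (w *m D) 0 j = 0.
Proof.
move=> wi jd; rewrite mxE big1 // => l _.
have [dl|/wi -> //] := eqVneq (deg l).+1 i; last by rewrite mul0r.
by rewrite (ko_D ko) ?mulr0 // dl.
Qed.

(** Choosing [t] to vanish wherever [v] does lets it inherit the degree of [v]. *)
Lemma idl_row_rcons s g n (v : 'rV[Q]_n) : idl_row (rcons s g) v ->
  exists t, idl_row s (v - g *: t) /\ forall j, v 0 j = 0 -> t 0 j = 0.
Proof.
move=> hv; have /fin_all_exists[t ht] : forall j, exists t, in_idl s (v 0 j - t * g) /\ (v 0 j = 0 -> t = 0).
  move=> j; have /in_idl_rcons[t ht] := hv j; have [v0|v0] := eqVneq (v 0 j) 0.
    by exists 0; rewrite v0 mul0r subr0; split=> //; case: (in_idl_ideal s).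
  by exists t; split=> // /eqP; rewrite (negbTE v0).
exists (\row_j t j); split=> [j|j v0]; rewrite !mxE; have [] := ht j => //.
  by rewrite mulrC.
by move=> _ ->.
Qed.

Lemma idl_row_rconsW s g n (v t : 'rV[Q]_n) : idl_row s (v - g *: t) -> idl_row (rcons s g) v.
Proof.
by move=> hv j; apply/in_idl_rcons; exists (t 0 j); have := hv j; rewrite !mxE mulrC.
Qed.

Variables (s : seq Q) (g : Q).
Hypothesis gy : in_idl y g.
Hypothesis greg : forall a, in_idl s (a * g) -> in_idl s a.

Lemma idl_row_reg n (v : 'rV[Q]_n) : idl_row s (g *: v) -> idl_row s v.
Proof. by move=> hv j; apply: greg; have := hv j; rewrite mxE mulrC. Qed.

Lemma koszul_homotopy : exists h : 'M[Q]_N, D *m h + h *m D = g%:M /\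
  forall i j, deg i != (deg j).+1 -> h i j = 0.
Proof.
case: gy => c ->; exists (\sum_(l < size y) c l *: H l); split.
  rewrite mulmx_sumr mulmx_suml -big_split /= raddf_sum; apply: eq_bigr => l _.
  by rewrite -scalemxAr -scalemxAl -scalerDr (ko_homotopy ko) // scale_scalar_mx.
move=> i j ij; rewrite summxE big1 // => l _.
by rewrite mxE (ko_H ko) ?mulr0.
Qed.

(** In the long exact sequence of multiplication by [g] on Q / (s), that multiplication is
    null-homotopic, so H^i modulo [s] is a quotient of H^(i-1) modulo [rcons s g]. *)
Lemma cohomology0_step m : (forall i, (i < m)%N -> cohomology0 (rcons s g) i) ->
  forall i, (i < m.+1)%N -> cohomology0 s i.
Proof.
move=> van i im x xi xD; have [h [hD hdeg]] := koszul_homotopy.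
have whi : forall j, (deg j).+1 != i -> (x *m h) 0 j = 0.
  move=> j jd; rewrite mxE big1 // => l _.
  have [dl|/xi -> //] := eqVneq (deg l) i; last by rewrite mul0r.
  by rewrite hdeg ?mulr0 // dl eq_sym.
have gx : g *: x = x *m D *m h + x *m h *m D.
  by rewrite -!mulmxA -mulmxDr hD mul_mx_scalar.
have E : idl_row s (g *: x - x *m h *m D) by rewrite gx addrK; apply: idl_rowM.
case: i im xi whi => [|i] im xi whi.
  exists 0; split; first by move=> j _; rewrite mxE.
  rewrite mul0mx subr0; apply: idl_row_reg.
  have -> : g *: x = g *: x - x *m h *m D.
    have -> : x *m h = 0 by apply/rowP => j; rewrite whi // mxE.
    by rewrite mul0mx subr0.
  exact: E.
have wi : in_deg i (x *m h) by move=> j jd; apply: whi; rewrite eqSS.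
have wD : idl_row (rcons s g) (x *m h *m D).
  apply: (@idl_row_rconsW _ _ _ _ x); rewrite -opprB; exact: idl_rowN.
have [v [vi hv]] := van i im _ wi wD.
have [t [ht t0]] := idl_row_rcons hv.
exists t; split.
  move=> j; rewrite eqSS => jd; apply: t0.
  by rewrite mxE wi // add0r mxE (deg_D_pred vi) // oppr0.
apply: idl_row_reg; rewrite scalerBr scalemxAl.
have := idl_rowD E (idl_rowM D ht); rewrite !mulmxBl -[v *m D *m D]mulmxA (ko_DD ko) mulmx0 subr0.
by rewrite addrA subrK.
Qed.

(** The part H^m(s) -> H^m(s, g) -> H^(m+1)(s) of the long exact sequence. *)
Lemma cohomology_connect m : cohomology0 s m -> ~ cohomology0 (rcons s g) m -> ~ cohomology0 s m.+1.
Proof.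
move=> van non van1; apply: non => x xi xD.
have [t [ht t0]] := idl_row_rcons xD.
have ti : in_deg m.+1 t by move=> j jd; apply: t0; apply: (in_deg_D xi).
have tD : idl_row s (t *m D).
  apply: idl_row_reg; have := idl_rowN (idl_rowM D ht).
  by rewrite mulmxBl -[x *m D *m D]mulmxA (ko_DD ko) mulmx0 sub0r opprK scalemxAl.
have [v [vi hv]] := van1 _ ti tD.
have hx : idl_row s ((x - g *: v) *m D).
  have := idl_rowD ht (idl_rowZ g hv); rewrite scalerBr addrA subrK mulmxBl.
  by rewrite -scalemxAl.
have [|w [wi hw]] := van (x - g *: v) _ hx.
  by move=> j jd; rewrite !mxE xi // vi ?eqSS // mulr0 subr0.
exists w; split=> //; apply: (@idl_row_rconsW _ _ _ _ v).
by rewrite addrAC.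
Qed.

End Cohomology.

(* Depth sensitivity of the Koszul complex: a socle element modulo f produces
   a nonzero class in degree [size f], which must be at most [size y]. *)
Lemma regular_seq_size y f u : regular_seq f -> (forall i, (i < size f)%N -> in_idl y f`_i) ->
  ~ in_idl f u -> (forall i, (i < size y)%N -> in_idl f (u * y`_i)) ->
  (size f <= size y)%N.
Proof.
move=> [freg _] fy uf uy; have [N [deg [D [H ko]]]] := koszul_exists y.
have uyx x : in_idl y x -> in_idl f (u * x).
  case=> c ->; rewrite mulr_sumr; apply: in_idl_sum => i _.
  by rewrite mulrCA; have [_ _ h _] := in_idl_ideal f; apply/h/uy.
(* The element [u] times the basis vector of degree 0 is a cocycle modulo [f] and is not 0 there. *)
have base : ~ cohomology0 deg D f 0.
  have [i0 d0] := ko_bot ko; move=> /(_ (u *: delta_mx 0 i0)) [].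
  - move=> j jd; rewrite !mxE; case: (j =P i0) => [e|_]; last by rewrite andbF mulr0.
    by move: jd; rewrite e d0.
  - move=> j; rewrite -scalemxAl -rowE !mxE; exact/uyx/(ko_y ko).
  move=> w [w0 /(_ i0)]; rewrite !mxE !eqxx mulr1 big1 ?subr0 //.
  by move=> l _; rewrite w0 ?mul0r.
(* Each element dropped from the end of [f] raises the lowest degree with nonzero cohomology by
   exactly one. *)
have main p : (p <= size f)%N ->
    (forall i, (i < p)%N -> cohomology0 deg D (take (size f - p) f) i) /\
    ~ cohomology0 deg D (take (size f - p) f) p.
  elim: p => [|p IH] pf; first by rewrite subn0 take_size; split.
  have [van non] := IH (ltnW pf).
  have lt : (size f - p.+1 < size f)%N by lia.
  have E : take (size f - p) f = rcons (take (size f - p.+1) f) f`_(size f - p.+1).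
    by rewrite -take_nth //; congr take; lia.
  have greg a : in_idl (take (size f - p.+1) f) (a * f`_(size f - p.+1)) ->
     in_idl (take (size f - p.+1) f) a by apply: freg.
  rewrite E in van non; have van' := cohomology0_step ko (fy _ lt) greg van.
  by split=> //; apply: (cohomology_connect ko greg _ non); apply: van'.
have [_] := main _ (leqnn _); rewrite subnn take0 => non.
rewrite leqNgt; apply/negP => lt; apply: non => x xd _; exists 0; split.
  by move=> j _; rewrite mxE.
move=> j; rewrite mul0mx subr0 xd; first by case: (in_idl_ideal ([::] : seq Q)).
by apply: contraTneq lt => <-; rewrite -leqNgt (ko_top ko).
Qed.

(** Relations on a regular sequence are Koszul. By regularity the last coefficient lies in the ideal
    of the earlier elements; moving it onto those leaves a shorter relation. *)
Lemma regular_seq_syzygies y (a : nat -> Q) : regular_seq y ->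
  \sum_(i < size y) a i * y`_i = 0 ->
  exists K : nat -> nat -> Q, [/\ forall i, K i i = 0, forall i j, K i j = - K j i
    & forall i, (i < size y)%N -> a i = \sum_(j < size y) K i j * y`_j].
Proof.
move=> [reg _]; have main l : (l <= size y)%N -> forall a : nat -> Q, \sum_(i < l) a i * y`_i = 0 ->
    exists K : nat -> nat -> Q, [/\ forall i, K i i = 0, forall i j, K i j = - K j i
    & forall i, (i < l)%N -> a i = \sum_(j < l) K i j * y`_j]; last exact: main (leqnn _) a.
elim: l => [_ b _|l IH ly b].
  by exists (fun _ _ => 0); split=> // *; rewrite oppr0.
rewrite big_ord_recr /= => bS.
have [c cE] : in_idl (take l y) (b l).
  apply: (reg _ ly); exists (fun i => - b i); rewrite size_takel ?(ltnW ly) //.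
  move/eqP: bS; rewrite addrC addr_eq0 => /eqP ->; rewrite -sumrN; apply: eq_bigr => i _.
  by rewrite nth_take ?mulNr.
rewrite size_takel ?(ltnW ly) // in cE.
have [|K [K0 KN KE]] := IH (ltnW ly) (fun i => b i + c i * y`_l).
  rewrite -[RHS]bS cE mulr_suml -big_split /=; apply: eq_bigr => i _.
  by rewrite nth_take // mulrDl mulrAC.
(* Border the smaller skew matrix by the coefficients that express [b l]. *)
exists (fun i j => if (i < l)%N && (j < l)%N then K i j else
   if (i < l)%N && (j == l) then - c i else if (i == l) && (j < l)%N then c j else 0).
split.
- by move=> i; case: ltngtP => //=; rewrite ?K0.
- move=> i j; case: (ltngtP i l) => hi; case: (ltngtP j l) => hj //=; rewrite ?opprK ?oppr0 //.
move=> i; rewrite ltnS leq_eqVlt big_ord_recr /= ltnn eqxx andbF andbT => /orP[/eqP ->|il].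
  rewrite ltnn eqxx /= mul0r addr0 cE; apply: eq_bigr => j _.
  by rewrite ltn_ord nth_take.
rewrite il /= mulNr; apply/eqP; rewrite -subr_eq opprK KE //; apply/eqP.
by apply: eq_bigr => j _; rewrite ltn_ord.
Qed.

End KoszulBound.

(** * Quadric relations in a quotient of a regular local ring *)

Section QuadricRelations.
Variables (k : fieldType) (A : comFalgType k) (A1 A2 A3 : {vspace A}).
Variables (c0 : 'Hom(A, k^o)) (q1 q2 q3 : 'End(A)).
Hypothesis gd : graded_duality A1 A2 A3 c0 q1 q2 q3.
Variables (Q : comNzRingType) (y f : seq Q) (phi : {rmorphism Q -> A}).
Variable rho : {rmorphism Q -> k}.
Hypothesis rhoE : forall q, rho q = c0 (phi q).
Hypothesis rho0 : forall q, rho q = 0 <-> in_idl y q.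
Hypothesis yreg : regular_seq y.
Hypothesis fy : forall i, (i < size f)%N -> in_idl y f`_i.
Hypothesis surj : forall a, exists q, phi q = a.
Hypothesis kerf : forall q, phi q = 0 -> in_idl f q.
Hypothesis kerf0 : forall i, (i < size f)%N -> phi f`_i = 0.
Local Notation d := (size y).
Local Notation c := (size f).
Local Notation n := (\dim A1).
Local Notation m := (gd_max A1 A2 A3).

Let Y : 'cV[Q]_d := \col_i y`_i.
Let F : 'cV[Q]_c := \col_i f`_i.
Local Notation rmx M := (map_mx rho M).

Lemma idl_rowP s (x : Q) : in_idl s x ->
  exists a : 'rV[Q]_(size s), x%:M = a *m (\col_(i < size s) s`_i) :> 'M_1.
Proof.
case=> a ->; exists (\row_i a i); apply/matrixP => i j; rewrite !mxE !ord1 eqxx mulr1n.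
by apply: eq_bigr => l _; rewrite !mxE.
Qed.

Lemma idl_colP p (g : 'cV[Q]_p) : rmx g = 0 -> exists H : 'M[Q]_(p, d), g = H *m Y.
Proof.
move=> g0; have /rows_choice[H hH] : forall i : 'I_p, exists a : 'rV[Q]_d, (g i 0)%:M = a *m Y :> 'M_1.
  by move=> i; apply/idl_rowP/rho0; have /matrixP/(_ i 0) := g0; rewrite !mxE.
exists H; apply/row_matrixP => i; rewrite row_mul -hH.
by apply/matrixP => a b; rewrite !mxE !ord1 eqxx mulr1n.
Qed.

Lemma rho_lift p q (M : 'M[k]_(p, q)) : exists N, rmx N = M.
Proof.
have /fin_all_exists[g hg] : forall ij : 'I_p * 'I_q, exists x, rho x = M ij.1 ij.2.
  move=> ij; have [x hx] := surj (in_alg A (M ij.1 ij.2)); exists x.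
  by rewrite rhoE hx (gd_c0_alg gd).
by exists (\matrix_(i, j) g (i, j)); apply/matrixP => i j; rewrite !mxE hg.
Qed.

Lemma rmxY : rmx Y = 0.
Proof.
apply/matrixP => i j; rewrite !mxE; apply/rho0.
by have [_ _ _ h] := in_idl_ideal y; apply: h.
Qed.

Lemma syz_lin (a : 'rV[Q]_d) : a *m Y = 0 -> rmx a = 0.
Proof.
move=> aY; case: (posnP d) => [d0|d0]; first by apply/rowP => i; have := ltn_ord i; rewrite [X in (_ < X)%N]d0.
have aS : \sum_(i < d) a 0 (insubd (Ordinal d0) (val i)) * y`_i = 0.
  move/matrixP/(_ 0 0): aY; rewrite !mxE => h; rewrite -[RHS]h.
  by apply: eq_bigr => i _; rewrite mxE valKd.
have [K [_ _ hK]] := regular_seq_syzygies (a := fun i => a 0 (insubd (Ordinal d0) i)) yreg aS.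
apply/rowP => i; rewrite !mxE; apply/rho0; have := hK i (ltn_ord i).
by rewrite valKd => ->; exists (K i).
Qed.

(** Quasi-regularity in degree 2. The form L - L^T means alternating, with zero diagonal, also in
    characteristic 2. *)
Lemma syz_quad (M : 'M[Q]_d) : Y^T *m M *m Y = 0 -> exists L, rmx M = L - L^T.
Proof.
move=> YMY; case: (posnP d) => [d0|d0].
  by exists 0; apply/matrixP => i; have := ltn_ord i; rewrite [X in (_ < X)%N]d0.
pose I (i : nat) : 'I_d := insubd (Ordinal d0) i.
have valI (i : 'I_d) : I i = i by rewrite /I valKd.
have aS : \sum_(i < d) (Y^T *m M) 0 (I i) * y`_i = 0.
  move/matrixP/(_ 0 0): YMY; rewrite !mxE => h; rewrite -[RHS]h.
  by apply: eq_bigr => i _; rewrite valI mxE [Y i 0]mxE.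
have [K [K0 KN hK]] := regular_seq_syzygies (a := fun i => (Y^T *m M) 0 (I i)) yreg aS.
exists (\matrix_(i, j) if (i < j)%N then rho (K j i) else 0).
have E (i j : 'I_d) : rho (M i j) = rho (K j i).
  have : rmx (\row_l (M l j - K j l)) = 0.
    apply: syz_lin; apply/matrixP => a b; rewrite !mxE.
    have := hK j (ltn_ord j); rewrite valI mxE => h.
    transitivity (\sum_l Y^T 0 l * M l j - \sum_(l < d) K j l * y`_l); last by rewrite h subrr.
    rewrite -sumrB; apply: eq_bigr => l _; rewrite !mxE mulrBl; congr (_ - _).
    by rewrite mulrC.
  by move/rowP/(_ i); rewrite !mxE raddfB => /eqP; rewrite subr_eq0 => /eqP.
apply/matrixP => i j; rewrite !mxE E; case: ltngtP => [ij|ij|/val_inj ->].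
- by rewrite subr0.
- by rewrite sub0r KN raddfN.
- by rewrite K0 raddf0 subrr.
Qed.

Lemma phi_max q : phi q \in m <-> in_idl y q.
Proof. by rewrite -rho0 rhoE; split=> [/(gd_maxP gd)|h]; last apply/(gd_maxP gd). Qed.

Lemma phi_lin x : x \in m -> exists a : 'rV[Q]_d, x = phi ((a *m Y) 0 0).
Proof.
have [q <-] := surj x; move/phi_max/idl_rowP => [a ha]; exists a.
by rewrite -/Y in ha; rewrite -ha mxE.
Qed.

Lemma phi_quad x : x \in (A2 + A3)%VS -> exists M : 'M[Q]_d, x = phi ((Y^T *m M *m Y) 0 0).
Proof.
rewrite -(gd_max2 gd); move: x.
apply: (@prodv_ind _ _ m m (fun x => exists M : 'M[Q]_d, x = phi ((Y^T *m M *m Y) 0 0))).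
- by exists 0; rewrite mulmx0 mul0mx mxE raddf0.
- move=> u v [M ->] [N ->]; exists (M + N).
  by rewrite mulmxDr mulmxDl [X in _ = phi X]mxE raddfD.
- move=> b u [M ->]; have [q hq] := surj (in_alg A b); exists (q *: M).
  by rewrite -scalemxAr -scalemxAl [X in _ = phi X]mxE rmorphM hq /= -scalerAl mul1r.
- move=> u v /phi_lin[a ->] /phi_lin[b ->]; exists (a^T *m b).
  rewrite -rmorphM; congr (phi _); rewrite !mulmxA -trmx_mul -mulmxA [RHS]mxE big_ord1.
  by rewrite [(_ ^T) 0 0]mxE.
Qed.

(** Cubics are written as quadratic forms with coefficients in the maximal ideal, so that reduction
    by [rho] kills them. *)
Lemma phi_cubic x : x \in A3 -> exists2 N : 'M[Q]_d, rmx N = 0 & x = phi ((Y^T *m N *m Y) 0 0).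
Proof.
move/(subvP (gd_gen3 gd)); move: x.
apply: (@prodv_ind _ _ A1 A2 (fun x =>
  exists2 N : 'M[Q]_d, rmx N = 0 & x = phi ((Y^T *m N *m Y) 0 0))).
- by exists 0; rewrite ?map_mx0 // mulmx0 mul0mx mxE raddf0.
- move=> u v [M M0 ->] [N N0 ->]; exists (M + N); first by rewrite map_mxD M0 N0 addr0.
  by rewrite mulmxDr mulmxDl [X in _ = phi X]mxE raddfD.
- move=> b u [M M0 ->]; have [q hq] := surj (in_alg A b); exists (q *: M).
    by rewrite map_mxZ M0 scaler0.
  by rewrite -scalemxAr -scalemxAl [X in _ = phi X]mxE rmorphM hq /= -scalerAl mul1r.
- move=> u v u1 v2; have [q hq] := surj u.
  have q0 : rho q = 0 by rewrite rhoE hq; have [] := gd_A1 gd u1.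
  have [M ->] := phi_quad (subvP (addvSl A2 A3) _ v2); exists (q *: M).
    by rewrite map_mxZ /= q0 scale0r.
  by rewrite -scalemxAr -scalemxAl [X in _ = phi X]mxE rmorphM hq.
Qed.

Lemma phi_ker x : phi x = 0 -> exists g : 'rV[Q]_c, x%:M = g *m F :> 'M_1.
Proof. by move/kerf/idl_rowP. Qed.

Let X := vbasis A1.
Definition lin_coord (x : Q) : 'rV[k]_n := \row_j coord X j (q1 (phi x)).
(** The classes of the y_i in the basis [X] of m / m^2. The presentation may be non-minimal: [d]
    exceeds [n] when elements of [f] have linear terms. *)
Let Th : 'M[k]_(d, n) := \matrix_i lin_coord y`_i.

Lemma lin_coord_comb (a : 'rV[Q]_d) : lin_coord ((a *m Y) 0 0) = rmx a *m Th.
Proof.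
apply/rowP => j; rewrite !mxE raddf_sum !linear_sum; apply: eq_bigr => i _.
rewrite !mxE /= rmorphM (gd_q1M gd); last first.
  by apply/phi_max; have [_ _ _ h] := in_idl_ideal y; apply: h.
by rewrite linearZ /= -rhoE.
Qed.

Lemma generators_coord : exists Z : 'M[Q]_(n, d), rmx Z *m Th = 1%:M /\
  forall i, q1 (phi ((Z *m Y) i 0)) = X`_i.
Proof.
have /rows_choice[Z hZ] : forall i : 'I_n, exists a : 'rV[Q]_d, X`_i = phi ((a *m Y) 0 0).
  move=> i; apply: phi_lin; apply: (subvP (gd_A1m A1 A2 A3)).
  by apply/vbasis_mem/mem_nth; rewrite size_tuple.
have XA i : (i < n)%N -> X`_i \in A1.
  by move=> h; apply/vbasis_mem/mem_nth; rewrite size_tuple.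
exists Z; split; last first.
  move=> i; have -> : (Z *m Y) i 0 = (row i Z *m Y) 0 0 by rewrite -row_mul [RHS]mxE.
  by rewrite -hZ; have [_ -> _ _] := gd_A1 gd (XA _ (ltn_ord i)).
apply/row_matrixP => i; rewrite row_mul -map_row -lin_coord_comb.
apply/rowP => j; rewrite ![LHS]mxE -hZ ![RHS]mxE; have [_ -> _ _] := gd_A1 gd (XA _ (ltn_ord i)).
by rewrite coord_free ?(basis_free (vbasisP A1)).
Qed.

Lemma idl_matrix : exists B : 'M[Q]_(c, d), F = B *m Y.
Proof.
apply: idl_colP; apply/matrixP => i j; rewrite !mxE; apply/rho0/fy.
exact: ltn_ord.
Qed.

Section Fixed.
Variables (Z : 'M[Q]_(n, d)) (B : 'M[Q]_(c, d)).
Hypothesis ZTh : rmx Z *m Th = 1%:M.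
Hypothesis ZX : forall i, q1 (phi ((Z *m Y) i 0)) = X`_i.
Hypothesis FB : F = B *m Y.
Local Notation s := (rmx B).

Lemma sTh : s *m Th = 0.
Proof.
apply/row_matrixP => i; rewrite row_mul -map_row -lin_coord_comb linear0.
have -> : (row i B *m Y) 0 0 = f`_i.
  by rewrite -row_mul -FB !mxE.
by apply/rowP => j; rewrite !mxE kerf0 ?linear0.
Qed.

(** An element of (y) with zero class in m / m^2 lies in (y)^2 + (f), so its linear coefficients lie
    in the row space of [s]. Thus the kernel of [Th], of dimension at least d - n, lies in that row
    space. *)
Lemma s_rank : (d <= \rank s + n)%N.
Proof.
have H : (kermx Th <= s)%MS.
  apply/row_subP => i; set sg := row i _.
  have sg0 : sg *m Th = 0 by rewrite -row_mul mulmx_ker linear0.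
  have [a aE] := rho_lift sg; pose x := (a *m Y) 0 0.
  have x1 : q1 (phi x) = 0.
    have : lin_coord x = 0 by rewrite lin_coord_comb aE.
    move=> h; have [q1A _ _] := gd_in gd (phi x).
    rewrite (coord_vbasis q1A) big1 // => j _.
    by move/rowP/(_ j): h; rewrite !mxE => ->; rewrite scale0r.
  have x0 : c0 (phi x) = 0.
    rewrite -rhoE; apply/rho0; exists (fun i => \sum_(j < d | val j == i) a 0 j).
    rewrite /x mxE; apply: eq_bigr => j _; rewrite mxE; congr (_ * _).
    rewrite (bigD1 j) //= big1 ?addr0 // => l /andP[/eqP h]; case/eqP; exact: val_inj.
  have [M hM] := phi_quad (introT (gd_A23P gd (phi x)) (conj x0 x1)).
  have [|g hg] := @phi_ker (x - (Y^T *m M *m Y) 0 0); first by rewrite raddfB /= hM subrr.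
  have E : (a - Y^T *m M - g *m B) *m Y = 0.
    rewrite !mulmxBl -[g *m B *m Y]mulmxA -FB -hg; apply/matrixP => u v.
    by rewrite !ord1 /x !mxE eqxx mulr1n subrr.
  have := syz_lin E; rewrite !map_mxB !map_mxM -map_trmx rmxY trmx0 mul0mx subr0 aE.
  by move/eqP; rewrite subr_eq0 => /eqP ->; apply: submxMl.
have := mxrankS H; rewrite mxrank_ker.
have := rank_leq_col Th; have := rank_leq_row Th; lia.
Qed.

Definition upair := {p : 'I_n * 'I_n | (p.1 <= p.2)%N}.
Local Notation S := #|{: upair}|.

(** Quadratic forms as upper triangular matrices, which are unique in every characteristic. *)
Definition umx (r : 'rV[k]_S) : 'M[k]_n :=
  \matrix_(i, j) \sum_(l < S) r 0 l *+ (val (enum_val l : upair) == (i, j)).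

Lemma umx_tri r (i j : 'I_n) : (j < i)%N -> umx r i j = 0.
Proof.
move=> ji; rewrite mxE big1 // => l _; case: eqP => // e.
by have := valP (enum_val l : upair); rewrite e leqNgt ji.
Qed.

Lemma umx_inj r : umx r = 0 -> r = 0.
Proof.
move=> h; apply/rowP => l; set p := val (enum_val l : upair).
have := congr1 (fun M : 'M_n => M p.1 p.2) h; rewrite !mxE (bigD1 l) //= -surjective_pairing eqxx mulr1n.
rewrite big1 ?addr0 // => l' ne; case: eqP => // /val_inj/enum_val_inj e.
by rewrite e eqxx in ne.
Qed.

Lemma umxD r r' : umx (r + r') = umx r + umx r'.
Proof.
apply/matrixP => i j; rewrite !mxE -big_split; apply: eq_bigr => l _.
by rewrite mxE mulrnDl.
Qed.

Lemma umxZ b r : umx (b *: r) = b *: umx r.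
Proof.
apply/matrixP => i j; rewrite !mxE mulr_sumr; apply: eq_bigr => l _.
by rewrite mxE mulrnAr.
Qed.

(* The quadric with coefficients umx r lifts to an element of (f), up to
   cubics, with coefficients reducing to ga. *)
Definition quad_rel (r : 'rV[k]_S) (ga : 'rV[k]_c) :=
  exists (a : 'M[Q]_n) (g : 'rV[Q]_c) (N : 'M[Q]_d),
    [/\ rmx a = umx r, rmx g = ga, rmx N = 0
      & (Z *m Y)^T *m a *m (Z *m Y) = g *m F + Y^T *m N *m Y].

Lemma quad_relD r ga r' ga' : quad_rel r ga -> quad_rel r' ga' -> quad_rel (r + r') (ga + ga').
Proof.
move=> [a [g [N [h1 h2 h3 h4]]]] [a' [g' [N' [h1' h2' h3' h4']]]].
exists (a + a'), (g + g'), (N + N'); rewrite !map_mxD h1 h1' h2 h2' h3 h3' umxD addr0; split=> //.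
by rewrite !(mulmxDr, mulmxDl) h4 h4' addrACA.
Qed.

Lemma quad_relZ b r ga : quad_rel r ga -> quad_rel (b *: r) (b *: ga).
Proof.
move=> [a [g [N [h1 h2 h3 h4]]]]; have [q hq] := surj (in_alg A b).
have rq : rho q = b by rewrite rhoE hq (gd_c0_alg gd).
exists (q *: a), (q *: g), (q *: N); rewrite !map_mxZ /= h1 h2 h3 rq umxZ scaler0; split=> //.
by rewrite -!(scalemxAr, scalemxAl) h4 scalerDr.
Qed.

Lemma quad_rel0 : quad_rel 0 0.
Proof.
exists 0, 0, 0; rewrite !map_mx0; split=> //; last by rewrite !(mulmx0, mul0mx) addr0.
by apply/matrixP => i j; rewrite !mxE big1 // => l _; rewrite mxE mul0rn.
Qed.

Lemma quad_rel_comb p (x : 'rV[k]_p) (R : 'M_(p, S)) (Ga : 'M_(p, c)) :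
  (forall i, quad_rel (row i R) (row i Ga)) -> quad_rel (x *m R) (x *m Ga).
Proof.
move=> h; rewrite !mulmx_sum_row; elim/big_ind2: _ => [|? ? ? ?|i _].
- exact: quad_rel0.
- exact: quad_relD.
- exact: quad_relZ.
Qed.

(** Compare the terms linear in the y_i: the quadric and the cubic contribute none. *)
Lemma quad_rel_s r ga : quad_rel r ga -> ga *m s = 0.
Proof.
move=> [a [g [N [h1 h2 h3 h4]]]].
have E : (Y^T *m (Z^T *m a *m Z) - g *m B - Y^T *m N) *m Y = 0.
  by rewrite !mulmxBl -[g *m B *m Y]mulmxA -FB -!mulmxA !mulmxA -trmx_mul -!mulmxA mulmxA h4 !mulmxA addrAC addrK subrr.
have := syz_lin E; rewrite !map_mxB !map_mxM -map_trmx rmxY trmx0 !mul0mx subr0 sub0r h2.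
by move/eqP; rewrite oppr_eq0 => /eqP.
Qed.

(** If [ga] is 0, the coefficients on [f] lie in (y). Pulled back along [Th], which kills [s], the
    relation makes [umx r] alternating; being upper triangular, it is 0. *)
Lemma quad_rel_inj r : quad_rel r 0 -> r = 0.
Proof.
move=> [a [g [N [h1 h2 h3 h4]]]].
have [|H gH] := @idl_colP _ g^T; first by rewrite -map_trmx h2 trmx0.
have gE : g = Y^T *m H^T by rewrite -trmx_mul -gH trmxK.
have E : Y^T *m (Z^T *m a *m Z - H^T *m B - N) *m Y = 0.
  rewrite !mulmxBr !mulmxBl !mulmxA -gE -[g *m B *m Y]mulmxA -FB -trmx_mul.
  by rewrite -[_ *m Z *m Y]mulmxA h4 addrAC addrK subrr.
have [L hL] := syz_quad E.
have aE : umx r = Th^T *m L *m Th - (Th^T *m L *m Th)^T.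
  rewrite !trmx_mul trmxK mulmxA -mulmxBl -mulmxBr -hL !map_mxB !map_mxM h3 subr0 h1.
  rewrite mulmxBr mulmxBl !mulmxA -[_ *m s *m Th]mulmxA sTh mulmx0 subr0.
  rewrite -map_trmx -trmx_mul ZTh trmx1 mul1mx -[_ *m _ *m Th]mulmxA ZTh mulmx1.
  by [].
move: (Th^T *m L *m Th) aE => P aE.
apply: umx_inj; apply/matrixP => i j; rewrite [RHS]mxE.
have D i' j' : umx r i' j' = - umx r j' i' by rewrite aE !mxE opprB.
case: (ltngtP i j) => [ij|/umx_tri //|/val_inj ->].
  by rewrite D umx_tri ?oppr0.
by rewrite aE !mxE subrr.
Qed.

Definition quad_mx : 'M[k]_(S, \dim A2) :=
  \matrix_(l, j) coord (vbasis A2) j (X`_(val (enum_val l : upair)).1 * X`_(val (enum_val l : upair)).2).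

(** The lift of such a quadric is mapped into A3, where it agrees with the image of a cubic; the
    difference lies in (f). *)
Lemma quad_rel_exists r : r *m quad_mx = 0 -> exists ga, quad_rel r ga.
Proof.
move=> r0; have [a ha] := rho_lift (umx r).
pose x := ((Z *m Y)^T *m a *m (Z *m Y)) 0 0.
have XA (i : 'I_n) : X`_i \in A1 by apply/vbasis_mem/mem_nth; rewrite size_tuple.
have zm i : phi ((Z *m Y) i 0) \in m.
  apply/phi_max/rho0; have := map_mxM rho Z Y; rewrite rmxY mulmx0.
  by move/matrixP/(_ i 0); rewrite !mxE.
have xE : phi x = \sum_j \sum_i phi (a i j) * (phi ((Z *m Y) i 0) * phi ((Z *m Y) j 0)).
  rewrite /x mxE raddf_sum; apply: eq_bigr => j _; rewrite /= rmorphM mxE raddf_sum mulr_suml.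
  apply: eq_bigr => i _; rewrite [(_^T)%R _ _]mxE /= rmorphM mulrA; congr (_ * _).
  exact: mulrC.
have term i j (u := phi (a i j) * (phi ((Z *m Y) i 0) * phi ((Z *m Y) j 0))) :
    [/\ c0 u = 0, q1 u = 0 & q2 u = umx r i j *: (X`_i * X`_j)].
  have /(gd_maxP gd) zi := zm i; have /(gd_maxP gd) zj := zm j.
  have [e0 e1 e2 _] := gd_mul_parts gd (phi ((Z *m Y) i 0)) (phi ((Z *m Y) j 0)).
  have [f0 f1 f2 _] := gd_mul_parts gd (phi (a i j)) (phi ((Z *m Y) i 0) * phi ((Z *m Y) j 0)).
  rewrite zi zj ?mulr0 ?scale0r ?addr0 ?add0r in e0 e1 e2.
  rewrite -/u e0 e1 e2 mulr0 scaler0 scale0r addr0 mulr0 !ZX -rhoE scale0r !addr0 in f0 f1 f2.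
  by split=> //; rewrite f2 -ha mxE.
have [x0 x1] : c0 (phi x) = 0 /\ q1 (phi x) = 0.
  by rewrite xE !linear_sum; split; rewrite big1 // => j _; rewrite linear_sum big1 // => i _;
    have [] := term i j.
have x2 : q2 (phi x) = 0.
  have -> : q2 (phi x) = \sum_(l < S) r 0 l *: (X`_(val (enum_val l : upair)).1 * X`_(val (enum_val l : upair)).2).
    rewrite xE linear_sum.
    transitivity (\sum_(j < n) \sum_(i < n) \sum_(l < S) (r 0 l *+ (val (enum_val l : upair) == (i, j))) *: (X`_i * X`_j)).
      apply: eq_bigr => j _; rewrite linear_sum; apply: eq_bigr => i _.
      have [_ _ h] := term i j; apply: etrans h _; rewrite mxE scaler_suml.
      by [].
    under eq_bigr do rewrite exchange_big.
    rewrite exchange_big; apply: eq_bigr => l _; set p := val _.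
    rewrite (bigD1 p.2) //= [X in _ + X]big1 ?addr0 => [|j jp].
      rewrite (bigD1 p.1) //= big1 ?addr0 => [|i ip]; first by rewrite -surjective_pairing eqxx.
      by case: eqP => [e|]; [rewrite e eqxx in ip | rewrite mulr0n scale0r].
    rewrite big1 // => i _.
    by case: eqP => [e|]; [rewrite e eqxx in jp | rewrite mulr0n scale0r].
  set w := \sum_(l < S) _.
  have wA : w \in A2 by rewrite rpred_sum // => l _; rewrite rpredZ ?(gd_11 gd).
  rewrite (coord_vbasis wA) big1 // => j _.
  have -> : coord (vbasis A2) j w = (r *m quad_mx) 0 j.
    rewrite /w linear_sum mxE; apply: eq_bigr => l _.
    by rewrite linearZ mxE.
  by rewrite r0 mxE scale0r.
have x3 : phi x \in A3.
  rewrite (gd_dec gd (phi x)) x0 x1 x2 rmorph0 !add0r.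
  by have [] := gd_in gd (phi x).
have [N N0 NE] := phi_cubic x3.
have [|g hg] := @phi_ker (x - (Y^T *m N *m Y) 0 0); first by rewrite raddfB /= NE subrr.
exists (rmx g), a, g, N; split=> //.
by rewrite -hg; apply/matrixP => u v; rewrite !ord1 /x [RHS]mxE [_%:M _ _]mxE eqxx mulr1n subrK.
Qed.

(** The quadric relations of A, at least S - dim A2 of them, inject into the left kernel of [s]. *)
Lemma quad_count : (S <= c - \rank s + \dim A2)%N.
Proof.
have /fin_all_exists[ga hga] : forall i : 'I_S, exists ga, quad_rel (row i (kermx quad_mx)) ga.
  by move=> i; apply: quad_rel_exists; rewrite -row_mul mulmx_ker linear0.
pose Ga : 'M[k]_(S, c) := \matrix_i ga i.
have hG i : quad_rel (row i (kermx quad_mx)) (row i Ga) by rewrite rowK.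
have Gs : Ga *m s = 0.
  by apply/row_matrixP => i; rewrite row_mul linear0; apply: quad_rel_s (hG i).
have r1 : (\rank Ga <= c - \rank s)%N.
  by rewrite -mxrank_ker; apply/mxrankS/sub_kermxP.
have r2 : (\rank (kermx quad_mx) <= \rank Ga)%N.
  have H : (kermx Ga <= kermx (kermx quad_mx))%MS.
    apply/row_subP => i; apply/sub_kermxP; apply: quad_rel_inj.
    have G0 : row i (kermx Ga) *m Ga = 0 by rewrite -row_mul mulmx_ker linear0.
    by have := quad_rel_comb (row i (kermx Ga)) hG; rewrite G0.
  have := mxrankS H; rewrite !mxrank_ker.
  have := rank_leq_row (kermx quad_mx); have := rank_leq_row Ga; rewrite !mxrank_ker; lia.
have := mxrank_ker quad_mx; have := rank_leq_col quad_mx; lia.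
Qed.

Lemma card_upair : (n * n <= S + S)%N.
Proof.
pose U : {set 'I_n * 'I_n} := [set p : 'I_n * 'I_n | (p.1 <= p.2)%N].
have -> : S = #|U| by rewrite card_sig; apply: eq_card => p; rewrite !inE.
have -> : (n * n = #|{: 'I_n * 'I_n}|)%N by rewrite card_prod !card_ord.
rewrite -cardsT -(cardsID U setT) setTI setTD leq_add2l.
pose sw (p : 'I_n * 'I_n) := (p.2, p.1).
have sw_inj : injective sw by case=> a b [a' b'] [-> ->].
rewrite -(card_imset _ sw_inj); apply/subset_leq_card/subsetP => _ /imsetP[[a b] h ->].
by move: h; rewrite !inE /= -ltnNge => /ltnW.
Qed.

End Fixed.

(** n^2 <= 2 S <= 2 (c - rank s + n) <= 4 n, as c <= d <= rank s + n. *)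
Lemma quadric_bound : (c <= d)%N -> \dim A2 = n -> (n <= 4)%N.
Proof.
move=> cd d2; have [Z [ZTh ZX]] := generators_coord; have [B FB] := idl_matrix.
have := quad_count ZTh ZX FB; have := s_rank FB; have := card_upair.
rewrite d2; move: (#|_|) (\rank _) => S r h1 h2 h3.
by move: h1 h2 h3 cd; clear; nia.
Qed.

End QuadricRelations.

Section NotCompleteIntersection.
Variables (k : fieldType) (A : comFalgType k) (A1 A2 A3 : {vspace A}).
Variables (c0 : 'Hom(A, k^o)) (q1 q2 q3 : 'End(A)).
Hypothesis gd : graded_duality A1 A2 A3 c0 q1 q2 q3.

Lemma gd_not_complete_intersection : \dim A1 = \dim A2 -> (4 < \dim A1)%N ->
  ~ complete_intersection A.
Proof.
move=> d12 n5 [Q [f [phi [[_ [y [yreg yloc]]] freg surj ker]]]].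
have f1 : ~ in_idl f 1 by case: freg.
have y1 : ~ in_idl y 1 by case: yreg.
have [f0 fD fM fi] := in_idl_ideal f; have [y0 yD yM yi] := in_idl_ideal y.
have fy x : in_idl f x -> in_idl y x.
  move=> fx; apply: boolp.contrapT => /yloc[u ux]; apply: f1; rewrite -ux; exact: fM.
(* The residue map of A pulled back to Q has kernel (y), so Q and A share the residue field k. *)
pose r (q : Q) : k := c0 (phi q).
have rB : zmod_morphism r by move=> a b; rewrite /r !raddfB.
have rM : monoid_morphism r.
  split=> [|a b]; first by rewrite /r rmorph1; case: (gd_one gd).
  by rewrite /r rmorphM; have [] := gd_mul_parts gd (phi a) (phi b).
pose rho : {rmorphism Q -> k} := HB.pack r (GRing.isZmodMorphism.Build Q k r rB)
  (GRing.isMonoidMorphism.Build Q k r rM).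
have rho0 q : rho q = 0 <-> in_idl y q.
  split=> [q0|yq].
    apply: boolp.contrapT => /yloc[u uq].
    have : rho (u * q) = 1 by rewrite uq rmorph1.
    by rewrite rmorphM q0 mulr0 => /eqP; rewrite eq_sym oner_eq0.
  apply/eqP; apply: contraT => q0.
  have uq : phi q \is a GRing.unit by apply: (gd_unit gd).
  have [u hu] := surj (phi q)^-1.
  have : phi (u * q - 1) = 0 by rewrite rmorphB rmorphM rmorph1 hu mulVr ?subrr.
  move/ker/fy => h; case: y1.
  have -> : 1 = u * q + - 1 * (u * q - 1) by rewrite mulN1r opprB addrC subrK.
  by apply: yD; apply: yM.
have fyi i : (i < size f)%N -> in_idl y f`_i by move=> h; apply/fy/fi.
(* A lift of a generator of the socle A3 is the [u] required by [regular_seq_size]. *)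
have cd : (size f <= size y)%N.
  have [w w3 w0] : exists2 w, w \in A3 & w != 0.
    exists (vpick A3); first exact: memv_pick.
    by rewrite vpick0 -dimv_eq0 (gd_dim3 gd).
  have [u hu] := surj w; apply: (regular_seq_size freg fyi (u := u)).
    by move/ker; rewrite hu => /eqP; rewrite (negbTE w0).
  move=> i iy; apply/ker; rewrite rmorphM hu.
  have : phi y`_i \in gd_max A1 A2 A3.
    by apply/(gd_maxP gd)/(rho0 y`_i)/yi.
  move=> h; have := memv_mul h w3; rewrite (gd_max4 gd) memv0 mulrC => /eqP.
  by [].
have := quadric_bound gd (rho := rho) (fun=> erefl) rho0 yreg fyi surj (fun q => (ker q).1)
  (fun i h => (ker _).2 (fi i h)) cd (esym d12).
lia.
Qed.

End NotCompleteIntersection.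

(** * Linear strands over the trivial extension *)

Section StrandComparison.
Variables (k : fieldType) (A : comFalgType k) (A1 : {vspace A}).
Local Notation kmx := (kmx A).
Local Notation kbasis := (kbasis A1).

Definition kindep p r (M : 'M[A]_(p, r)) := forall x : 'rV[k]_p, kmx x *m M = 0 -> x = 0.

Lemma kindep_kbasis p r (M : 'M[A]_(p, r)) : kindep (kbasis M).
Proof. by move=> x; apply: kbasis_free. Qed.

Lemma kindep_free m p r (M : 'M[A]_(p, r)) (X : 'M[k]_(m, p)) :
  (forall x : 'rV[k]_m, kmx (x *m X) *m M = 0 -> x = 0) -> row_free X.
Proof.
move=> h; rewrite -kermx_eq0; apply/eqP/row_matrixP => i; rewrite linear0; apply: h.
by rewrite -row_mul mulmx_ker linear0 kmx0 mul0mx.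
Qed.

Definition betti p r (M : 'M[A]_(p, r)) i := srows (strand A1 (Stage M) i).

Lemma betti0 p r (M : 'M[A]_(p, r)) : betti M 0 = p. Proof. by []. Qed.
Lemma betti1 p r (M : 'M[A]_(p, r)) : betti M 1 = kdim A1 M. Proof. by []. Qed.
Lemma bettiS p r (M : 'M[A]_(p, r)) i : betti M i.+1 = betti (kbasis M) i.
Proof. by rewrite /betti -strand_nextE. Qed.

(* The row spaces of M', M, M'' over k form a complex, compatible with maps
   k^r' -> k^r -> k^r'' of which the first is injective, exact in the middle. *)
Definition tri p' r' p r p'' r'' (M' : 'M[A]_(p', r')) (M : 'M[A]_(p, r))
    (M'' : 'M[A]_(p'', r'')) :=
  exists (P : 'M[k]_(r, r'')) (B : 'M[k]_(r', r)),
  [/\ row_free B, forall x : 'rV[k]_r, x *m P = 0 -> (x <= B)%MS,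
      exists C, M *m kmx P = kmx C *m M'', exists C, M' *m kmx B = kmx C *m M
    & forall c : 'rV[k]_p, kmx c *m M *m kmx P = 0 -> exists c', kmx c *m M = kmx c' *m M' *m kmx B].

Lemma tri_cols p' r' p r p'' r'' (M' : 'M[A]_(p', r')) (M : 'M[A]_(p, r))
  (M'' : 'M[A]_(p'', r'')) : tri M' M M'' -> (r <= r' + r'')%N.
Proof.
case=> P [B [fB kP _ _ _]].
have : (kermx P <= B)%MS.
  by apply/row_subP => i; apply: kP; rewrite -row_mul mulmx_ker linear0.
move/mxrankS; rewrite mxrank_ker (eqP fB); have := rank_leq_col P; lia.
Qed.

(** Taking linear syzygies turns the row maps [C] and [C'] into the next column maps; exactness in
    the middle is [kmx_ker_factor] followed by cancelling the injective map [B]. *)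
Lemma tri_next p' r' p r p'' r'' (M' : 'M[A]_(p', r')) (M : 'M[A]_(p, r))
    (M'' : 'M[A]_(p'', r'')) : kindep M' -> kindep M ->
  tri M' M M'' -> tri (kbasis M') (kbasis M) (kbasis M'').
Proof.
move=> iM' iM [P [B [fB kP [C MC] [C' MC'] mid]]]; exists C, C'.
have fC' : row_free C'.
  apply: (@kindep_free _ _ _ M) => x; rewrite kmxM -mulmxA -MC' mulmxA.
  by move/(kmx_free_inj fB)/iM'.
have kC (x : 'rV[k]_p) : x *m C = 0 -> (x <= C')%MS.
  move=> xC; have [|c' hc'] := mid x; first by rewrite -mulmxA MC mulmxA -kmxM xC kmx0 mul0mx.
  have : kmx (x - c' *m C') *m M = 0.
    rewrite kmxD (_ : kmx (- _) = - kmx (c' *m C')); last by rewrite /kmx map_mxN.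
    by rewrite mulmxDl mulNmx kmxM hc' -!mulmxA MC' subrr.
  by move/iM/eqP; rewrite subr_eq0 => /eqP ->; apply: submxMl.
split=> //.
- apply: kbasisPmx; first exact/entries_in_kmxr/kbasis_entries.
  by rewrite -mulmxA -MC mulmxA kbasisM mul0mx.
- apply: kbasisPmx; first exact/entries_in_kmxr/kbasis_entries.
  by rewrite -mulmxA -MC' mulmxA kbasisM mul0mx.
move=> c cC; have [D hD] := kmx_ker_factor kC cC.
have vA : entries_in A1 (kmx c *m kbasis M *m kmx D).
  exact/entries_in_kmxr/entries_in_kmxl/kbasis_entries.
have [|c' hc'] := kbasisP vA (D := M').
  apply: (kmx_free_inj fB); rewrite -mulmxA MC' mulmxA -hD -mulmxA kbasisM mulmx0 //.
by exists c'; rewrite -hc'.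
Qed.

Lemma tri_betti i : forall p' r' p r p'' r'' (M' : 'M[A]_(p', r')) (M : 'M[A]_(p, r))
    (M'' : 'M[A]_(p'', r'')), kindep M' -> kindep M ->
  tri M' M M'' -> (betti M i <= betti M' i + betti M'' i)%N.
Proof.
elim: i => [|i IH] p' r' p r p'' r'' M' M M'' iM' iM t; have t' := tri_next iM' iM t.
  exact: tri_cols t'.
by rewrite !bettiS; apply: IH => //; apply: kindep_kbasis.
Qed.

Lemma betti_empty p (N : 'M[A]_(0, p)) i : betti N i = 0%N.
Proof.
elim: i p N => [//|i IH] p N; rewrite bettiS.
have : kdim A1 N = 0%N.
  apply/eqP; rewrite /kdim -leqn0; apply: leq_trans (dimvS (capvSl _ _)) _.
  by rewrite dim_pointwise.
by rewrite /kbasis; move: (\matrix_i _) => K; move: K => /[swap] ->.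
Qed.

(** The case of [tri] with nothing on the left. *)
Lemma betti_mono p r p'' (M : 'M[A]_(p, r)) (M'' : 'M[A]_(p'', r)) C i :
  kindep M -> M = kmx C *m M'' -> (betti M i <= betti M'' i)%N.
Proof.
move=> iM MC; rewrite -[betti M'' i]add0n -(betti_empty (0 : 'M[A]_(0, 0)) i); apply: tri_betti => //; first by move=> x _; apply/rowP => -[].
exists 1%:M, 0; split.
- by rewrite /row_free mxrank0.
- by move=> x; rewrite mulmx1 => ->; apply: sub0mx.
- by exists C; rewrite kmx1 mulmx1.
- by exists 0; apply/matrixP => -[].
- by move=> c; rewrite kmx1 mulmx1 => ->; exists 0; rewrite kmx0 !mul0mx.
Qed.

Lemma betti_eq p r p'' (M : 'M[A]_(p, r)) (M'' : 'M[A]_(p'', r)) C C' i :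
  kindep M -> kindep M'' -> M = kmx C *m M'' -> M'' = kmx C' *m M -> betti M i = betti M'' i.
Proof.
move=> iM iM'' h h'; apply/eqP; rewrite eqn_leq.
by rewrite (betti_mono i iM h) (betti_mono i iM'' h').
Qed.

Lemma kmx_row_mx m a b (x : 'M[k]_(m, a)) (y : 'M[k]_(m, b)) :
  kmx (row_mx x y) = row_mx (kmx x) (kmx y).
Proof. by rewrite /kmx map_row_mx. Qed.

Lemma entries_in_row_mx U m a b (x : 'M[A]_(m, a)) (y : 'M[A]_(m, b)) :
  entries_in U (row_mx x y) <-> entries_in U x /\ entries_in U y.
Proof.
split=> [h|[hx hy] i j].
  by split=> i j; [have := h i (lshift b j) | have := h i (rshift a j)];
    rewrite ?row_mxEl ?row_mxEr.
by case: (split_ordP j) => l ->; rewrite ?row_mxEl ?row_mxEr.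
Qed.

Lemma entries_in_col_mx U m a b (x : 'M[A]_(a, m)) (y : 'M[A]_(b, m)) :
  entries_in U x -> entries_in U y -> entries_in U (col_mx x y).
Proof.
by move=> hx hy i j; case: (split_ordP i) => l ->; rewrite ?col_mxEu ?col_mxEd.
Qed.

Lemma entries_in_block U a b c d (x : 'M[A]_(a, b)) (y : 'M[A]_(a, c)) (z : 'M[A]_(d, b))
  (t : 'M[A]_(d, c)) : entries_in U x -> entries_in U y -> entries_in U z -> entries_in U t ->
  entries_in U (block_mx x y z t).
Proof.
by move=> *; apply: entries_in_col_mx; apply/entries_in_row_mx.
Qed.

Lemma kindep_block p r p' r' (M : 'M[A]_(p, r)) (N : 'M[A]_(p', r')) :
  kindep M -> kindep N -> kindep (block_mx M 0 0 N).
Proof.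
move=> iM iN x; rewrite -[x]hsubmxK kmx_row_mx mul_row_block !mulmx0 addr0 add0r -row_mx0.
by case/eq_row_mx => /iM -> /iN ->; rewrite row_mx0.
Qed.

Lemma betti_block i : forall p r p' r' (M : 'M[A]_(p, r)) (N : 'M[A]_(p', r')),
  betti (block_mx M 0 0 N) i = (betti M i + betti N i)%N.
Proof.
elim: i => [//|i IH] p r p' r' M N; rewrite !bettiS -IH.
have [C hC] : exists C, kbasis (block_mx M 0 0 N) = kmx C *m block_mx (kbasis M) 0 0 (kbasis N).
  apply: row_factor => j; set v := row j _.
  have vA : entries_in A1 v by apply/row_entries_in/kbasis_entries.
  have : v *m block_mx M 0 0 N = 0 by rewrite -row_mul kbasisM linear0.
  rewrite -[v]hsubmxK in vA *; have [v1 v2] := (entries_in_row_mx _ _ _).1 vA.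
  rewrite mul_row_block !mulmx0 addr0 add0r -row_mx0 => /eq_row_mx[h1 h2].
  have [x ->] := kbasisP v1 h1; have [y ->] := kbasisP v2 h2.
  by exists (row_mx x y); rewrite kmx_row_mx mul_row_block !mulmx0 addr0 add0r.
have [C' hC'] : exists C, block_mx (kbasis M) 0 0 (kbasis N) = kmx C *m kbasis (block_mx M 0 0 N).
  apply: kbasisPmx.
    by apply: entries_in_block; [exact: kbasis_entries | exact: entries_in0 |
      exact: entries_in0 | exact: kbasis_entries].
  by rewrite mulmx_block !kbasisM !(mulmx0, mul0mx) !addr0 block_mx0.
apply: betti_eq hC hC'; first exact: kindep_kbasis.
by apply: kindep_block; apply: kindep_kbasis.
Qed.

(** A zero row imposes no condition on its coefficient, so it contributes one copy of the strand of
    k. *)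
Lemma betti_col0 p r c (M : 'M[A]_(p, r)) i :
  betti (col_mx M (0 : 'M_(c, r))) i = (betti M i + c * betti (0 : 'M[A]_(1, 0)) i)%N.
Proof.
have -> : betti (col_mx M (0 : 'M_(c, r))) i = betti (block_mx M 0 0 (0 : 'M_(c, 0))) i.
  case: i => [//|i]; rewrite !bettiS.
  have h : forall v : 'rV[A]_(p + c), v *m col_mx M 0 = 0 <-> v *m block_mx M 0 0 (0 : 'M_(c, 0)) = 0.
    move=> v; rewrite -[v]hsubmxK mul_row_col mul_row_block !mulmx0 !addr0 -row_mx0.
    by split=> [->|/eq_row_mx[]//]; congr row_mx; apply/matrixP => ? [].
  have F : forall (q : nat) (X : 'M[A]_(p + c, q)) q' (X' : 'M[A]_(p + c, q')),
      (forall v : 'rV[A]_(p + c), v *m X = 0 -> v *m X' = 0) ->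
      exists C, kbasis X = kmx C *m kbasis X'.
    move=> q X q' X' hX; apply: row_factor => j; apply: kbasisP.
      exact/row_entries_in/kbasis_entries.
    by apply: hX; rewrite -row_mul kbasisM linear0.
  have [C hC] := F _ _ _ _ (fun v => (h v).1); have [C' hC'] := F _ _ _ _ (fun v => (h v).2).
  by apply: betti_eq hC hC'; apply: kindep_kbasis.
rewrite betti_block; congr addn; elim: c => [|c IH]; first by rewrite betti_empty.
have -> : betti (0 : 'M[A]_(c.+1, 0)) i = betti (block_mx (0 : 'M[A]_(1, 0)) 0 0 (0 : 'M_(c, 0))) i.
  by congr (betti _ i); apply/matrixP => ? [].
by rewrite betti_block IH mulSn.
Qed.

End StrandComparison.

Section TrivextStrands.
Variables (k : fieldType) (R : comFalgType k) (R1 R2 : {vspace R}).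
Variables (p0 : 'Hom(R, k^o)) (p1 p2 : 'End(R)).
Hypothesis sh : short_subring R1 R2 p0 p1 p2.
Hypothesis full : fullv = short_carrier R1 R2.
Local Notation T := (trivext R).
Local Notation kmx := (kmx T).
Local Notation TR1 := (TR1 p1).
Local Notation TR2 := (TR2 p2).
Local Notation TE1 := (TE1 p2).
Local Notation TE2 := (TE2 p1).
Local Notation T1 := (T1 p1 p2).
Local Notation bt := (betti T1).
Local Notation rpart M := (map_mx (tr1 p1) M).
Local Notation epart M := (map_mx (te1 p2) M).

Lemma T1_split m n (M : 'M[T]_(m, n)) : entries_in T1 M ->
  [/\ M = rpart M + epart M, entries_in TR1 (rpart M) & entries_in TE1 (epart M)].
Proof.
move=> HM; split=> [|i j|i j]; rewrite ?mxE ?tr1_in ?te1_in //.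
apply/matrixP => i j; rewrite !mxE; have [a [b [a1 b1 ->]]] := T1P (HM i j).
have [_ a2 _ [a3 _ _]] := TR1_parts sh full a1; have [_ b2 _ [b3 _ _]] := TE1_parts sh full b1.
by rewrite !linearD /= a2 a3 b2 b3 addr0 add0r.
Qed.

Lemma TR1_T1 m n (M : 'M[T]_(m, n)) : entries_in TR1 M -> entries_in T1 M.
Proof. by apply: entries_in_sub; apply: addvSl. Qed.
Lemma rpart_TR1 m n (M : 'M[T]_(m, n)) : entries_in TR1 M -> rpart M = M.
Proof.
by move=> HM; apply/matrixP => i j; rewrite !mxE; have [] := TR1_parts sh full (HM i j).
Qed.

Lemma rpart_TE1 m n (M : 'M[T]_(m, n)) : entries_in TE1 M -> rpart M = 0.
Proof.
by move=> HM; apply/matrixP => i j; rewrite !mxE; have [] := TE1_parts sh full (HM i j).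
Qed.

Lemma TE1_TE1 m n p (M : 'M[T]_(m, n)) (N : 'M[T]_(n, p)) :
  entries_in TE1 M -> entries_in TE1 N -> M *m N = 0.
Proof. by apply: entries_inM0 => x y; apply: (TEE0 sh full (TE_sub1 _ _ _) (TE_sub1 _ _ _)). Qed.

Lemma TR1_TE1_sum0 m n (M N : 'M[T]_(m, n)) : entries_in TR1 M -> entries_in TE1 N ->
  M + N = 0 -> M = 0 /\ N = 0.
Proof.
move=> HM HN E; have := congr1 (map_mx (tr1 p1)) E.
rewrite map_mxD map_mx0 (rpart_TR1 HM) (rpart_TE1 HN) addr0 => M0.
by split=> //; move: E; rewrite M0 add0r.
Qed.

Lemma TR2_TE2_sum0 m n (M N : 'M[T]_(m, n)) : entries_in TR2 M -> entries_in TE2 N ->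
  M + N = 0 -> M = 0 /\ N = 0.
Proof.
move=> HM HN E; suff M0 : M = 0 by split=> //; move: E; rewrite M0 add0r.
apply/matrixP => i j; have /matrixP/(_ i j) := E; rewrite !mxE => /(congr1 (tr2 p2)).
rewrite linearD /= linear0; have [_ _ -> _] := TR2_parts sh full (HM i j).
by have [_ _ -> _] := TE2_parts sh full (HN i j); rewrite addr0.
Qed.

Definition eps : 'cV[T]_(\dim TE1) := \col_i (vbasis TE1)`_i.

Lemma eps_TE1 : entries_in TE1 eps.
Proof. by move=> i j; rewrite mxE vbasis_mem // mem_nth // size_tuple. Qed.

Lemma eps_span (x : T) : x \in TE1 -> exists c, x%:M = kmx c *m eps :> 'M_1.
Proof.
move/coord_vbasis => xE; exists (\row_i coord (vbasis TE1) i x).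
apply/matrixP => a b; rewrite !ord1 !mxE eqxx mulr1n {1}xE; apply: eq_bigr => i _.
by rewrite !mxE -scalerAl mul1r.
Qed.

Lemma kindep_eps : kindep eps.
Proof.
move=> x /matrixP/(_ 0 0); rewrite !mxE => h.
have /freeP := basis_free (vbasisP TE1) => /(_ (fun i => x 0 i)) H.
apply/rowP => i; rewrite mxE; apply: H; rewrite -[RHS]h; apply: eq_bigr => j _.
by rewrite !mxE -scalerAl mul1r.
Qed.

Fixpoint erows u : nat := if u is u'.+1 then \dim TE1 + erows u' else 0.
Fixpoint Emx u : 'M[T]_(erows u, u) :=
  if u is u'.+1 then block_mx eps 0 0 (Emx u') : 'M_(_, 1 + u') else 0.

Lemma erowsE u : erows u = (u * \dim TE1)%N.
Proof. by elim: u => //= u ->; rewrite mulSn. Qed.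

Lemma Emx_TE1 u : entries_in TE1 (Emx u).
Proof.
elim: u => [|u IH]; first by move=> [].
by apply: (@entries_in_block _ _ TE1 _ _ _ _ eps 0 0 (Emx u)) => //;
  [exact: eps_TE1 | exact: entries_in0 | exact: entries_in0].
Qed.

Lemma Emx_span u (v : 'rV[T]_u) : entries_in TE1 v -> exists c, v = kmx c *m Emx u.
Proof.
elim: u v => [|u IH] v vE; first by exists 0; apply/rowP => -[].
move: v vE; rewrite -[u.+1]/(1 + u)%N => v; rewrite -[v]hsubmxK => /entries_in_row_mx[v1 v2].
have [x hx] := eps_span (v1 0 0); have [y hy] := IH _ v2.
exists (row_mx x y); rewrite kmx_row_mx /= mul_row_block !mulmx0 addr0 add0r -hy -hx.
by congr row_mx; apply/matrixP => a b; rewrite !ord1 [RHS]mxE eqxx.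
Qed.

Lemma betti_Emx u i : bt (Emx u) i = (u * bt eps i)%N.
Proof.
elim: u => [|u IH]; first exact: betti_empty.
by rewrite mulSn -IH; apply: (betti_block T1 i eps (Emx u)).
Qed.

(* A basis over k of the vectors v over T1 whose R-part is killed by D. *)
Definition ext p r (D : 'M[T]_(p, r)) : 'M[T]_(kdim TR1 D + erows p, p) :=
  col_mx (kbasis TR1 D) (Emx p).

Lemma ext_span p r (D : 'M[T]_(p, r)) (v : 'rV[T]_p) : entries_in T1 v -> rpart v *m D = 0 ->
  exists c, v = kmx c *m ext D.
Proof.
move=> /T1_split[vE vR vT] vD; have [x hx] := kbasisP vR vD; have [y hy] := Emx_span vT.
by exists (row_mx x y); rewrite kmx_row_mx mul_row_col -hx -hy.
Qed.

Lemma betti_ext0 p r (D : 'M[T]_(p, r)) : bt (ext D) 0 = (kdim TR1 D + p * \dim TE1)%N.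
Proof. by rewrite betti0 erowsE. Qed.

Lemma TE1_TR1_mx m n p (M : 'M[T]_(m, n)) (N : 'M[T]_(n, p)) :
  entries_in TE1 M -> entries_in TR1 N -> entries_in TE2 (M *m N).
Proof. by apply: entries_inM => x y x1 y1; rewrite mulrC (TR1_TE1 sh full). Qed.

Lemma T1_TE1_mx m n p (M : 'M[T]_(m, n)) (N : 'M[T]_(n, p)) :
  entries_in T1 M -> entries_in TE1 N -> entries_in TE2 (M *m N).
Proof.
apply: entries_inM => _ y /T1P[a [b [a1 b1 ->]]] y1.
by rewrite mulrDl (TEE0 sh full (TE_sub1 _ _ _) (TE_sub1 _ _ _) b1 y1) addr0 (TR1_TE1 sh full).
Qed.

(** Keep the coordinates of a syzygy on the rows of K = [kbasis TR1 D]. The R-part of what is kept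
    is a linear syzygy of K; a syzygy with nothing kept is one of [p] copies of [eps]. *)
Lemma betti_ext_next p r (D : 'M[T]_(p, r)) i :
  (bt (ext D) i.+1 <= bt (ext (kbasis TR1 D)) i + p * bt eps i.+1)%N.
Proof.
rewrite bettiS -betti_Emx (bettiS T1 (Emx p)) [X in (_ <= X)%N]addnC; set K := kbasis TR1 D.
apply: tri_betti; try exact: kindep_kbasis.
exists (col_mx 1%:M 0), (row_mx 0 1%:M); split.
- rewrite -kermx_eq0; apply/eqP.
  have := mulmx_ker (row_mx (0 : 'M[k]_(erows p, kdim TR1 D)) 1%:M).
  by rewrite mul_mx_row mulmx0 mulmx1 -row_mx0 => /eq_row_mx[].
- move=> x; rewrite -[x]hsubmxK mul_row_col mulmx1 mulmx0 addr0 => ->.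
  by apply/submxP; exists (rsubmx x); rewrite mul_mx_row mulmx0 mulmx1.
- apply: row_factor => j; rewrite row_mul; set v := row j _.
  have vA : entries_in T1 v by apply/row_entries_in/kbasis_entries.
  have vE : v *m ext D = 0 by rewrite -row_mul kbasisM linear0.
  rewrite -[v]hsubmxK in vA vE *; have [v1 v2] := (entries_in_row_mx _ _ _).1 vA.
  rewrite /kmx map_col_mx map_mx1 map_mx0 mul_row_col mulmx1 mulmx0 addr0.
  apply: ext_span => //; have [E h1 h2] := T1_split v1.
  have KR : entries_in TR1 K by apply: kbasis_entries.
  move: vE; rewrite mul_row_col {1}E mulmxDl -addrA => /TR2_TE2_sum0[] //.
    by move: h1 KR; apply: entries_inM => x y; apply: (TR1_TR1 sh full).
  apply: entries_inD; first exact: TE1_TR1_mx.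
  by apply: T1_TE1_mx => //; apply: Emx_TE1.
- apply: kbasisPmx.
    exact/entries_in_kmxr/kbasis_entries.
  by rewrite kmx_row_mx kmx0 kmx1 mul_mx_row mulmx0 mulmx1 mul_row_col mul0mx add0r kbasisM.
move=> c; set v := kmx c *m _; rewrite /kmx map_col_mx map_mx1 map_mx0.
have vA : entries_in T1 v by apply/entries_in_kmxl/kbasis_entries.
have vE : v *m ext D = 0 by rewrite -mulmxA kbasisM mulmx0.
rewrite -[v]hsubmxK in vA vE *; have [v1 v2] := (entries_in_row_mx _ _ _).1 vA.
rewrite mul_row_col mulmx1 mulmx0 addr0 => l0; move: vE; rewrite l0 mul_row_col mul0mx add0r.
move=> /(kbasisP v2)[c' hc']; exists c'.
by rewrite map_row_mx map_mx1 map_mx0 mul_mx_row mulmx0 mulmx1 hc'.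
Qed.

(** At [l = 0] these are the coefficients of U (1 + z H), for the generating series U and H of [u]
    and [h]; [l] shifts [u]. *)
Fixpoint ubound (u h : nat -> nat) i l : nat :=
  if i is i'.+1 then ubound u h i' l.+1 + u l * h i' else u l.

Lemma betti_ext_bound (s : stage T) i l :
  (bt (ext (smx (strand TR1 s l))) i <= ubound (fun l => srows (strand TR1 s l)) (bt eps) i.+1 l)%N.
Proof.
elim: i l => [|i IH] l; first by rewrite betti_ext0 /=.
apply: leq_trans (betti_ext_next _ _) _; rewrite [ubound _ _ _ _]/=.
by apply: leq_add => //; apply: (IH l.+1).
Qed.

Lemma betti_stage_bound (s : stage T) i :
  (forall v : 'rV[T]_(srows s), entries_in T1 v -> v *m smx s = 0 -> rpart v *m smx s = 0) ->
  (bt (smx s) i <= ubound (fun l => srows (strand TR1 s l)) (bt eps) i 0)%N.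
Proof.
move=> h; case: i => [//|i]; apply: leq_trans (betti_ext_bound s i 0).
rewrite bettiS /=; have [C hC] : exists C, kbasis T1 (smx s) = kmx C *m ext (smx s).
  apply: row_factor => j; have vA : entries_in T1 (row j (kbasis T1 (smx s))).
    exact/row_entries_in/kbasis_entries.
  by apply: ext_span => //; apply: h => //; rewrite -row_mul kbasisM linear0.
exact: betti_mono (@kindep_kbasis _ _ _ _ _ _) hC.
Qed.

(** An implicit bound: the right side involves the same numbers at smaller indices. [ubound_fixed]
    resolves it. *)
Lemma betti_eps_bound i :
  (bt eps i <= ubound (fun l => srows (strand TR1 (Stage eps) l)) (bt eps) i 0)%N.
Proof.
apply: (betti_stage_bound (s := Stage eps)) => v /T1_split[vE _ vT] /=.
by rewrite {1}vE mulmxDl (TE1_TE1 vT eps_TE1) addr0.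
Qed.

Lemma betti_k_bound i :
  (bt (0 : 'M[T]_(1, 0)) i <= ubound (fun l => srows (strand TR1 (kstage T) l)) (bt eps) i 0)%N.
Proof. by apply: (betti_stage_bound (s := kstage T)) => v _ _; rewrite mulmx0. Qed.

End TrivextStrands.

(** * Recurrences for the bounds *)

Section Recurrences.

Lemma ubound_mono u h h' i l : (forall j, (j < i)%N -> (h j <= h' j)%N) ->
  (ubound u h i l <= ubound u h' i l)%N.
Proof.
elim: i l => //= i IH l hh; apply: leq_add; first by apply: IH => j ji; apply/hh/ltnW.
by rewrite leq_mul2l hh ?orbT.
Qed.

(** The first component solves H = Y (1 + z H) for Y = (f - z) / (1 - f z), that is, H = (f - z) /
    (1 - 2 f z + z^2). The second is the value of [ubound] with shift 1, carried along to make the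
    recursion first order. *)
Definition eta_pair f i : nat * nat :=
  iter i (fun pq => (pq.2 + f * pq.1, f * pq.2 + (f * f - 1) * pq.1)%N) (f, (f * f - 1)%N).
Definition eta f i := (eta_pair f i).1.

Lemma ubound_eta f y i : y 0%N = f -> y 1%N = (f * f - 1)%N ->
  (forall l, y l.+2 = f * y l.+1)%N ->
  ubound y (eta f) i 0 = eta f i /\ ubound y (eta f) i 1 = (eta_pair f i).2.
Proof.
move=> y0 y1 yS.
have sc j l : ubound y (eta f) j l.+2 = (f * ubound y (eta f) j l.+1)%N.
  elim: j l => [|j IH] l /=; first exact: yS.
  by rewrite IH yS mulnDr mulnA.
elim: i => [|i [IH0 IH1]]; first by rewrite /= y0 y1.
by rewrite /= sc IH1 y0 y1.
Qed.

(** [ubound] at i is monotone in the values of [h] below i, so strong induction compares [h] with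
    the exact solution [eta f]. *)
Lemma ubound_fixed f y h : y 0%N = f -> y 1%N = (f * f - 1)%N ->
  (forall l, y l.+2 = f * y l.+1)%N -> (forall i, h i <= ubound y h i 0)%N ->
  forall i, (h i <= eta f i)%N.
Proof.
move=> y0 y1 yS hh; elim/ltn_ind => i IH.
by have [<- _] := ubound_eta i y0 y1 yS; apply: leq_trans (hh i) (ubound_mono _ _ IH).
Qed.

Lemma ubound_recurrence f u i (a := fun i => ubound u (eta f) i 0) (n := (2 * f).+1) :
  (0 < f)%N -> u 0%N = 1%N -> u 1%N = f.+1 ->
  (forall l, u l.+2 + f * u l = f.+1 * u l.+1)%N ->
  (a i.+3 + n * a i.+1 = n * a i.+2 + a i)%N.
Proof.
move=> f0 u0 u1 uS; pose b i := ubound u (eta f) i 1; pose c i := ubound u (eta f) i 2.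
pose p i := (eta_pair f i).1; pose q i := (eta_pair f i).2.
have sc j l : (ubound u (eta f) j l.+2 + f * ubound u (eta f) j l = f.+1 * ubound u (eta f) j l.+1)%N.
  by elim: j l => [|j IH] l /=; [apply: uS | have := IH l.+1; have := uS l; nia].
have aS j : a j.+1 = (b j + p j)%N by rewrite /a /b /= u0 mul1n.
have bS j : b j.+1 = (c j + f.+1 * p j)%N by rewrite /b /c /= u1.
have cE j : (c j + f * a j = f.+1 * b j)%N by apply: sc.
have pS j : p j.+1 = (q j + f * p j)%N by [].
have qS j : q j.+1 = (f * q j + (f * f - 1) * p j)%N by [].
have ff : exists g, (f * f = g + 1 /\ f * f - 1 = g)%N by exists (f * f - 1)%N; nia.
case: ff => g [fg gE]; rewrite gE in qS.
(* The state (a, b, p, q) evolves linearly; this invariant confines it to a hyperplane, which is why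
   a recurrence of order 3 suffices. *)
have inv j : (g * b j = g * a j + f * q j)%N.
  elim: j => [|j IH]; first by rewrite /a /b /q /= u0 u1 gE; nia.
  rewrite aS bS qS; have := cE j; nia.
have := inv i; have := cE i; have := cE i.+1; rewrite !(aS, bS, pS, qS).
move: (a i) (b i) (c i) (c i.+1) (p i) (q i) => x0 x1 x2 x3 x4 x5 h1 h2 h3.
have h2' : x2%:Z = f.+1%:Z * x1%:Z - f%:Z * x0%:Z by lia.
have fg' : f%:Z * f%:Z = g%:Z + 1 by lia.
have h1' : x3%:Z = f.+1%:Z * (x2%:Z + f.+1%:Z * x4%:Z) - f%:Z * (x1%:Z + x4%:Z) by lia.
have h3' : g%:Z * x1%:Z = g%:Z * x0%:Z + f%:Z * x5%:Z by lia.
apply/eqP; rewrite -eqz_nat; apply/eqP; rewrite /n.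
rewrite !(PoszD, PoszM) h1' h2'.
have gz : g%:Z = f%:Z * f%:Z - 1 by rewrite fg' addrK.
rewrite gz in h3'.
apply/eqP; rewrite -subr_eq0; apply/eqP.
transitivity ((f%:Z * f%:Z - 1) * x0%:Z + f%:Z * x5%:Z - (f%:Z * f%:Z - 1) * x1%:Z); last by rewrite h3' subrr.
have -> : (f.+1)%:Z = f%:Z + 1 by lia.
have -> : ((2 * f).+1)%:Z = 2 * f%:Z + 1 by lia.
rewrite gz; ring.
Qed.

(** The lower bound on w_(i+3) contains earlier terms with both signs, so it only propagates because
    those terms are already known exactly. *)
Lemma recurrence_squeeze (w a : nat -> nat) n : (forall i, w i <= a i)%N ->
  (forall i, a i.+3 + n * a i.+1 = n * a i.+2 + a i)%N ->
  (forall i, n * w i.+2 + w i <= w i.+3 + n * w i.+1)%N ->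
  w 0%N = a 0%N -> w 1%N = a 1%N -> w 2%N = a 2%N -> forall i, w i = a i.
Proof.
move=> wa aS wS w0 w1 w2; elim/ltn_ind => -[|[|[|i]]] IH //.
apply/eqP; rewrite eqn_leq wa /=.
have := wS i; rewrite (IH i) ?(IH i.+1) ?(IH i.+2) ?ltnS ?leqnSn ?leqW //.
by have := aS i; lia.
Qed.

End Recurrences.

(** * Exactness of the strand of k over R *)

Section StrandExactness.
Variables (k : fieldType) (A : comFalgType k) (R1 R2 : {vspace A}).
Variables (p0 : 'Hom(A, k^o)) (p1 p2 : 'End(A)).
Hypothesis sh : short_subring R1 R2 p0 p1 p2.
Variables (b : nat -> nat) (d : forall j, 'M[A]_(b j, b j.+1)).
Hypothesis lc : left_complex R1 R2 d.
Hypothesis e3 : (3 <= \dim R1)%N.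
Hypothesis f2 : (2 <= \dim R2)%N.
Local Notation kmx := (kmx A).
Local Notation L := (lin p1 d).
Local Notation st := (strand R1 (kstage A)).

(** Far along the complex [kap] vanishes, and [img_kap] leaves the whole of R2 to the image of the
    linear part. *)
Lemma quad_onto a m (X : 'M[A]_(m, b a.+2)) : (b 0 <= a)%N -> entries_in R2 X ->
  exists2 V, entries_in R1 V & X = V *m L a.+1.
Proof.
move=> ba X2; have k0 := kap_eventually0 sh lc e3 f2 (leqW ba).
have E : imgv R1 (L a.+1) = pointwise R2 (b a.+2).
  apply/eqP; rewrite eqEdim dim_pointwise -(img_kap sh lc) k0 addn0 leqnn andbT.
  apply/subvP => g; rewrite -[g]row_of_ffunK => /imgvP[v v1 ->].
  apply/pointwiseP => i; rewrite ffunE; apply: (entries_in_11 sh) => //.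
  exact: (@lin_R1 _ _ _ _ _ _ _ sh).
have /rows_choice[V hV] : forall i, exists v, entries_in R1 v /\ row i X = v *m L a.+1.
  move=> i; have [|v v1 hv] := (imgvP R1 (L a.+1) (row i X)).1; last by exists v.
  by rewrite E; apply/pointwiseP => j; rewrite ffunE mxE.
exists V; first by apply: entries_in_row => i; have [] := hV i.
by apply/row_matrixP => i; rewrite row_mul; have [_] := hV i.
Qed.

(** A chase in the strand tensored with the linear part of F: lift [X] along [L], then use the
    induction hypothesis one index earlier to change the lift by a multiple of the previous [L] so
    that the strand kills it. Each step uses up one index, whence [b 0 + i <= a]. *)
Lemma strand_lin_onto i a (X : 'M[A]_(srows (st i), b a.+2)) : (b 0 + i <= a)%N ->
  entries_in R2 X -> exists C, X = (smx (st i.+1))^T *m kmx C *m L a.+1.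
Proof.
elim: i a X => [|i IH] a X ia X2.
  have [|V V1 ->] := quad_onto _ X2; first by lia.
  have [|C hC] := kbasisPmx (D := smx (st 0)) (entries_inT V1); first by rewrite mulmx0.
  by exists C^T; rewrite -[V]trmxK hC trmx_mul kmxT.
have [|V V1 ->] := quad_onto _ X2; first by lia.
case: a ia X X2 V V1 => [|a] ia X X2 V V1; first by lia.
have [||C hC] := IH a ((smx (st i.+1))^T *m V); first by lia.
  apply: (entries_in_11 sh) => //; apply: entries_inT; exact: kbasis_entries.
have [||C' hC'] := @kbasisPmx k A R1 _ _ _ (smx (st i.+1)) (V - kmx C *m L a.+1)^T.
- by apply/entries_inT/entries_inB => //; apply/entries_in_kmxl/(@lin_R1 _ _ _ _ _ _ _ sh).
- by apply: trmx_inj; rewrite trmx_mul !trmxK trmx0 mulmxBr hC mulmxA subrr.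
exists C'^T; rewrite -kmxT -trmx_mul -hC' trmxK mulmxBl -mulmxA (lin_lin sh lc) mulmx0 subr0 //.
Qed.

(** Place [w] in a single column far along the complex, apply the chase, and read that column off
    again. *)
Lemma strand_onto i (w : 'rV[A]_(srows (st i))) : entries_in R2 w ->
  exists2 v, entries_in R1 v & w = v *m smx (st i.+1).
Proof.
move=> w2; pose a := (b 0 + i)%N; pose l : 'I_(b a.+2) := Ordinal (lc_pos lc a.+2).
have [||C hC] := @strand_lin_onto i a (w^T *m kmx (delta_mx 0 l)); rewrite ?leqnn //.
  exact/entries_in_kmxr/entries_inT.
exists (kmx C *m L a.+1 *m kmx (delta_mx l 0))^T.
  by apply/entries_inT/entries_in_kmxr/entries_in_kmxl/(@lin_R1 _ _ _ _ _ _ _ sh).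
apply: trmx_inj; rewrite trmx_mul trmxK !mulmxA -hC -mulmxA -kmxM.
have -> : delta_mx 0 l *m delta_mx l 0 = 1%:M :> 'M[k]_1.
  by rewrite mul_delta_mx; apply/matrixP => x y; rewrite !ord1 !mxE.
by rewrite kmx1 mulmx1.
Qed.

Lemma strand_dim_eq i :
  (srows (st i.+1) * \dim R1 = srows (st i.+2) + srows (st i) * \dim R2)%N.
Proof.
apply: (kdim_eq (short_11 sh)); first by apply: kbasis_entries.
exact: strand_onto.
Qed.

End StrandExactness.

Section TrivextComplex.
Variables (k : fieldType) (R : comFalgType k) (R1 R2 : {vspace R}).
Variables (p0 : 'Hom(R, k^o)) (p1 p2 : 'End(R)).
Hypothesis sh : short_subring R1 R2 p0 p1 p2.
Hypothesis full : fullv = short_carrier R1 R2.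
Local Notation T := (trivext R).
Local Notation TR1 := (TR1 p1).
Local Notation TR2 := (TR2 p2).
Local Notation TE := (TE p0 p1 p2).
Local Notation TRR := (short_carrier TR1 TR2).

Definition ring_emb (x : R) : T := (x, 0).
Fact ring_emb_linear : linear ring_emb.
Proof. by move=> a x y; congr pair; rewrite /= scaler0 addr0. Qed.
HB.instance Definition _ := GRing.isLinear.Build k R T _ ring_emb ring_emb_linear.
Fact ring_emb_monoid : monoid_morphism ring_emb.
Proof.
split=> // x y; apply: trivext_eqP => [|z]; first by rewrite trivext_mul1E.
by rewrite trivext_mul2E /= !lfunE addr0.
Qed.
HB.instance Definition _ := GRing.isMonoidMorphism.Build R T ring_emb ring_emb_monoid.

Lemma ring_emb_R1 x : x \in R1 -> ring_emb x \in TR1.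
Proof. by move=> x1; apply/(TR1P sh full). Qed.
Lemma ring_emb_R2 x : x \in R2 -> ring_emb x \in TR2.
Proof. by move=> x1; apply/(TR2P sh full). Qed.

Lemma trivext_short : short_subring TR1 TR2 (tp0 p0) (tr1 p1) (tr2 p2).
Proof.
split.
- by have [-> -> -> _] := one_parts sh.
- by move=> x /(TR1_parts sh full)[].
- by move=> x /(TR2_parts sh full)[].
- exact: (TR1_TR1 sh full).
- exact: (TR1_TR2 sh full).
- exact: (TR2_TR2 sh full).
apply/subvP => u /(TR2P sh full)[u1 u2].
have -> : u = ring_emb u.1 by case: (u) u2 => a b /= ->.
move: (u.1) (subvP (short_gen sh) _ u1); apply: prodv_ind.
- by rewrite raddf0 mem0v.
- by move=> x y hx hy; rewrite raddfD rpredD.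
- by move=> a x hx; rewrite linearZ rpredZ.
- by move=> x y x1 y1; rewrite rmorphM memv_mul // ring_emb_R1.
Qed.

Lemma trivext_ringP (u : T) : u \in TRR <-> u.2 = 0.
Proof.
split.
  case/memv_addP => _ /vlineP[a ->] [_ /memv_addP[y /(TR1P sh full)[_ y2] [z /(TR2P sh full)[_ z2] ->]] ->].
  by rewrite /= y2 z2 scaler0 !addr0.
move=> u2; have -> : u = ring_emb u.1 by case: (u) u2 => a b /= ->.
have [E h1 h2] := full_dec sh full u.1; rewrite E !raddfD /= -addrA memv_add //.
  by rewrite linearZ rpredZ // rmorph1 memv_line.
by apply: memv_add; [exact: ring_emb_R1 | exact: ring_emb_R2].
Qed.

Lemma ring_embK m n (M : 'M[T]_(m, n)) : entries_in TRR M ->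
  exists N : 'M[R]_(m, n), M = map_mx ring_emb N.
Proof.
move=> HM; exists (map_mx (fun u : T => u.1) M); apply/matrixP => i j; rewrite !mxE.
by have /trivext_ringP := HM i j; case: (M i j) => a c /= ->.
Qed.

Lemma ring_emb_TRR m n (N : 'M[R]_(m, n)) : entries_in TRR (map_mx ring_emb N).
Proof. by move=> i j; rewrite mxE; apply/trivext_ringP. Qed.

Lemma ring_emb_inj : injective ring_emb.
Proof. by move=> x y []. Qed.

Variables (b : nat -> nat) (dR : forall j, 'M[R]_(b j, b j.+1)).
Hypothesis lcR : left_complex R1 R2 dR.

Definition dT j : 'M[T]_(b j, b j.+1) := map_mx ring_emb (dR j).
Local Notation d := dT.

Lemma trivext_left_complex : left_complex TR1 TR2 d.
Proof.
split.
- by move=> j; rewrite -map_mxM (lc_dd lcR) map_mx0.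
- move=> j i l; rewrite mxE; have /memv_addP[x x1 [y y2 ->]] := lc_min lcR i l.
  by rewrite raddfD; apply: memv_add; [exact: ring_emb_R1 | exact: ring_emb_R2].
- move=> j v /ring_embK[w ->]; rewrite -map_mxM => h.
  have [||u _ ->] := lc_ex lcR (j := j) (v := w).
  + by move=> i l; rewrite -full memvf.
  + by apply/matrixP => i l; move/matrixP/(_ i l): h; rewrite !mxE => /ring_emb_inj.
  by exists (map_mx ring_emb u); [apply: ring_emb_TRR | rewrite map_mxM].
- exact: (lc_pos lcR).
Qed.

(* Hom_k(-, k) turns exactness of Hom_R(F, R) into exactness of Hom_k(R, k) (x) F. *)
Lemma dual_spot : (forall ph : 'cV[R]_(b 1), dR 0 *m ph = 0 -> exists ps, ph = dR 1 *m ps) ->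
  forall al : 'rV[T]_(b 1), entries_in TE al -> al *m d 1 = 0 ->
  exists2 be, entries_in TE be & al = be *m d 0.
Proof.
move=> dex al alE ald.
have al1 j : (al 0 j).1 = 0 by apply/(TEP sh full).
pose mulc r c (M : 'M[R]_(r, c)) (g : {ffun 'I_c -> R}) : {ffun 'I_r -> R} :=
  [ffun i => \sum_j M i j * g j].
have mulc_lin r c (M : 'M[R]_(r, c)) : linear (@mulc r c M).
  move=> a g h; apply/ffunP => i; rewrite !ffunE scaler_sumr -big_split; apply: eq_bigr => j _.
  by rewrite !ffunE mulrDr scalerAr.
pose mulL : {linear {ffun 'I_(b 1) -> R} -> {ffun 'I_(b 0) -> R}} :=
  HB.pack (mulc _ _ (dR 0)) (GRing.isLinear.Build k _ _ _ _ (mulc_lin _ _ (dR 0))).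
pose fn (g : {ffun 'I_(b 1) -> R}) : k^o := \sum_j (al 0 j).2 (g j).
have fn_lin : linear fn.
  move=> a g h; rewrite /fn scaler_sumr -big_split; apply: eq_bigr => j _.
  by rewrite !ffunE linearP.
pose fnL : {linear {ffun 'I_(b 1) -> R} -> k^o} :=
  HB.pack fn (GRing.isLinear.Build k _ _ _ fn fn_lin).
have kerfn g : mulc _ _ (dR 0) g = 0 -> fn g = 0.
  move=> g0; have [|ps hps] := dex (\col_j g j).
    apply/matrixP => i j; rewrite !mxE; have /ffunP/(_ i) := g0; rewrite !ffunE => h.
    by rewrite -[RHS]h; apply: eq_bigr => l _; rewrite mxE.
  have gE j : g j = \sum_l dR 1 j l * ps l 0.
    by have /matrixP/(_ j 0) := hps; rewrite !mxE.
  rewrite /fn; under eq_bigr => j _ do rewrite gE linear_sum.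
  rewrite exchange_big big1 // => l _ /=.
  have /matrixP/(_ 0 l) := ald; rewrite !mxE => /(congr1 (fun u : T => u.2 (ps l 0))).
  rewrite zero_lfunE => h; rewrite -[RHS]h.
  have sum2 (I : finType) (h' : I -> T) x : (\sum_i h' i).2 x = \sum_i (h' i).2 x.
    by elim/big_rec2: _ => [|i y1 y2 _ <-]; rewrite ?zero_lfunE // trivextD2.
  rewrite sum2; apply: eq_bigr => j _.
  by rewrite mxE trivext_mul2E al1 mul0r linear0 add0r.
(* [fn] vanishes on the kernel of multiplication by [dR 0], so it factors through the image; the
   pseudo-inverse extends the factor to the whole space. Its coordinates form [be]. *)
pose ps : 'Hom({ffun 'I_(b 0) -> R}, k^o) := (linfun fnL \o (linfun mulL)^-1)%VF.
have psE g : ps (mulc _ _ (dR 0) g) = fn g.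
  rewrite comp_lfunE !lfunE /=; set h := (_^-1)%VF _.
  apply/eqP; rewrite -subr_eq0; apply/eqP.
  have <- : fn (h - g) = fn h - fn g by rewrite -(linearB fnL).
  apply: kerfn; have -> : mulc _ _ (dR 0) (h - g) = mulc _ _ (dR 0) h - mulc _ _ (dR 0) g.
    by rewrite -(linearB mulL).
  apply/eqP; rewrite subr_eq0; apply/eqP.
  have := limg_lfunVK (f := linfun mulL) (x := mulc _ _ (dR 0) g).
  rewrite lfunE /= => -> //; apply/memv_imgP; exists g; rewrite ?memvf //.
  exact: (esym (lfunE mulL g)).
pose unit_at (l : 'I_(b 0)) (x : R) : {ffun 'I_(b 0) -> R} := [ffun i => if i == l then x else 0].
have ua_lin l : linear (unit_at l).
  move=> a x y; apply/ffunP => i; rewrite !ffunE; case: eqP => // _.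
  by rewrite scaler0 addr0.
pose uaL l : {linear R -> {ffun 'I_(b 0) -> R}} :=
  HB.pack (unit_at l) (GRing.isLinear.Build k _ _ _ _ (ua_lin l)).
pose be : 'rV[T]_(b 0) := \row_l (0, (ps \o linfun (uaL l))%VF).
exists be; first by move=> i l; rewrite mxE; apply/(TEP sh full).
apply/rowP => j; apply: trivext_eqP => [|x].
  rewrite al1; apply/esym; rewrite mxE.
  have sum1 (I : finType) (h' : I -> T) : (\sum_i h' i).1 = \sum_i (h' i).1.
    by elim/big_rec2: _ => // i y1 y2 _ <-.
  by rewrite sum1 big1 // => l _; rewrite trivext_mul1E mxE /= mul0r.
have sum2 (I : finType) (h' : I -> T) y : (\sum_i h' i).2 y = \sum_i (h' i).2 y.
  by elim/big_rec2: _ => [|i y1 y2 _ <-]; rewrite ?zero_lfunE // trivextD2.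
pose g : {ffun 'I_(b 1) -> R} := [ffun i => if i == j then x else 0].
have fg : fn g = (al 0 j).2 x.
  rewrite /fn (bigD1 j) //= ffunE eqxx big1 ?addr0 // => l /negbTE lj.
  by rewrite ffunE lj linear0.
rewrite -fg -psE mxE sum2.
have -> : mulc _ _ (dR 0) g = \sum_l unit_at l (dR 0 l j * x).
  apply/ffunP => i; rewrite ffunE sum_ffunE (bigD1 j) //= ffunE eqxx big1 ?addr0 => [|l /negbTE lj].
    rewrite (bigD1 i) //= ffunE eqxx big1 ?addr0 // => l; rewrite eq_sym => /negbTE li.
    by rewrite ffunE li.
  by rewrite ffunE lj mulr0.
rewrite linear_sum; apply: eq_bigr => l _.
rewrite trivext_mul2E !mxE /= zero_lfunE add0r [RHS]comp_lfunE; congr (ps _).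
exact: (esym (lfunE (uaL l) _)).
Qed.

End TrivextComplex.

(** * The strand of Hom_k(R, k) over R *)

Section DualStrand.
Variables (k : fieldType) (R : comFalgType k) (R1 R2 : {vspace R}).
Variables (p0 : 'Hom(R, k^o)) (p1 p2 : 'End(R)).
Hypothesis sh : short_subring R1 R2 p0 p1 p2.
Hypothesis full : fullv = short_carrier R1 R2.
Hypothesis nosoc : forall x, x \in R1 -> (forall y, y \in R1 -> x * y = 0) -> x = 0.
Hypothesis R2n0 : R2 != 0%VS.
Local Notation T := (trivext R).
Local Notation kmx := (kmx T).
Local Notation TR1 := (TR1 p1).
Local Notation TR2 := (TR2 p2).
Local Notation TE1 := (TE1 p2).
Local Notation TE2 := (TE2 p1).
Local Notation TE3 := (TE3 p0).
Local Notation TE := (TE p0 p1 p2).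
Local Notation TRR := (short_carrier TR1 TR2).
Local Notation eps := (eps p2).
Local Notation m0 M := (mx0 (tp0 p0) M).
Local Notation m1 M := (mx1 (tr1 p1) M).
Local Notation m2 M := (mx2 (tr2 p2) M).
Variables (b : nat -> nat) (d : forall j, 'M[T]_(b j, b j.+1)).
Hypothesis lc : left_complex TR1 TR2 d.
Hypothesis spot : forall al : 'rV[T]_(b 1), entries_in TE al -> al *m d 1 = 0 ->
  exists2 be, entries_in TE be & al = be *m d 0.

Let shT : short_subring TR1 TR2 (tp0 p0) (tr1 p1) (tr2 p2) := trivext_short sh full.

Lemma lc_ex_mx j m (M : 'M[T]_(m, b j.+1)) : entries_in TRR M -> M *m d j.+1 = 0 ->
  exists2 W, entries_in TRR W & M = W *m d j.
Proof.
move=> HM Md; have /rows_choice[W hW] : forall i, exists w, entries_in TRR w /\ row i M = w *m d j.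
  move=> i; have [||w h1 h2] := lc_ex lc (j := j) (v := row i M); last by exists w.
    exact: row_entries_in.
  by rewrite -row_mul Md linear0.
exists W; first by apply: entries_in_row => i; have [] := hW i.
by apply/row_matrixP => i; rewrite row_mul; have [] := hW i.
Qed.

Lemma TRR_mul x y : x \in TRR -> y \in TRR -> x * y \in TRR.
Proof.
move=> /(trivext_ringP sh full) hx /(trivext_ringP sh full) hy.
apply/(trivext_ringP sh full)/lfunP => z.
by rewrite trivext_mul2E hx hy !zero_lfunE addr0.
Qed.

Lemma TE_eps x : x \in TE -> exists2 g : 'rV[T]_(\dim TE1), entries_in TRR g & x%:M = g *m eps :> 'M_1.
Proof.
pose P x := exists2 g : 'rV[T]_(\dim TE1), entries_in TRR g & x%:M = g *m eps :> 'M_1.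
have PD u v : P u -> P v -> P (u + v).
  by move=> [g g1 hg] [h h1 hh]; exists (g + h); [apply: entries_inD | rewrite mulmxDl -hg -hh raddfD].
have PM u v : u \in TRR -> P v -> P (u * v).
  move=> uR [g g1 hg]; exists (u *: g); first by move=> i j; rewrite mxE TRR_mul.
  by rewrite -scalemxAl -hg scale_scalar_mx.
have P1 u : u \in TE1 -> P u.
  case/eps_span => c hc; exists (kmx c) => //.
  by apply: (entries_in_sub (short_1 _ _)); apply: entries_in_kmx.
have PZ (a : k) u : P u -> P (a *: u).
  move=> h; rewrite -mulr_algl; apply: PM => //.
  by apply: (subvP (short_1 _ _)); rewrite rpredZ ?memv_line.
have P0 : P 0 by exists 0; [apply: entries_in0 | rewrite mul0mx raddf0].
have Pprod (U : {vspace T}) u : (U <= TRR)%VS -> u \in (U * TE1)%VS -> P u.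
  move=> /subvP UR; apply: (prodv_ind P0 PD PZ) => u' v' /UR u1 /P1 hv'.
  exact: PM u1 hv'.
case/memv_addP => u /P1 hu [_ /memv_addP[v v2 [w w3 ->]] ->].
apply: (PD _ _ hu (PD _ _ _ _)).
  apply: Pprod (short_R1S _ _) _; exact: (subvP (TE2_gen sh full nosoc) _ v2).
apply: Pprod (short_R2S _ _) _; exact: (subvP (TE3_gen sh full R2n0) _ w3).
Qed.

Local Notation Ys l := (strand TR1 (Stage eps) l).
Local Notation y l := (srows (Ys l)).
Local Notation D l := (smx (Ys l)).

(** The products of [D l] with the parts of [v] of degrees 0, 1 and 2 lie in distinct degrees, and
    the rows of [D l] are independent over k. *)
Lemma dual_strand_good l (v : 'rV[T]_(y l)) : entries_in TRR v -> v *m D l = 0 ->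
  [/\ m0 v = 0, m1 v *m D l = 0 & m2 v *m D l = 0].
Proof.
move=> vR; have [E v1 v2] := mx_dec shT vR; case: l v vR E v1 v2 => [|l] v vR E v1 v2.
  rewrite {1}E !mulmxDl /= => S.
  have h1 : entries_in TE1 (kmx (m0 v) *m eps) by apply/entries_in_kmxl/eps_TE1.
  have h2 : entries_in TE2 (m1 v *m eps).
    by apply: (entries_inM (TR1_TE1 sh full)) => //; apply: eps_TE1.
  have h3 : entries_in TE3 (m2 v *m eps).
    by apply: (entries_inM (TR2_TE1 sh full)) => //; apply: eps_TE1.
  have e1 : kmx (m0 v) *m eps = 0.
    apply/matrixP => i j; have /matrixP/(_ i j)/(congr1 (te1 p2)) := S.
    rewrite mxE linearD [X in te1 p2 X + _]mxE linearD /=.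
    have [_ _ _ [-> _ _]] := TE1_parts sh full (h1 i j).
    have [_ _ _ [-> _ _]] := TE2_parts sh full (h2 i j).
    have [_ _ _ [-> _ _]] := TE3_parts sh full (h3 i j).
    by rewrite !addr0 !mxE linear0.
  have e2 : m1 v *m eps = 0.
    apply/matrixP => i j; have /matrixP/(_ i j)/(congr1 (te2 p1)) := S.
    rewrite e1 add0r mxE linearD /=.
    have [_ _ _ [_ -> _]] := TE2_parts sh full (h2 i j).
    have [_ _ _ [_ -> _]] := TE3_parts sh full (h3 i j).
    by rewrite !addr0 !mxE linear0.
  split; [exact: kindep_eps e1 | exact: e2 | ].
  by move: S; rewrite e1 e2 !add0r.
have DR : entries_in TR1 (D l.+1) by apply: kbasis_entries.
have h3 : m2 v *m D l.+1 = 0 by apply: (entries_inM0 (short_21 shT)) v2 DR.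
rewrite {1}E !mulmxDl h3 addr0 => S.
have h1 : entries_in TR1 (kmx (m0 v) *m D l.+1) by apply: entries_in_kmxl.
have h2 : entries_in TR2 (m1 v *m D l.+1) by apply: (entries_in_11 shT).
have [e1 e2] := mx_sum0 shT h1 h2 S.
by split; [exact: kbasis_free e1 | exact: e2 | reflexivity].
Qed.

Lemma dual_strand_R1 l m (V : 'M[T]_(y l, m)) : entries_in TRR V -> (D l)^T *m V = 0 ->
  [/\ m0 V = 0, exists C, m1 V = (D l.+1)^T *m kmx C & (D l)^T *m m2 V = 0].
Proof.
move=> VR DV; have good j : [/\ m0 (col j V)^T = 0, m1 (col j V)^T *m D l = 0
    & m2 (col j V)^T *m D l = 0].
  apply: dual_strand_good; first by move=> a c; rewrite !mxE; apply: VR.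
  by apply: trmx_inj; rewrite trmx_mul trmxK trmx0 colE mulmxA DV mul0mx.
split.
- apply/matrixP => i j; have [/matrixP/(_ 0 i) h _ _] := good j.
  by move: h; rewrite !mxE.
- have [||C hC] := @kbasisPmx k T TR1 _ _ _ (D l) (m1 V)^T.
  + by have [_ h _] := mx_dec shT VR; apply: entries_inT.
  + apply/row_matrixP => j; rewrite row_mul linear0; have [_ <- _] := good j.
    by congr (_ *m _); apply/rowP => i; rewrite !mxE.
  by exists C^T; rewrite -[m1 V]trmxK hC trmx_mul kmxT.
- apply: trmx_inj; rewrite trmx_mul trmxK trmx0; apply/row_matrixP => j.
  rewrite row_mul linear0; have [_ _ <-] := good j.
  by congr (_ *m _); apply/rowP => i; rewrite !mxE.
Qed.

(* Exactness of the strand tensored with the complex, at the spot l + 1. *)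
Definition strand_spot l := forall Z : 'M[T]_(y l, b l.+1), entries_in TRR Z ->
  (D l)^T *m Z *m d l.+1 = 0 ->
  exists2 g : 'M[T]_(y l, b l), entries_in TRR g & (D l)^T *m (Z - g *m d l) = 0.

Definition dual_strand_onto l := forall w : 'rV[T]_(y l), entries_in TR2 w -> w *m D l = 0 ->
  exists2 v, entries_in TR1 v & w = v *m D l.+1.

Lemma TRR_d m j (g : 'M[T]_(m, b j)) : entries_in TRR g -> entries_in TRR (g *m d j).
Proof. by move=> gR; apply: (entries_inM TRR_mul) => //; apply: (d_RR lc). Qed.

(** Place [w] in one column of F_(l+2). It is a cycle there; exactness at the spot corrects a
    preimage until the strand kills it, and the degree 1 part of the result exhibits [w] as an
    image. *)
Lemma strand_spot_onto l : strand_spot l -> dual_strand_onto l.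
Proof.
move=> spotl w w2 wD; pose j0 : 'I_(b l.+2) := Ordinal (lc_pos lc l.+2).
pose X : 'M[T]_(y l, b l.+2) := w^T *m kmx (delta_mx 0 j0).
have X2 : entries_in TR2 X by apply/entries_in_kmxr/entries_inT.
have XR := entries_in_sub (short_R2S TR1 TR2) X2.
have Xd : X *m d l.+2 = 0.
  rewrite (lc_mul shT lc XR); have [-> -> _] := mx_2 shT X2.
  by rewrite kmx0 !mul0mx !addr0.
have [V VR XV] := lc_ex_mx XR Xd.
have DX : (D l)^T *m X = 0 by rewrite mulmxA -trmx_mul wD trmx0 mul0mx.
have [|g gR hg] := spotl V VR; first by rewrite -mulmxA -XV DX.
have V'R : entries_in TRR (V - g *m d l) by apply: entries_inB => //; apply: TRR_d.
have [V0 [C V1] _] := dual_strand_R1 V'R hg.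
have XE : X = (D l.+1)^T *m kmx C *m lin (tr1 p1) d l.+1.
  have := lc_mul_parts shT lc V'R (j := l.+1).
  have -> : (V - g *m d l) *m d l.+1 = X.
    by rewrite mulmxBl -mulmxA (lc_dd lc) mulmx0 subr0 -XV.
  rewrite V0 V1 kmx0 !mul0mx add0r.
  by case=> _ _ <-; have [_ _ ->] := mx_2 shT X2.
exists (kmx C *m lin (tr1 p1) d l.+1 *m kmx (delta_mx j0 0))^T.
  by apply/entries_inT/entries_in_kmxr/entries_in_kmxl/(@lin_R1 _ _ _ _ _ _ _ shT).
apply: trmx_inj; rewrite trmx_mul trmxK !mulmxA -XE -mulmxA -kmxM.
have -> : delta_mx 0 j0 *m delta_mx j0 0 = 1%:M :> 'M[k]_1.
  by rewrite mul_delta_mx; apply/matrixP => u v; rewrite !ord1 !mxE.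
by rewrite kmx1 mulmx1.
Qed.

Lemma strand_spot0 : strand_spot 0.
Proof.
move=> Z ZR ZD; have [||be beE hbe] := spot (al := eps^T *m Z).
- move=> i j; rewrite mxE rpred_sum // => l _.
  have /(TE1P sh full)[e1 _] : eps^T i l \in TE1 by rewrite mxE; apply: eps_TE1.
  by apply/(TEP sh full); rewrite trivext_mul1E e1 mul0r.
- exact: ZD.
have /fin_all_exists[g hg] : forall j, exists g : 'rV[T]_(\dim TE1),
    entries_in TRR g /\ (be 0 j)%:M = g *m eps :> 'M_1.
  by move=> j; have [g h1 h2] := TE_eps (beE 0 j); exists g.
exists (\matrix_(i, j) g j 0 i); first by move=> i j; rewrite mxE; have [] := hg j.
rewrite mulmxBr mulmxA; have -> : (D 0)^T *m (\matrix_(i, j) g j 0 i) = be.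
  apply/rowP => j; rewrite !mxE; have [_ /matrixP/(_ 0 0)] := hg j.
  rewrite !mxE eqxx mulr1n => ->; apply: eq_bigr => i _.
  by rewrite !mxE mulrC.
by rewrite -hbe subrr.
Qed.

(** Lift along F and correct the lift by the exact spot [l]. Its part of degree 1 then comes from
    the next matrix of the strand by construction, its part of degree 2 by [onto]. Hence one exact
    spot is enough. *)
Lemma strand_spot_next l : strand_spot l -> dual_strand_onto l -> strand_spot l.+1.
Proof.
move=> spotl onto Z ZR ZD.
have DlR : entries_in TRR (D l.+1)^T.
  by apply/entries_inT/(entries_in_sub (short_R1S _ _))/kbasis_entries.
have DZR : entries_in TRR ((D l.+1)^T *m Z) by apply: (entries_inM TRR_mul).
have [Z' Z'R hZ'] := lc_ex_mx DZR ZD.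
have [||g gR hg] := spotl Z' => //.
  by rewrite -mulmxA -hZ' mulmxA -trmx_mul kbasisM trmx0 mul0mx.
have [V [hV VR hg']] : exists V, [/\ V *m d l.+1 = Z' *m d l.+1, entries_in TRR V & (D l)^T *m V = 0].
  exists (Z' - g *m d l); split; last exact: hg.
    by rewrite mulmxBl -mulmxA (lc_dd lc) mulmx0 subr0.
  by apply: entries_inB => //; apply: TRR_d.
have [V0 [C V1] V2] := dual_strand_R1 VR hg'.
have [E _ V2R] := mx_dec shT VR.
have /rows_choice[H hH] : forall j, exists h, entries_in TR1 h /\ row j (m2 V)^T = h *m D l.+1.
  move=> j; have [||v v1 hv] := onto (row j (m2 V)^T); last by exists v.
    by apply/row_entries_in/entries_inT.
  by rewrite -row_mul -[D l]trmxK -trmx_mul V2 trmx0 linear0.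
have V2E : m2 V = (D l.+1)^T *m H^T.
  rewrite -trmx_mul -[LHS]trmxK; congr trmx; apply/row_matrixP => j.
  by rewrite row_mul; have [_] := hH j.
have HR : entries_in TR1 H by apply: entries_in_row => j; have [] := hH j.
exists (kmx C + H^T).
  apply: entries_inD.
    by apply: (entries_in_sub (short_1 _ _)); apply: entries_in_kmx.
  by apply: (entries_in_sub (short_R1S _ _)); apply: entries_inT.
rewrite mulmxBr hZ' mulmxA mulmxDr -V1 -V2E.
have VE : m1 V + m2 V = V by rewrite [RHS]E V0 kmx0 add0r.
by rewrite VE hV subrr.
Qed.

Lemma dual_strand_onto_all l : dual_strand_onto l.
Proof.
apply: strand_spot_onto; elim: l => [|l IH]; first exact: strand_spot0.
exact: strand_spot_next IH (strand_spot_onto IH).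
Qed.

(** With e = f + 1: R1 [TE1] = [TE2] gives y_1 = f e - e. The quadratic kernel of [eps] has
    dimension f^2 - 1, since R2 [TE1] = [TE3] is a line, so y_2 = e y_1 - (f^2 - 1) = f y_1. Later
    terms satisfy y_(l+3) = e y_(l+2) - f y_(l+1). *)
Lemma dual_strand_dims : \dim R1 = (\dim R2).+1 ->
  [/\ y 0 = \dim R2, y 1 = (\dim R2 * \dim R2 - 1)%N & forall l, y l.+2 = (\dim R2 * y l.+1)%N].
Proof.
move=> dR; have dTR1 := dim_TR1 sh full; have dTR2 := dim_TR2 sh full.
have dTE1 := dim_TE1 sh full; have dTE2 := dim_TE2 sh full; have dTE3 := dim_TE3 sh.
have onto := dual_strand_onto_all.
have y0 : y 0 = \dim R2 by [].
have i1 : imgv TR1 eps = pointwise TE2 1.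
  apply/vspaceP => g; rewrite -[g]row_of_ffunK; apply/idP/idP => [/imgvP[v v1 ->]|/pointwiseP g2].
    apply/pointwiseP => i.
    rewrite ffunE; apply: (entries_inM (TR1_TE1 sh full)) => //; exact: eps_TE1.
  have := subvP (TE2_gen sh full nosoc) _ (g2 0); rewrite ffunE mxE => g2'.
  have [v v1 hv] : exists2 v : 'rV[T]_(\dim TE1), entries_in TR1 v & (g 0)%:M = v *m eps :> 'M_1.
    move: g2'; apply: (prodv_ind (P := fun x =>
      exists2 v : 'rV[T]_(\dim TE1), entries_in TR1 v & x%:M = v *m eps :> 'M_1)).
    - by exists 0; [apply: entries_in0 | rewrite mul0mx raddf0].
    - move=> u v [g1 h1 e1] [g3 h3 e3]; exists (g1 + g3); first exact: entries_inD.
      by rewrite mulmxDl -e1 -e3 raddfD.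
    - move=> a u [g1 h1 e1]; exists (kmx a%:M *m g1); first exact: entries_in_kmxl.
      rewrite -mulmxA -e1; apply/matrixP => i j; rewrite !ord1 !mxE big_ord1 !mxE !eqxx !mulr1n.
      by rewrite -scalerAl mul1r.
    - move=> u v u1 /eps_span[c hc]; exists (u *: kmx c).
        move=> i j; rewrite !mxE; apply: (subvP (subvv _)).
        by rewrite -scalerAr mulr1 rpredZ.
      by rewrite -scalemxAl -hc scale_scalar_mx.
  apply/imgvP; exists v => //; apply/rowP => i; rewrite !ord1 mxE.
  by have /matrixP/(_ 0 0) := hv; rewrite mxE eqxx mulr1n.
have y1 : (y 1 + \dim R1 = \dim R2 * \dim R1)%N.
  have := kdimE TR1 eps; rewrite i1 dim_pointwise mul1n [\dim TE2]dTE2 [\dim TR1]dTR1.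
  by rewrite [X in (X * _)%N]dTE1.
have i2 : imgv TR1 (D 1) = kerv TR2 eps.
  apply/vspaceP => g; rewrite -[g]row_of_ffunK; apply/idP/idP => [/imgvP[v v1 ->]|/kervP[w2 wD]]; [apply/kervP | apply/imgvP].
    split; last by rewrite -mulmxA kbasisM mulmx0.
    by apply: (entries_in_11 shT) => //; apply: kbasis_entries.
  exact: onto.
have i3 : imgv TR2 eps = pointwise TE3 1.
  apply/eqP; rewrite eqEdim dim_pointwise [\dim TE3]dTE3 andbC lt0n dimv_eq0.
  apply/andP; split; last first.
    apply/subvP => g; rewrite -[g]row_of_ffunK => /imgvP[v v1 ->].
    apply/pointwiseP => i; rewrite ffunE; apply: (entries_inM (TR2_TE1 sh full)) => //.
    exact: eps_TE1.
  apply/negP => /eqP z; have : (TE3 <= 0)%VS.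
    apply: subv_trans (TE3_gen sh full R2n0) _; apply/prodvP => u v u2 /eps_span[c hc].
    have : ffun_of_row (u *: kmx c *m eps) \in imgv TR2 eps.
      apply/imgvP; exists (u *: kmx c) => // i j; rewrite !mxE.
      by rewrite -scalerAr mulr1 rpredZ.
    rewrite z memv0 -scalemxAl -hc scale_scalar_mx => /eqP/ffunP/(_ 0).
    by rewrite !ffunE mxE eqxx mulr1n memv0 => ->.
  by move/dimvS; rewrite [\dim TE3]dTE3 dimv0.
have y2 : (y 2 + (\dim R2 * \dim R2 - 1) = y 1 * \dim R1)%N.
  have := kdimE TR1 (D 1); rewrite i2 [\dim TR1]dTR1 => <-; congr addn.
  have := kdimE TR2 eps; rewrite i3 dim_pointwise mul1n [\dim TE3]dTE3 [\dim TR2]dTR2.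
  by rewrite [X in (X * _)%N]dTE1 /kdim => <-; rewrite addnK.
have yS l : (y l.+3 + y l.+1 * \dim R2 = y l.+2 * \dim R1)%N.
  apply/esym; rewrite -dTR1 -dTR2.
  apply: (kdim_eq (short_11 shT)); first by apply: kbasis_entries.
  move=> w w2; apply: onto => //; apply: (entries_inM0 (short_21 shT)) w2 _.
  exact: kbasis_entries.
have y1' : y 1 = (\dim R2 * \dim R2 - 1)%N by move: y1; rewrite dR; lia.
split=> // l; elim: l => [|l IH]; first by move: y2; rewrite y1' dR; nia.
by have := yS l; rewrite IH dR; nia.
Qed.

End DualStrand.

(** * The strand of k over T *)

Section TrivextResidueStrand.
Variables (k : fieldType) (R : comFalgType k) (R1 R2 : {vspace R}).
Variables (p0 : 'Hom(R, k^o)) (p1 p2 : 'End(R)).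
Hypothesis sh : short_subring R1 R2 p0 p1 p2.
Hypothesis full : fullv = short_carrier R1 R2.
Hypothesis nosoc : forall x, x \in R1 -> (forall y, y \in R1 -> x * y = 0) -> x = 0.
Hypothesis R2n0 : R2 != 0%VS.
Local Notation T := (trivext R).
Local Notation kmx := (kmx T).
Local Notation TR1 := (TR1 p1).
Local Notation TR2 := (TR2 p2).
Local Notation TE1 := (TE1 p2).
Local Notation TE2 := (TE2 p1).
Local Notation T1 := (T1 p1 p2).
Local Notation T2 := (T2 p1 p2).
Local Notation T3 := (T3 p0).
Local Notation rpart M := (map_mx (tr1 p1) M).
Local Notation epart M := (map_mx (te1 p2) M).
Local Notation W i := (strand T1 (kstage T) i).
Local Notation w i := (srows (W i)).

Let gd := trivext_graded_duality sh full nosoc R2n0.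
Let shT := trivext_short sh full.

Lemma strandT_entries i : entries_in T1 (smx (W i)).
Proof. by case: i => [|i]; [move=> ? [] | apply: kbasis_entries]. Qed.

Lemma rpart_mul0 m n p (M : 'M[T]_(m, n)) (N : 'M[T]_(n, p)) :
  entries_in T1 M -> entries_in T1 N -> M *m N = 0 -> rpart M *m rpart N = 0.
Proof.
move=> /(T1_split sh full)[ME M1 M2] /(T1_split sh full)[NE N1 N2] MN.
have S : rpart M *m rpart N + (rpart M *m epart N + epart M *m rpart N) = 0.
  transitivity ((rpart M + epart M) *m (rpart N + epart N)); last by rewrite -ME -NE.
  rewrite mulmxDl 2!mulmxDr (TE1_TE1 sh full M2 N2).
  by move: (rpart M *m rpart N) (rpart M *m _) (_ *m rpart N) => X Y Z; rewrite addr0 addrA.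
have h1 : entries_in TR2 (rpart M *m rpart N) by apply: (entries_in_11 shT).
have h2 : entries_in TE2 (rpart M *m epart N + epart M *m rpart N).
  apply: entries_inD; last exact: (TE1_TR1_mx sh full).
  by apply: (T1_TE1_mx sh full) => //; apply: TR1_T1.
by have [] := TR2_TE2_sum0 sh full h1 h2 S.
Qed.

Section Homotopy.
Variable de : T.
Hypothesis de1 : de \in TE1.

(* A homotopy on the strand for multiplication by an element of E, up to the
   R-part of the differential: it shows that the columns are independent. *)
Lemma strandT_homotopy a : exists (S' : 'M[k]_(scols (W a), w a)) (S : 'M[k]_(w a, w a.+1)),
  kmx S *m smx (W a.+1) = de%:M - rpart (smx (W a)) *m kmx S'.
Proof.
have deM m n (M : 'M[T]_(m, n)) : entries_in T1 M -> de *: (M - rpart M) = 0.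
  move=> /(T1_split sh full)[ME _ M2]; rewrite {1}ME addrC addKr.
  by apply/matrixP => i j; rewrite [LHS]mxE [RHS]mxE
    (TEE0 sh full (TE_sub1 _ _ _) (TE_sub1 _ _ _) de1 (M2 i j)).
have main b (S' : 'M[k]_(scols (W b), w b)) :
    (de%:M - rpart (smx (W b)) *m kmx S') *m smx (W b) = 0 ->
    exists S : 'M[k]_(w b, w b.+1), kmx S *m smx (W b.+1) = de%:M - rpart (smx (W b)) *m kmx S'.
  move=> h; have [|S hS] := @kbasisPmx k T T1 _ _ _ (smx (W b)) (de%:M - rpart (smx (W b)) *m kmx S') _ h;
    last by exists S.
  apply: entries_inB.
    move=> i j; rewrite mxE; case: (_ == _); rewrite ?mulr1n ?mulr0n ?mem0v //.
    exact: (subvP (addvSr _ _)).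
  apply/entries_in_kmxr/TR1_T1 => i j; rewrite mxE; exact: tr1_in.
elim: a => [|a [S' [S hS]]].
  have [|S hS] := main 0%N 0; last by exists 0, S.
  by apply/matrixP => ? [].
have [|S2 hS2] := main a.+1 S; last by exists S, S2.
rewrite mulmxBl -mulmxA hS mul_scalar_mx mulmxBr mul_mx_scalar mulmxA.
rewrite rpart_mul0 ?kbasisM ?mul0mx ?subr0 -?scalerBr ?deM //; exact: strandT_entries.
Qed.

(** Applied to [x], the homotopy identity splits into an R-part and the E-part [de *: kmx x], which
    must vanish separately. *)
Lemma strandT_cols_free a (x : 'cV[k]_(w a)) : de != 0 -> smx (W a.+1) *m kmx x = 0 -> x = 0.
Proof.
move=> de0 Dx; have [S' [S hS]] := strandT_homotopy a.
have E : - (rpart (smx (W a)) *m kmx S') *m kmx x + de *: kmx x = 0.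
  by rewrite addrC -mul_scalar_mx -mulmxDl -hS -mulmxA Dx mulmx0.
have [|i j|_ h] := TR1_TE1_sum0 sh full _ _ E.
- rewrite mulNmx -mulmxA; apply: entries_inN; rewrite -kmxM; apply: entries_in_kmxr => i j.
  by rewrite mxE tr1_in.
- by rewrite !mxE /= -scalerAr mulr1 rpredZ.
apply/matrixP => i j; have /matrixP/(_ i j) := h; rewrite !mxE /= -scalerAr mulr1.
by move/eqP; rewrite scaler_eq0 (negbTE de0) orbF => /eqP.
Qed.

End Homotopy.

Lemma TE1_neq0 : exists2 de : T, de \in TE1 & de != 0.
Proof.
exists (vpick TE1); first exact: memv_pick.
by rewrite vpick0 -dimv_eq0 (dim_TE1 sh full) dimv_eq0.
Qed.

(** Otherwise some nonzero constant column x is orthogonal to the image. Then T2 kills the entries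
    of D x, which lie in T1, so D x = 0 by duality, against independence of the columns. *)
Lemma strandT_T3_onto a : imgv T2 (smx (W a.+1)) = pointwise T3 (w a).
Proof.
set D := smx (W a.+1); have D1 : entries_in T1 D := @strandT_entries a.+1.
have S : (imgv T2 D <= pointwise T3 (w a))%VS.
  apply/subvP => g; rewrite -[g]row_of_ffunK => /imgvP[v v2 ->].
  apply/pointwiseP => i; rewrite ffunE mxE rpred_sum // => j _.
  by rewrite mulrC (gd_12 gd).
apply/eqP; rewrite eqEdim S dim_pointwise (gd_dim3 gd) muln1 /=.
have [t t3 t0] : exists2 t, t \in T3 & t != 0.
  by exists (vpick T3); rewrite ?memv_pick // vpick0 -dimv_eq0 (gd_dim3 gd).
have T3t : T3 = <[t]>%VS.
  by apply/esym/eqP; rewrite eqEdim -memvE t3 (gd_dim3 gd) dim_vline t0.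
have co (g : {ffun 'I_(w a) -> T}) : g \in pointwise T3 (w a) ->
    exists c : 'rV[k]_(w a), row_of_ffun g = t *: kmx c.
  move/pointwiseP => g3; have /fin_all_exists[c hc] : forall i, exists c, g i = c *: t.
    by move=> i; have := g3 i; rewrite T3t => /vlineP.
  by exists (\row_i c i); apply/rowP => i; rewrite !mxE hc /= -scalerAr mulr1.
have /fin_all_exists[c hc] : forall i : 'I_(\dim (imgv T2 D)), exists c : 'rV[k]_(w a),
    row_of_ffun (vbasis (imgv T2 D))`_i = t *: kmx c.
  by move=> i; apply/co/(subvP S)/vbasis_mem/mem_nth; rewrite size_tuple.
pose V : 'M[k]_(_, w a) := \matrix_i c i.
rewrite leqNgt; apply/negP => lt.
have : kermx V^T != 0.
  rewrite -mxrank_eq0 mxrank_ker mxrank_tr -lt0n subn_gt0.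
  exact: leq_ltn_trans (rank_leq_row V) lt.
case/rowV0Pn => x /sub_kermxP xV x0; case/eqP: x0.
have [de de1 de0] := TE1_neq0.
apply: trmx_inj; rewrite trmx0; apply: (strandT_cols_free de1 de0).
have cx i : c i *m x^T = 0.
  have -> : c i = row i V by rewrite rowK.
  by rewrite -row_mul -[V]trmxK -trmx_mul xV trmx0 linear0.
have vDx (v : 'rV[T]_(w a.+1)) : entries_in T2 v -> v *m D *m kmx x^T = 0.
  move=> v2; have : ffun_of_row (v *m D) \in imgv T2 D by apply/imgvP; exists v.
  move/coord_vbasis => vE; pose cc i := coord (vbasis (imgv T2 D)) i (ffun_of_row (v *m D)).
  have -> : v *m D = \sum_i kmx (cc i)%:M *m (t *: kmx (c i)).
    rewrite -[LHS]ffun_of_rowK vE; apply/rowP => j.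
    rewrite mxE sum_ffunE summxE; apply: eq_bigr => i _; rewrite -hc ffunE.
    by rewrite [RHS]mxE big_ord1 !mxE eqxx mulr1n /= -scalerAl mul1r.
  rewrite mulmx_suml big1 // => i _; rewrite -mulmxA -scalemxAl -kmxM cx kmx0.
  by rewrite scaler0 mulmx0.
apply/matrixP => i j; rewrite [RHS]mxE ord1; apply: (gd_nondeg1 gd).
  exact: (@entries_in_kmxr _ _ T1 _ _ _ D x^T D1).
move=> z z2; have := vDx (z *: delta_mx 0 i).
rewrite -mulmxA -scalemxAl -rowE mulrC => /(_ _)/matrixP/(_ 0 0).
rewrite !mxE => -> // a1 b1; rewrite !mxE; case: (_ && _); rewrite ?mulr1 ?mulr0 ?mem0v //.
Qed.

Lemma strandT_dim1 : w 1 = \dim T1.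
Proof.
have := kdimE T1 (0 : 'M[T]_(1, 0)); rewrite mul1n => <-.
rewrite [X in (_ + X)%N](_ : _ = 0%N) ?addn0 //.
by apply/eqP; rewrite -leqn0; apply: leq_trans (dimvS (subvf _)) _; rewrite dimvf /dim /= card_ord mul0n.
Qed.

Lemma strandT_lower0 : (\dim T1 * \dim T1 <= w 2 + \dim T2)%N.
Proof.
have := kdim_ge (gd_11 gd) (@strandT_entries 1).
by rewrite [X in (X * _ <= _)%N]strandT_dim1 mul1n.
Qed.

(** Rows over T1 times the matrix of index i + 2 lie in the kernel on T2 of the matrix of index i +
    1, whose dimension is known exactly from [strandT_T3_onto]. *)
Lemma strandT_lower i :
  (\dim T1 * w i.+2 + w i <= w i.+3 + \dim T2 * w i.+1)%N.
Proof.
have k2 := kdimE T2 (smx (W i.+1)); rewrite strandT_T3_onto dim_pointwise (gd_dim3 gd) muln1 in k2.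
have k1 := kdimE T1 (smx (W i.+2)); rewrite -[kdim T1 _]/(w i.+3) in k1.
have : (\dim (imgv T1 (smx (W i.+2))) <= kdim T2 (smx (W i.+1)))%N.
  apply: dimvS; apply/subvP => g; rewrite -[g]row_of_ffunK => /imgvP[v v1 ->].
  apply/kervP; split; last by rewrite -mulmxA kbasisM mulmx0.
  by apply: (entries_inM (gd_11 gd)) => //; apply: strandT_entries.
by rewrite (mulnC (\dim T1)) -k1 (mulnC (\dim T2)) -k2 -addnA leq_add2l leq_add2r.
Qed.

Variables (b : nat -> nat) (dR : forall j, 'M[R]_(b j, b j.+1)).
Hypothesis lcR : left_complex R1 R2 dR.
Hypothesis dR12 : \dim R1 = (\dim R2).+1.
Hypothesis R2_gt1 : (1 < \dim R2)%N.
Hypothesis dex : forall ph : 'cV[R]_(b 1), dR 0 *m ph = 0 -> exists ps, ph = dR 1 *m ps.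

Lemma strandT_recurrence i :
  (w i.+3 + \dim T1 * w i.+1 = \dim T1 * w i.+2 + w i)%N /\ (w 2 + \dim T1 = \dim T1 * \dim T1)%N.
Proof.
have lc := trivext_left_complex sh full lcR.
set f := \dim R2; have [dT1 dT2] := trivext_dimT sh full.
have n_eq : \dim T1 = (2 * f).+1 by rewrite dT1 dR12 -/f; lia.
have n_eq2 : \dim T2 = (2 * f).+1 by rewrite dT2 dR12 -/f; lia.
have [y0 y1 yS] := dual_strand_dims sh full nosoc R2n0 lc (dual_spot sh full dex) dR12.
have eta_le := ubound_fixed y0 y1 yS (@betti_eps_bound _ _ _ _ _ _ _ sh full).
pose u l := srows (strand TR1 (kstage T) l); pose a i := ubound u (eta f) i 0.
have dTR1 := dim_TR1 sh full; have dTR2 := dim_TR2 sh full.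
have u1 : u 1%N = f.+1.
  by rewrite /u (strand_dim1 TR1) [LHS]dTR1 dR12.
have uS l : (u l.+2 + f * u l = f.+1 * u l.+1)%N.
  have := strand_dim_eq shT lc; rewrite [\dim TR1]dTR1 [\dim TR2]dTR2 dR12.
  by move=> /(_ _ _ l); rewrite -/f mulnC => ->; rewrite // mulnC.
have aS j := ubound_recurrence j (ltnW R2_gt1) (erefl : u 0%N = 1%N) u1 uS.
have wa j : (w j <= a j)%N.
  apply: leq_trans (betti_k_bound sh full j) _; apply: ubound_mono => l _; exact: eta_le.
have u2 := uS 0%N; rewrite u1 in u2.
have a2 : (a 2 + (2 * f).+1 = (2 * f).+1 * (2 * f).+1)%N.
  rewrite /a /= u1 /eta /=; move: u2; rewrite /u /= -/(u 2); move: (u 2) => U2.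
  by move: R2_gt1; rewrite -/f; nia.
have w2 := strandT_lower0; rewrite n_eq n_eq2 in w2.
(* The squeeze needs three exact initial values; this one is where [strandT_lower0] meets the upper
   bound. *)
have w2E : w 2 = a 2 by apply/eqP; rewrite eqn_leq wa andTb -(leq_add2r (2 * f).+1) a2.
have wE : forall j, w j = a j.
  apply: (recurrence_squeeze wa (n := (2 * f).+1)) => //.
  - by move=> j; have := strandT_lower j; rewrite n_eq n_eq2.
  - by rewrite strandT_dim1 n_eq /a /= u1 /u /eta /= /f; lia.
rewrite n_eq !wE; split; first exact: aS.
exact: a2.
Qed.

End TrivextResidueStrand.

(** * The quotient by the socle *)

Section SocleQuotientStages.
Variables (k : fieldType) (A : comFalgType k) (A1 A2 A3 : {vspace A}).
Variables (c0 : 'Hom(A, k^o)) (q1 q2 q3 : 'End(A)).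
Hypothesis gd : graded_duality A1 A2 A3 c0 q1 q2 q3.
Local Notation kmx := (kmx A).
Local Notation kbasis := (kbasis A1).

Lemma gdmx_dec m n (M : 'M[A]_(m, n)) :
  M = kmx (map_mx c0 M) + map_mx q1 M + map_mx q2 M + map_mx q3 M.
Proof. by apply/matrixP => i j; rewrite !mxE; exact: (gd_dec gd (M i j)). Qed.

Lemma gdmx_in m n (M : 'M[A]_(m, n)) :
  [/\ entries_in A1 (map_mx q1 M), entries_in A2 (map_mx q2 M) & entries_in A3 (map_mx q3 M)].
Proof. by split=> i j; rewrite mxE; have [] := gd_in gd (M i j). Qed.

Lemma gdmx_sum0 m n (X Y Z : 'M[A]_(m, n)) : entries_in A1 X -> entries_in A2 Y ->
  entries_in A3 (X + Y + Z) -> entries_in A3 Z -> X = 0 /\ Y = 0.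
Proof.
move=> HX HY HS HZ.
have H i j : X i j = 0 /\ Y i j = 0.
  have [_ x1 x2 _] := gd_A1 gd (HX i j); have [_ y1 y2 _] := gd_A2 gd (HY i j).
  have [_ z1 z2 _] := gd_A3 gd (HZ i j); have [_ s1 s2 _] := gd_A3 gd (HS i j).
  move: s1 s2; rewrite !mxE !linearD /= x1 x2 y1 y2 z1 z2 !addr0 add0r.
  by [].
by split; apply/matrixP => i j; rewrite [RHS]mxE; have [] := H i j.
Qed.

Lemma gdmx_mulA1 m n p (v : 'M[A]_(m, n)) (M : 'M[A]_(n, p)) : entries_in A1 M ->
  v *m M = kmx (map_mx c0 v) *m M + map_mx q1 v *m M + map_mx q2 v *m M.
Proof.
move=> HM; have [_ _ v3] := gdmx_in v.
rewrite {1}(gdmx_dec v) !mulmxDl (entries_inM0 (_ : forall x y, x \in A3 -> y \in A1 -> x * y = 0) v3 HM) ?addr0 //.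
by move=> x y x3 y1; rewrite mulrC (gd_13 gd).
Qed.

Lemma gdmx_mulA2 m n p (v : 'M[A]_(m, n)) (M : 'M[A]_(n, p)) : entries_in A2 M ->
  v *m M = kmx (map_mx c0 v) *m M + map_mx q1 v *m M.
Proof.
move=> HM; have [_ v2 v3] := gdmx_in v.
rewrite {1}(gdmx_dec v) !mulmxDl (entries_inM0 (gd_22 gd) v2 HM) addr0.
rewrite (entries_inM0 (_ : forall x y, x \in A3 -> y \in A2 -> x * y = 0) v3 HM) ?addr0 //.
by move=> x y x3 y1; rewrite mulrC (gd_23 gd).
Qed.

Lemma gdmx_21 m n p (M : 'M[A]_(m, n)) (N : 'M[A]_(n, p)) :
  entries_in A2 M -> entries_in A1 N -> entries_in A3 (M *m N).
Proof. by apply: entries_inM => x y x2 y1; rewrite mulrC (gd_12 gd). Qed.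

Lemma gdmx_A3l m n p (M : 'M[A]_(m, n)) (N : 'M[A]_(n, p)) :
  entries_in A3 N -> entries_in A3 (M *m N).
Proof.
move=> N3; apply: (entries_inM (_ : forall x y, x \in fullv -> y \in A3 -> x * y \in A3)) N3.
  move=> x y _ y3.
  rewrite (gd_dec gd x) !mulrDl; have [x1 x2 x3] := gd_in gd x.
  rewrite (gd_13 gd x1 y3) (gd_23 gd x2 y3) (gd_33 gd x3 y3) !addr0 /= -scalerAl mul1r.
  exact: rpredZ.
by move=> i j; apply: memvf.
Qed.

Section Stage.
Variable s : stage A.
Local Notation K := (kbasis (smx s)).

(** Modulo A3 every row over A2 is killed by a minimal differential. The complement collects the
    syzygies of this kind not generated by the linear ones. *)
Definition qcompl : {vspace {ffun 'I_(srows s) -> A}} :=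
  (pointwise A2 (srows s) :\: imgv A1 K)%VS.
Definition qcount := \dim qcompl.
Definition qbasis : 'M[A]_(qcount, srows s) := \matrix_i row_of_ffun (vbasis qcompl)`_i.
Definition qdiff : 'M[A]_(kdim A1 (smx s) + qcount, srows s) := col_mx K qbasis.
(** The linear part of [qdiff]. Modulo A3 the quadratic rows are killed by A1, so for linear
    syzygies they count as zero rows. *)
Definition qnext : stage A := Stage (col_mx K (0 : 'M_(qcount, srows s))).

Lemma imgv_K_A2 : (imgv A1 K <= pointwise A2 (srows s))%VS.
Proof.
apply/subvP => g; rewrite -[g]row_of_ffunK => /imgvP[v v1 ->]; apply/pointwiseP => i.
rewrite ffunE; apply: (entries_inM (gd_11 gd)) => //; exact: kbasis_entries.
Qed.

Lemma qcountE : (qcount + \dim A1 * betti A1 (smx s) 1 =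
  \dim A2 * betti A1 (smx s) 0 + betti A1 (smx s) 2)%N.
Proof.
rewrite !betti1 betti0 bettiS betti1.
have := dimv_cap_compl (pointwise A2 (srows s)) (imgv A1 K).
rewrite (capv_idPr imgv_K_A2) dim_pointwise -/qcount mulnC => h.
have := kdimE A1 K; rewrite [X in _ = X -> _]mulnC => <-.
by rewrite -h; lia.
Qed.

Lemma qbasis_comb (x : 'rV[k]_qcount) :
  ffun_of_row (kmx x *m qbasis) = \sum_i x 0 i *: (vbasis qcompl)`_i.
Proof.
apply/ffunP => j; rewrite ffunE mxE sum_ffunE; apply: eq_bigr => i _.
by rewrite !mxE !ffunE -scalerAl mul1r.
Qed.

Lemma qbasis_mem (x : 'rV[k]_qcount) : ffun_of_row (kmx x *m qbasis) \in qcompl.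
Proof.
by rewrite qbasis_comb rpred_sum // => i _; rewrite rpredZ // vbasis_mem // mem_nth // size_tuple.
Qed.

Lemma qbasis_span g : g \in qcompl -> exists x, row_of_ffun g = kmx x *m qbasis.
Proof.
move=> /coord_vbasis gE; exists (\row_i coord (vbasis qcompl) i g).
apply: (can_inj (@ffun_of_rowK k A _)); rewrite row_of_ffunK qbasis_comb {1}gE.
by apply: eq_bigr => i _; rewrite mxE.
Qed.

Lemma qbasis_A2 : entries_in A2 qbasis.
Proof.
move=> i j; rewrite !mxE; have : (vbasis qcompl)`_i \in pointwise A2 (srows s).
  have : (vbasis qcompl)`_i \in qcompl by rewrite vbasis_mem // mem_nth // size_tuple.
  exact: (subvP (diffvSl _ (imgv A1 K))).
by move/pointwiseP.
Qed.

Lemma qbasis_indep (x : 'rV[k]_qcount) (t : 'rV[A]_(kdim A1 (smx s))) : entries_in A1 t ->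
  t *m K + kmx x *m qbasis = 0 -> x = 0 /\ t *m K = 0.
Proof.
move=> t1 E; have xQ : kmx x *m qbasis = (- t) *m K.
  by apply/eqP; rewrite mulNmx -addr_eq0 addrC E.
have : ffun_of_row (kmx x *m qbasis) \in (qcompl :&: imgv A1 K)%VS.
  rewrite memv_cap qbasis_mem /=; apply/imgvP; exists (- t) => //.
  exact: entries_inN.
rewrite capv_diff memv0 => /eqP Q0.
have Q00 : kmx x *m qbasis = 0.
  by apply: (can_inj (@ffun_of_rowK k A _)); rewrite Q0; apply/ffunP => i; rewrite !ffunE mxE.
split; last by move: E; rewrite Q00 addr0.
have /freeP := basis_free (vbasisP qcompl) => /(_ (fun i => x 0 i)) H.
by apply/rowP => i; rewrite mxE; apply: H; rewrite -qbasis_comb.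
Qed.

Lemma qdiff_max : entries_in (gd_max A1 A2 A3) qdiff.
Proof.
apply: entries_in_col_mx.
  by apply: (entries_in_sub (gd_A1m A1 A2 A3)); apply: kbasis_entries.
by apply: (entries_in_sub (gd_A2m A1 A2 A3)); apply: qbasis_A2.
Qed.

(** The linear part of [v] is a combination of the rows of [K] over k. The quadratic part splits
    along the chosen complement into a combination of [qbasis] over k and one of [K] over A1. *)
Lemma qdiff_onto (v : 'rV[A]_(srows s)) : map_mx c0 v = 0 -> map_mx q1 v *m smx s = 0 ->
  exists w, entries_in A3 (v - w *m qdiff).
Proof.
move=> v0 v1s; have [v1 v2 v3] := gdmx_in v; have [c hc] := kbasisP v1 v1s.
have : ffun_of_row (map_mx q2 v) \in (qcompl + (pointwise A2 (srows s) :&: imgv A1 K))%VS.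
  by rewrite addv_diff_cap; apply/pointwiseP => i; rewrite ffunE.
case/memv_addP => g gQ [h]; rewrite memv_cap => /andP[_ hI] E.
have [x hx] := qbasis_span gQ.
have [t t1 ht] := (imgvP A1 K (row_of_ffun h)).1 (etrans (congr1 _ (row_of_ffunK h)) hI).
exists (row_mx (kmx c + t) (kmx x)).
have vE : v = map_mx q1 v + map_mx q2 v + map_mx q3 v.
  by rewrite {1}(gdmx_dec v) v0 kmx0 add0r.
have v2E : map_mx q2 v = kmx x *m qbasis + t *m K.
  rewrite -hx -ht -[LHS]ffun_of_rowK E; apply/rowP => i; by rewrite !mxE ffunE.
have -> : v - row_mx (kmx c + t) (kmx x) *m qdiff = map_mx q3 v; last exact: v3.
rewrite mul_row_col mulmxDl -hc {1}vE v2E.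
move: (map_mx q1 v) (kmx x *m _) (t *m K) (map_mx q3 v) => X Y Z U.
by rewrite [Y + Z]addrC !addrA [X + Z + Y + U]addrC addrK.
Qed.

End Stage.

Lemma qdiff_exact (s : stage A) (v : 'rV[A]_(srows (qnext s))) :
  entries_in A3 (v *m qdiff s) <-> exists w, entries_in A3 (v - w *m qdiff (qnext s)).
Proof.
split; last first.
  case=> w hw; have -> : v *m qdiff s = (v - w *m qdiff (qnext s)) *m qdiff s +
      w *m (qdiff (qnext s) *m qdiff s) by rewrite mulmxBl mulmxA subrK.
  apply: entries_inD.
    by rewrite -[X in entries_in _ X]trmxK trmx_mul; apply/entries_inT/gdmx_A3l/entries_inT.
  apply: gdmx_A3l; rewrite /qdiff mul_col_mx; apply: entries_in_col_mx.
    have K0 := kbasisM A1 (smx (qnext s)); have K1 := @kbasis_entries _ _ A1 _ _ (smx (qnext s)).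
    move: (kbasis (smx (qnext s))) K0 K1 => K' K0 K1.
    rewrite -[K']hsubmxK in K0 K1 *; have [_ K1r] := (entries_in_row_mx _ _ _).1 K1.
    move: K0; rewrite !mul_row_col mulmx0 addr0 => ->; rewrite add0r.
    by apply: (entries_inM (gd_12 gd)) K1r _; apply: qbasis_A2.
  apply: (entries_inM (_ : forall x y, x \in A2 -> y \in (gd_max A1 A2 A3) -> x * y \in A3));
    [|exact: qbasis_A2|exact: qdiff_max].
  move=> x y x2 /memv_addP[a a1 [_ /memv_addP[b b2 [c c3 ->]] ->]].
  rewrite !mulrDr (gd_22 gd x2 b2) (gd_23 gd x2 c3) !addr0 mulrC.
  exact: (gd_12 gd).
move=> vQ; have K1 := @kbasis_entries _ _ A1 _ _ (smx s); have Q2 := @qbasis_A2 s.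
rewrite -[v]hsubmxK mul_row_col (gdmx_mulA1 _ K1) (gdmx_mulA2 _ Q2) in vQ.
set v' := lsubmx v in vQ; set v'' := rsubmx v in vQ.
have [v1 v2 _] := gdmx_in v'; have [u1 _ _] := gdmx_in v''.
have [|||| e1 e2] := @gdmx_sum0 _ _ (kmx (map_mx c0 v') *m kbasis (smx s))
  (map_mx q1 v' *m kbasis (smx s) + kmx (map_mx c0 v'') *m qbasis s)
  (map_mx q2 v' *m kbasis (smx s) + map_mx q1 v'' *m qbasis s).
- exact: entries_in_kmxl.
- apply: entries_inD; last exact: entries_in_kmxl.
  exact: (entries_inM (gd_11 gd)).
- by move: vQ; rewrite -!addrA [in X in _ -> X](addrCA (kmx (map_mx c0 v'') *m _)).
- apply: entries_inD; first exact: gdmx_21.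
  exact: (entries_inM (gd_12 gd)).
have a0 : map_mx c0 v' = 0 := kbasis_free e1.
have [b0 e3] := qbasis_indep v1 e2.
apply: qdiff_onto.
  by rewrite -[v]hsubmxK map_row_mx a0 b0 row_mx0.
by rewrite -[v]hsubmxK map_row_mx mul_row_col mulmx0 addr0.
Qed.

End SocleQuotientStages.

Section QuotientMorphism.
Variables (k : fieldType) (A : comFalgType k) (I : {vspace A}).

Fact quot_proj_monoid : monoid_morphism (@quot_proj k A I).
Proof. by split=> // x y; rewrite quot_projM. Qed.
HB.instance Definition _ := GRing.isMonoidMorphism.Build A (quot_alg I) (@quot_proj k A I)
  quot_proj_monoid.

End QuotientMorphism.

Section SocleQuotientResolution.
Variables (k : fieldType) (A : comFalgType k) (A1 A2 A3 : {vspace A}).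
Variables (c0 : 'Hom(A, k^o)) (q1 q2 q3 : 'End(A)).
Hypothesis gd : graded_duality A1 A2 A3 c0 q1 q2 q3.
Local Notation n := (\dim A1).
Local Notation w i := (srows (strand A1 (kstage A) i)).
Hypothesis A12 : \dim A2 = n.
Hypothesis w2 : (w 2 + n = n * n)%N.
Hypothesis wS : forall i, (w i.+3 + n * w i.+1 = n * w i.+2 + w i)%N.

Definition qstage j : stage A := iter j (qnext A1 A2) (kstage A).
Local Notation r j := (srows (qstage j)).
Local Notation B j i := (betti A1 (smx (qstage j)) i).
Local Notation c j := (qcount A1 A2 (qstage j)).

Lemma qstage_bettiS j i : B j.+1 i = (B j i.+1 + c j * w i)%N.
Proof. by rewrite bettiS; apply: betti_col0. Qed.

Lemma qstage_rec j i : (B j i.+3 + n * B j i.+1 = n * B j i.+2 + B j i)%N.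
Proof.
elim: j i => [|j IH] i; first exact: wS.
rewrite !qstage_bettiS; have := IH i.+1; have := wS i.
move: (B j i.+4) (B j i.+3) (B j i.+2) (B j i.+1) => x4 x3 x2 x1.
move: (w i.+3) (w i.+2) (w i.+1) (w i) (c j) n => y3 y2 y1 y0 d m h1 h2.
have := congr1 (muln d) h1; rewrite !mulnDr; lia.
Qed.

Lemma qstage_count j : (c j + n * B j 1 = n * B j 0 + B j 2)%N.
Proof. by rewrite -{2}A12; apply: (qcountE gd). Qed.

Lemma qstage_w1 : w 1 = n. Proof. exact: strand_dim1. Qed.

Lemma qstage_c0 : c 0 = 0%N.
Proof.
have := qstage_count 0; rewrite -[B 0 1]/(w 1) -[B 0 0]/1%N -[B 0 2]/(w 2) qstage_w1 muln1.
by move: w2; lia.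
Qed.

(** Each generator of step j causes one quadratic syzygy two steps later; this is the z^2 by which
    the inverse series of T / t^3 differs from that of T. *)
Lemma qstage_cS j : c j.+1 = r j.
Proof.
have := qstage_count j.+1; rewrite !qstage_bettiS qstage_w1; have := qstage_rec j 0.
rewrite -[w 0]/1%N betti0; move: (r j) (B j 3) (B j 2) (B j 1) (c j) (c j.+1) => x0 x3 x2 x1 d d'.
have := congr1 (muln d) w2; move: (w 2) n => y2 m; rewrite !mulnDr => h1 h2 h3.
have : (m * (d * m) = d * (m * m))%N by rewrite mulnCA.
by lia.
Qed.

Lemma qstage_rank0 : [/\ r 0 = 1%N, r 1 = n & (r 2 + n = n * n + 1)%N].
Proof.
have rB j : r j.+1 = (B j 1 + c j)%N by rewrite -[LHS]/(B j.+1 0) qstage_bettiS muln1.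
split=> //; first by rewrite rB qstage_c0 addn0 -[B 0 1]/(w 1) qstage_w1.
by rewrite rB qstage_bettiS qstage_cS qstage_c0 mul0n addn0 -[B 0 2]/(w 2) addnAC w2.
Qed.

Lemma qstage_rank j : (r j.+3 + n * r j.+1 = n * r j.+2 + r j.+1 + r j)%N.
Proof.
have rB i : r i.+1 = (B i 1 + c i)%N by rewrite -[LHS]/(B i.+1 0) qstage_bettiS muln1.
have := qstage_rec j 0; rewrite betti0.
have r2 : r j.+2 = (B j 2 + c j * n + r j)%N.
  by rewrite rB qstage_bettiS qstage_w1 qstage_cS.
have r3 : r j.+3 = (B j 3 + c j * w 2 + r j * n + r j.+1)%N.
  by rewrite rB !qstage_bettiS qstage_w1 !qstage_cS.
rewrite r3 r2 rB; move: (r j) (B j 3) (B j 2) (B j 1) (c j) => x0 x3 x2 x1 d.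
have := congr1 (muln d) w2; move: (w 2) n => y2 m; rewrite !mulnDr => h1 h2.
have : (m * (d * m) = d * (m * m))%N by rewrite mulnCA.
have := mulnC d m; have := mulnC x0 m; lia.
Qed.

Local Notation t := (gd_max A1 A2 A3).
Local Notation I := (ideal_pow t 3).
Local Notation Q := (quot_alg I).
Local Notation pr := (@quot_proj k A I).
Local Notation pm M := (map_mx pr M).
Local Notation mbar := (quot_image I t).

Lemma socle_quot_ideal : proper_ideal_part I = A3.
Proof.
rewrite /proper_ideal_part (gd_ideal_pow gd) /= ifT //; apply/andP; split.
  apply/prodvP => x y _ y3; have := @gdmx_A3l _ _ _ _ _ _ _ _ _ gd 1 1 1 x%:M y%:M.
  move=> /(_ _ 0 0); rewrite !mxE big_ord1 !mxE eqxx !mulr1n; apply=> i j.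
  by rewrite mxE !ord1 eqxx.
apply/negP => /(gd_A3 gd)[h _ _ _]; have [o _ _ _] := gd_one gd.
by move: h; rewrite o => /eqP; rewrite oner_eq0.
Qed.

Lemma socle_quot0 x : (pr x == 0) = (x \in A3).
Proof. by rewrite quot_proj_eq0 socle_quot_ideal. Qed.

Lemma socle_quot_mx0 p q (M : 'M[A]_(p, q)) : pm M = 0 <-> entries_in A3 M.
Proof.
split=> [h i j|h]; first by rewrite -socle_quot0; have /matrixP/(_ i j) := h; rewrite !mxE => ->.
by apply/matrixP => i j; rewrite !mxE; apply/eqP; rewrite socle_quot0.
Qed.

Lemma socle_quot_lift p q (M : 'M[Q]_(p, q)) : exists N : 'M[A]_(p, q), M = pm N.
Proof. by exists (map_mx vsval M); apply/matrixP => i j; rewrite !mxE quot_projK. Qed.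

Lemma mbarP x : x \in mbar -> exists2 y, y \in t & x = pr y.
Proof. by case/memv_imgP => y yt ->; exists y => //; rewrite lfunE. Qed.

Lemma mbar_pr y : y \in t -> pr y \in mbar.
Proof. by move=> yt; apply/memv_imgP; exists y => //; rewrite lfunE. Qed.

Lemma mbar_disjoint : (1 :&: mbar = 0)%VS.
Proof.
apply/eqP; rewrite -subv0; apply/subvP => x; rewrite memv_cap memv0.
case/andP => /vlineP[a ->] /mbarP[y yt E].
have : pr (a%:A - y) == 0 by rewrite raddfB /= linearZ /= rmorph1 E subrr.
rewrite socle_quot0 => /(gd_A3 gd)[h _ _ _].
have y0 : c0 y = 0 by apply/(gd_maxP gd).
have a0 : a = 0.
  move: h; rewrite linearB /= y0 subr0 linearZ /=; have [-> _ _ _] := gd_one gd.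
  by rewrite /GRing.scale /= mulr1.
by rewrite a0 scale0r.
Qed.

Lemma mbar_ideal a x : x \in mbar -> a * x \in mbar.
Proof.
move=> /mbarP[y yt ->]; rewrite -[a]quot_projK -rmorphM; apply: mbar_pr.
exact: (gd_max_ideal gd).
Qed.

Lemma residue_pr x : residue mbar (pr x) = c0 x.
Proof.
pose a : k := c0 x; have xt : x - in_alg A a \in t.
  have e : c0 a%:A = a := gd_c0_alg gd a.
  by apply/(gd_maxP gd); rewrite linearB /= e subrr.
have -> : pr x = a *: 1 + pr (x - in_alg A a).
  by rewrite raddfB /= linearZ /= rmorph1 addrC subrK.
rewrite (residue_is_linear mbar a 1 (pr (x - in_alg A a))) (residue1 mbar_disjoint).
by rewrite (residue_m mbar_disjoint (mbar_pr xt)) addr0 /GRing.scale /= mulr1.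
Qed.

Lemma residue_pm p q (M : 'M[A]_(p, q)) : map_mx (residue mbar) (pm M) = map_mx c0 M.
Proof. by apply/matrixP => i j; rewrite !mxE residue_pr. Qed.

Lemma c0_max p q (M : 'M[A]_(p, q)) : entries_in t M -> map_mx c0 M = 0.
Proof. by move=> h; apply/matrixP => i j; rewrite !mxE; apply/(gd_maxP gd). Qed.

Definition qres_diff j : 'M[Q]_(r j.+1, r j) := pm (qdiff A1 A2 (qstage j)).

Lemma qres_aug_surj (x : 'M[k]_1) :
  exists v : 'rV[Q]_(r 0), map_mx (residue mbar) v *m (1%:M : 'cV[k]_1) = x.
Proof.
exists (pm (kmx A x)); rewrite residue_pm mulmx1; apply/matrixP => i j; rewrite !mxE.
exact: (gd_c0_alg gd).
Qed.

Lemma qres_exact0 (v : 'rV[Q]_(r 0)) :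
  map_mx (residue mbar) v *m (1%:M : 'cV[k]_1) = 0 <-> exists w, v = w *m qres_diff 0.
Proof.
rewrite mulmx1; have [V ->] := socle_quot_lift v; rewrite residue_pm; split.
  move=> V0; have [|u hu] := qdiff_onto gd (s := qstage 0) V0; first by apply/matrixP => ? [].
  exists (pm u); rewrite /qres_diff -map_mxM; apply/eqP; rewrite -subr_eq0 -map_mxB; apply/eqP.
  exact/socle_quot_mx0.
case=> u; have [U ->] := socle_quot_lift u; rewrite /qres_diff -map_mxM => /eqP.
rewrite -subr_eq0 -map_mxB => /eqP/socle_quot_mx0 h.
apply: c0_max; rewrite -[V](subrK (U *m qdiff A1 A2 (qstage 0))); apply: entries_inD.
  exact: (entries_in_sub (gd_A3m A1 A2 A3)).
apply: (entries_inM (_ : forall x y, x \in fullv -> y \in t -> x * y \in t)).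
- by move=> x y _; apply: (gd_max_ideal gd).
- by move=> i j; apply: memvf.
exact: qdiff_max.
Qed.

Lemma qres_exactS j (v : 'rV[Q]_(r j.+1)) :
  v *m qres_diff j = 0 <-> exists w, v = w *m qres_diff j.+1.
Proof.
have [V ->] := socle_quot_lift v; rewrite /qres_diff -map_mxM.
split=> [/socle_quot_mx0/(qdiff_exact gd)[u hu]|[u]].
  exists (pm u); rewrite -map_mxM; apply/eqP; rewrite -subr_eq0 -map_mxB; apply/eqP.
  exact/socle_quot_mx0.
have [U ->] := socle_quot_lift u; rewrite -map_mxM => /eqP.
rewrite -subr_eq0 -map_mxB => /eqP/socle_quot_mx0 h.
by apply/socle_quot_mx0/(qdiff_exact gd); exists U.
Qed.

Definition qres : resolution mbar :=
  @Resolution k Q mbar (fun j => r j) qres_diff 1%:M qres_aug_surj qres_exact0 qres_exactS.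

(** The resolution is minimal, so all its differentials vanish over k. *)
Lemma qres_tor_dim j : tor_dim qres j = r j.
Proof.
have rk i : \rank (map_mx (residue mbar) (res_diff qres i)) = 0%N.
  by rewrite /= /qres_diff residue_pm c0_max ?mxrank0 //; apply: qdiff_max.
by rewrite /tor_dim rk; case: j => [|j]; rewrite ?rk !subn0.
Qed.

(** Every element of the maximal ideal has cube 0, so none is regular. *)
Lemma mbar_depth : depth mbar 0.
Proof.
split.
  exists [::]; split=> //; split=> // -[x]; rewrite big_ord0 => /eqP.
  by rewrite oner_eq0.
case=> [//|x s] /= /andP[xm _] [reg _]; exfalso.
have [y yt xE] := mbarP xm.
have y3 : y ^+ 3 \in A3.
  rewrite -[A3]/(gd_ideal A1 A2 A3 3) -(gd_expv gd) !exprS expr0 mulr1.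
  by rewrite !expvSl expv0 prodv1 !memv_mul.
have x3 : x ^+ 3 = 0.
  by rewrite xE -rmorphXn; apply/eqP; rewrite socle_quot0.
have reg0 a : a * x = 0 -> a = 0.
  move=> ax; have [|e ->] := reg 0%N isT a; last by rewrite big_ord0.
  by exists (fun=> 0); rewrite ax /= big_ord0.
have := reg0 1; rewrite mul1r.
have x0 : x = 0.
  by apply: (reg0 x); apply: reg0; rewrite -[RHS]x3 !exprS expr0 mulr1 mulrA.
by move/(_ x0)/eqP; rewrite oner_eq0.
Qed.

Lemma socle_quot_not_golod : ~ golod mbar.
Proof.
move=> gol; have [s mins] := minimal_generators_exist mbar_ideal.
have := gol (size s) 0%N (in_tuple s) qres mins mbar_depth.
set e := size s; rewrite subn0; set den := 1 - _; move=> H.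
(* N is the degree of (1 + z)^e q, whose top coefficient is -1. The series of ranks may be truncated
   there, as only coefficients up to N are compared. *)
pose N := e.+3; pose rp : {poly int} := \poly_(i < N.+1) (r i)%:Z.
pose qp : {poly int} := 1 - n%:Z *: 'X + (n%:Z - 1) *: 'X^2 - 'X^3.
pose E : {poly int} := (1 + 'X) ^+ e.
have rpE i : (i <= N)%N -> rp`_i = (r i)%:Z by move=> iN; rewrite coef_poly ltnS iN.
have rden i : (i <= N)%N -> (rp * den)`_i = E`_i.
  move=> iN; rewrite -H coefMr; apply: eq_bigr => j _; rewrite rpE ?qres_tor_dim //.
  by apply: leq_trans iN; apply: leq_subr.
have [r0 r1 r2] := qstage_rank0.
have rq i : (i <= N)%N -> (rp * qp)`_i = (i == 0%N)%:R.
  move=> iN; rewrite /qp mulrBr mulrDr mulrBr mulr1 -!scalerAr !(coefB, coefD).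
  rewrite !coefZ -['X]expr1 !coefMXn.
  case: i iN => [|[|[|i]]] iN; rewrite ?subSS ?subn0 /= !rpE;
    try by move: iN; rewrite /N; lia.
  by have := qstage_rank i; lia.
(* The Golod denominator has degree at most e + 1. *)
have den0 : den`_N = 0.
  rewrite coefB coef1 coef_sum big_nat big1 ?subr0 // => j /andP[_ je].
  by rewrite coefZ coefXn (_ : (N == j.+1) = false) ?mulr0 //; apply/eqP; rewrite /N; lia.
(* Up to degree N the product [rp * qp] is 1, so this coefficient is that of [den]; grouping
   [rp * den] first gives that of (1 + z)^e q. *)
have c1 : (rp * qp * den)`_N = 0.
  rewrite coefM (bigD1 ord0) //= subn0 den0 mulr0 add0r big1 // => j j0.
  have jn : (j == 0%N :> nat) = false by apply: negbTE.
  by rewrite rq ?jn ?mul0r // -ltnS.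
have Ehi i : (e < i)%N -> E`_i = 0.
  move=> ei; rewrite /E addrC -['X + 1]/('X + 1%:P) nth_default //.
  by apply: leq_trans (size_poly_exp_leq _ _) _; rewrite size_XaddC mul1n.
have Ee : E`_e = 1.
  have mon : ('X + 1 : {poly int}) \is monic by rewrite -['X + 1]/('X + 1%:P) monicXaddC.
  have := monic_exp e mon; rewrite monicE lead_coefE => /eqP.
  by rewrite size_exp -['X + 1]/('X + 1%:P) size_XaddC mul1n /E addrC.
have c2 : (rp * den * qp)`_N = (E * qp)`_N.
  rewrite !coefM; apply: eq_bigr => j _; rewrite rden //; exact: (ltn_ord j).
have c3 : (E * qp)`_N = -1.
  rewrite /qp mulrBr mulrDr mulrBr mulr1 -!scalerAr !(coefB, coefD) !coefZ -['X]expr1 !coefMXn /N /=.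
  rewrite !subSS !subn0 Ee !Ehi ?mulr0 ?subr0 ?addr0 ?sub0r //; lia.
by have := c1; rewrite mulrAC c2 c3.
Qed.

End SocleQuotientResolution.

Section GradedEmbdim.
Variables (k : fieldType) (R : comFalgType k) (G : nat -> {vspace R}) (m : {vspace R}).
Hypothesis std : standard_graded_local m G.
Hypothesis soc : socle_degree m 2.

Lemma graded_embdim e : embdim m e <-> e = \dim (G 1%N).
Proof.
have sh := graded_short std soc; have full := graded_full std soc.
have mE := graded_mE std soc.
apply: (embdimE (c0 := gp0 m) (q1 := gp1 G)).
- exact: (graded_m_ideal std soc).
- by rewrite mE addvSl.
- rewrite mE => _ /memv_addP[x x1 [y y2 ->]].
  have [i0 iD iM ii] := in_idl_ideal (vbasis (G 1%N)).
  apply: (iD _ _ (in_idl_vbasis x1)); move: y2; apply: prodv_ind => // [a z|u v u1 _].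
    by rewrite -mulr_algl; apply: iM.
  by rewrite mulrC; apply/iM/in_idl_vbasis.
- by move=> x /(short_R1 sh)[].
- move=> a z zm; have /memv_addP[x x1 [y y2 ->]] : z \in (G 1%N + G 1%N * G 1%N)%VS by rewrite -mE.
  have [_ h _] := R1_mul sh full a x1; have [_ xx _] := short_R1 sh x1.
  have [_ yy _] := short_R2 sh y2.
  by rewrite mulrC mulrDl !linearD /= h (R2_mul sh full a y2) linearZ /= xx yy !scaler0 !addr0.
Qed.

End GradedEmbdim.

Theorem mainTheorem5 (k : fieldType) (R : comFalgType k)
    (G : nat -> {vspace R}) (m : {vspace R}) (e : nat) (F : complex R) :
  standard_graded_local m G ->
  embdim m e -> (3 <= e)%N ->
  socle_degree m 2 ->
  ~ gorenstein R ->
  nonzero_complex F -> minimal_complex m F -> acyclic F ->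
  let T := trivext R in
  let t : {vspace T} := trivext_max m in
  (exists GT : nat -> {vspace T}, trivext_grading G GT /\ graded_local t GT) /\
  gorenstein T /\
  compressed t /\
  (forall i, hilb t i = nth 0%N [:: 1; 2 * e - 1; 2 * e - 1; 1]%N i) /\
  ~ complete_intersection T /\
  ((~ exists a : R, exact_zero_divisor a) ->
     ~ exists a : T, exact_zero_divisor a) /\
  ((exists n, dual_exact_at F n) ->
     ~ golod (quot_image (ideal_pow t 3) t)).
Proof.
move=> std emb e3 soc ngor Fn0 Fmin Fac T t.
have eE := (graded_embdim std soc e).1 emb; rewrite eE in e3.
have dR := R_dims std soc e3 ngor Fn0 Fmin Fac.
have R2g := R2_dim_gt1 std soc e3 ngor Fn0 Fmin Fac.
have gd := Tgd std soc e3 Fn0 Fmin Fac.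
have tE : t = _ := T_max std soc e3 Fn0 Fmin Fac.
have sh := graded_short std soc; have full := graded_full std soc.
have nosoc := R_nosoc std soc e3 Fn0 Fmin Fac.
have R2n0 := graded_R2_neq0 std soc.
have [dT1 dT2] := trivext_dimT sh full.
have gor : gorenstein T by apply: trivext_gorenstein.
have n_eq : (\dim (G 1%N) + \dim (G 1%N * G 1%N) = 2 * e - 1)%N by rewrite eE dR; lia.
rewrite n_eq in dT1 dT2.
split.
  exists (gd_grading (T1 (gp1 G) (gp2 G)) (T2 (gp1 G) (gp2 G)) (T3 (gp0 m))).
  split; first exact: (T_grading std soc).
  by rewrite tE; apply: (gd_graded_local gd).
split=> //; split.
  by rewrite tE; apply: (gd_compressed gd gor); rewrite dT1 ?dT2 // eE; lia.
split.
  by move=> i; rewrite tE (gd_hilb gd) dT1 dT2.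
split.
  by apply: (gd_not_complete_intersection gd); rewrite dT1 ?dT2 // eE; lia.
split.
  move=> no [a /(trivext_exact_zero_divisor sh full nosoc R2n0 dR R2g)]; exact: no.
case=> n dex; rewrite tE.
(* Numbering from [n] puts the spot where Hom(F, R) is exact at index 1, as [dual_spot] expects. *)
have lc := complex_left std soc e3 Fn0 Fmin Fac n.
have w_rec := strandT_recurrence sh full nosoc R2n0 lc dR R2g dex.
apply: (socle_quot_not_golod gd); first by rewrite dT1 dT2.
  by have [] := w_rec 0%N.
by move=> i; have [] := w_rec i.
Qed.
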